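(* Let $k\in\{3,4,5,6\}$, let $p$ be an odd prime in $\mathbf Z[\tau]$, let $q=|N(p)|$, and suppose that the reductions modulo $p$ of the matrices $\mathbf g$ and $\mathbf c$ defined in the context are non-singular. Then the group $G^p=\langle\mathbf r_0,\mathbf r_1,\mathbf r_2,\mathbf r_3\rangle^p$, generated by the reductions modulo $p$ of the matrices $\mathbf r_0,\mathbf r_1,\mathbf r_2,\mathbf r_3$ defined in the context, is an orthogonal group of type either $O(4,q,\varepsilon)$ or $O_1(4,q,\varepsilon)$, where $\varepsilon=\left(\frac{\det\mathbf g}{p}\right)_{\mathbf Z[\tau]}$.
   Context: Let $\tau=\frac{1+\sqrt5}{2}$, $\mathbf Z[\tau]=\{a+b\tau\mid a,b\in\mathbf Z\}$, with norm $N(a+b\tau)=a^2+ab-b^2$. A prime of $\mathbf Z[\tau]$ is called odd if it is not an associate of $2$. For an odd prime $p$, $\mathbf F_q=\mathbf Z[\tau]/(p)$ is a finite field of odd order $q=|N(p)|$. For $a\in\mathbf Z[\tau]$ the Legendre symbol $\left(\frac{a}{p}\right)_{\mathbf Z[\tau]}$ is $0$ if $a\equiv0\pmod p$, is $1$ if $a$ is a quadratic residue modulo $p$ (i.e. a nonzero square in $\mathbf F_q$), and is $-1$ if it is a quadratic non-residue. For $k\in\{3,4,5,6\}$ put $\rho_3=1$, $\rho_4=2$, $\rho_5=\tau^2$, $\rho_6=3$, and define the matrices over $\mathbf Z[\tau]$ $$\mathbf r_0=\begin{bmatrix}-1&\tau^2&0&0\\0&1&0&0\\0&0&1&0\\0&0&0&1\end{bmatrix},\quad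 \mathbf r_1=\begin{bmatrix}1&0&0&0\\1&-1&1&\rho_k\\0&0&1&0\\0&0&0&1\end{bmatrix},$$ $$\mathbf r_2=\begin{bmatrix}1&0&0&0\\0&1&0&0\\0&1&-1&0\\0&0&0&1\end{bmatrix},\quad \mathbf r_3=\begin{bmatrix}1&0&0&0\\0&1&0&0\\0&0&1&0\\0&1&0&-1\end{bmatrix},$$ $$\mathbf g=\begin{bmatrix}4&-2\tau^2&0&0\\-2\tau^2&4\tau^2&-2\tau^2&-2\tau^2\rho_k\\0&-2\tau^2&4\tau^2&0\\0&-2\tau^2\rho_k&0&4\tau^2\rho_k\end{bmatrix},\quad \mathbf c=\begin{bmatrix}2&-\tau^2&0&0\\-1&2&-1&-\rho_k\\0&-1&2&0\\0&-1&0&2\end{bmatrix}.$$ Reducing the entries of the $\mathbf r_i$ modulo $p$ gives the subgroup $G^p=\langle\mathbf r_0,\mathbf r_1,\mathbf r_2,\mathbf r_3\rangle^p$ of $GL(4,\mathbf F_q)$. It acts on the $4$-dimensional $\mathbf F_q$-space $V$ with basis $v_0,v_1,v_2,v_3$ (matrices acting on coordinate column vectors), endowed with the symmetric bilinear form $(\cdot)_p$ whose Gram matrix in this basis is $\mathbf g \bmod p$. When this form is non-singular, $\mathbf r_i\bmod p$ is the reflection with root $v_i$. Orthogonal groups: let $V$ be an $n$-dimensional space over $\mathbf F_q$ ($q$ odd) with a non-singular symmetric bilinear form $(\cdot)_V$. The full orthogonal group is the group of all invertible linear maps of $V$ preserving the form. For $n$ even it is denoted $O(n,q,\varepsilon)$,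 where $\varepsilon=1$ if $(-1)^{n/2}$ times the determinant of a Gram matrix of the form is a square in $\mathbf F_q^*$, and $\varepsilon=-1$ otherwise. For $v\in V$ with $(v\cdot v)_V\neq0$, the reflection with root $v$ is $r_v(x)=x-2\frac{(x\cdot v)_V}{(v\cdot v)_V}v$. The subgroup $O_1(n,q,\varepsilon)$ is $\langle r_v\mid (v\cdot v)_V\in(\mathbf F_q^* )^2\rangle$. Here these groups are taken for $V$ with the form $(\cdot)_p$. *)

(* Defs.v *)
From HB Require Import structures.
From mathcomp Require Import all_boot all_order all_algebra all_fingroup all_field.
From mathcomp Require Import generic_quotient ring_quotient.
From mathcomp Require Import ring zify.

Set Implicit Arguments.
Unset Strict Implicit.
Unset Printing Implicit Defensive.

Import Order.TTheory GRing.Theory Num.Theory.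
Local Open Scope ring_scope.
Local Open Scope quotient_scope.

(* [ZTau a b] stands for a + b * tau with tau ^ 2 = tau + 1; [ztau_eval] below
   is the corresponding embedding into the real numbers. *)
Record ztau := ZTau { zre : int; ztc : int }.

Definition ztau_pair (x : ztau) : int * int := (zre x, ztc x).
Definition pair_ztau (x : int * int) : ztau := ZTau x.1 x.2.

Lemma ztau_pairK : cancel ztau_pair pair_ztau.
Proof. by case. Qed.

HB.instance Definition _ := Countable.copy ztau (can_type ztau_pairK).

Definition zt_add (x y : ztau) := ZTau (zre x + zre y) (ztc x + ztc y).
Definition zt_opp (x : ztau) := ZTau (- zre x) (- ztc x).
Definition zt_mul (x y : ztau) :=
  ZTau (zre x * zre y + ztc x * ztc y)
       (zre x * ztc y + ztc x * zre y + ztc x * ztc y).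

Lemma zt_addA : associative zt_add.
Proof. by move=> x y z; congr ZTau; exact: addrA. Qed.
Lemma zt_addC : commutative zt_add.
Proof. by move=> x y; congr ZTau; exact: addrC. Qed.
Lemma zt_add0 : left_id (ZTau 0 0) zt_add.
Proof. by case=> a b; congr ZTau; exact: add0r. Qed.
Lemma zt_addN : left_inverse (ZTau 0 0) zt_opp zt_add.
Proof. by move=> x; congr ZTau; exact: addNr. Qed.

HB.instance Definition _ :=
  GRing.isZmodule.Build ztau zt_addA zt_addC zt_add0 zt_addN.

Lemma zt_mulA : associative zt_mul.
Proof. by move=> [a b] [c d] [e f]; congr ZTau => /=; ring. Qed.
Lemma zt_mulC : commutative zt_mul.
Proof. by move=> [a b] [c d]; congr ZTau => /=; ring. Qed.
Lemma zt_mul1 : left_id (ZTau 1 0) zt_mul.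
Proof. by move=> [a b]; congr ZTau => /=; ring. Qed.
Lemma zt_mulD : left_distributive zt_mul zt_add.
Proof. by move=> [a b] [c d] [e f]; congr ZTau => /=; ring. Qed.
Lemma zt_one_neq0 : ZTau 1 0 != 0.
Proof. by []. Qed.

HB.instance Definition _ := GRing.Zmodule_isComNzRing.Build ztau
  zt_mulA zt_mulC zt_mul1 zt_mulD zt_one_neq0.

Definition tau : ztau := ZTau 0 1.

Definition zt_norm (x : ztau) : int := zre x ^+ 2 + zre x * ztc x - ztc x ^+ 2.

Definition zt_conj (x : ztau) : ztau := ZTau (zre x + ztc x) (- ztc x).

Lemma zt_normM x y : zt_norm (x * y) = zt_norm x * zt_norm y.
Proof. by case: x y => [a b] [c d]; rewrite /zt_norm /=; ring. Qed.

Lemma zt_mul_conj x : x * zt_conj x = ZTau (zt_norm x) 0.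
Proof. by case: x => [a b]; congr ZTau; rewrite /zt_norm /=; ring. Qed.

Lemma zt_intM (m : int) x : ZTau m 0 * x = ZTau (m * zre x) (m * ztc x).
Proof. by case: x => [a b]; congr ZTau => /=; ring. Qed.

Lemma sqr_eq_5sqr (c b : nat) : (c ^ 2 = 5 * b ^ 2)%N -> b = 0%N.
Proof.
move=> E; apply/eqP; case: (posnP b) => // b0.
have c0 : (0 < c)%N by rewrite -sqrn_gt0 E muln_gt0 sqrn_gt0.
have := congr1 (logn 5) E; rewrite lognM ?expn_gt0 ?b0 // !lognX.
by rewrite (_ : logn 5 5 = 1%N) // => /(congr1 odd); rewrite oddD !oddM.
Qed.

Lemma zt_norm_eq0 x : (zt_norm x == 0) = (x == 0).
Proof.
apply/eqP/eqP => [|->] //; case: x => a b; rewrite /zt_norm /= => N0.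
have E : ((a *+ 2 + b) ^+ 2 = 5%:Z * b ^+ 2).
  by apply/eqP; rewrite -subr_eq0 -(mulr0 4) -N0; apply/eqP; ring.
have b0 : b = 0.
  apply/eqP; rewrite -absz_eq0; apply/eqP.
  apply: (@sqr_eq_5sqr (absz (a *+ 2 + b))).
  by rewrite -!abszX E abszM abszX.
move: N0; rewrite b0 mulr0 expr0n /= addr0 subr0 => /eqP.
by rewrite sqrf_eq0 => /eqP ->.
Qed.

Definition zt_unit : pred ztau := fun x => `|zt_norm x|%N == 1%N.
Definition zt_inv (x : ztau) : ztau :=
  if zt_unit x then ZTau (zt_norm x) 0 * zt_conj x else x.

Lemma zt_mulVr : {in zt_unit, left_inverse 1 zt_inv *%R}.
Proof.
move=> x; rewrite -topredE /= /zt_inv => ux; rewrite ux -mulrA [_ * x]mulrC.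
rewrite zt_mul_conj zt_intM mulr0; congr ZTau.
by move: ux; rewrite /zt_unit; case: (zt_norm x) => [[|[|m]]|[|m]].
Qed.

Lemma zt_unitPl x y : y * x = 1 -> zt_unit x.
Proof.
move=> /(congr1 (fun z => `|zt_norm z|%N)); rewrite zt_normM abszM.
by rewrite mulnC => /eqP; rewrite muln_eq1 => /andP[].
Qed.

Lemma zt_inv_out : {in [predC zt_unit], zt_inv =1 id}.
Proof. by move=> x; rewrite inE -topredE /zt_inv /= => /negbTE ->. Qed.

HB.instance Definition _ := GRing.ComNzRing_hasMulInverse.Build ztau
  zt_mulVr zt_unitPl zt_inv_out.

Lemma zt_integral : GRing.integral_domain_axiom ztau.
Proof.
move=> x y xy0; rewrite -!zt_norm_eq0 -mulf_eq0 -zt_normM xy0.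
by rewrite zt_norm_eq0.
Qed.

HB.instance Definition _ :=
  GRing.ComUnitRing_isIntegral.Build ztau zt_integral.

Section Embedding.
Variable R : rcfType.

Definition ztau_eval (x : ztau) : R :=
  (zre x)%:~R + (ztc x)%:~R * ((1 + Num.sqrt 5) / 2).

Lemma golden_ratio_sqr :
  ((1 + Num.sqrt 5) / 2) ^+ 2 = (1 + Num.sqrt 5) / 2 + 1 :> R.
Proof.
have s5 : Num.sqrt 5 ^+ 2 = 5 :> R by rewrite sqr_sqrtr ?ler0n.
by field: s5.
Qed.

Lemma ztau_eval_is_zmod_morphism : zmod_morphism ztau_eval.
Proof. by move=> [a b] [c d]; rewrite /ztau_eval /=; ring. Qed.

Lemma ztau_eval_is_monoid_morphism : monoid_morphism ztau_eval.
Proof.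
split; first by rewrite /ztau_eval /= mul0r addr0.
move=> [a b] [c d]; rewrite /ztau_eval /=.
by have := golden_ratio_sqr; move: (_ / _) => t t2; ring: t2.
Qed.

HB.instance Definition _ :=
  GRing.isZmodMorphism.Build ztau R ztau_eval ztau_eval_is_zmod_morphism.
HB.instance Definition _ :=
  GRing.isMonoidMorphism.Build ztau R ztau_eval ztau_eval_is_monoid_morphism.

Lemma ztau_eval_inj : injective ztau_eval.
Proof.
apply: raddf_inj => x x0; apply/eqP; rewrite -zt_norm_eq0.
have : ztau_eval (x * zt_conj x) = 0 by rewrite rmorphM /= x0 mul0r.
by rewrite zt_mul_conj /ztau_eval /= mul0r addr0 => /eqP; rewrite intr_eq0.
Qed.

End Embedding.

Definition zt_dvd (d a : ztau) : Prop := exists c, a = c * d.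

Definition zt_prime (p : ztau) : Prop :=
  [/\ p != 0, p \isn't a GRing.unit &
      forall a b, zt_dvd p (a * b) -> zt_dvd p a \/ zt_dvd p b].

Definition zt_associate (a b : ztau) : Prop :=
  exists2 u, u \is a GRing.unit & a = u * b.

Definition zt_odd (p : ztau) : Prop := ~ zt_associate p 2%:R.

Section Residue.
Variables (p : ztau) (hp : zt_prime p).

(* The ideal (p), as a decidable predicate; see [prime_idealP]. *)
Definition prime_ideal of zt_prime p : {pred ztau} := fun a =>
  (zt_norm p %| zre (a * zt_conj p))%Z && (zt_norm p %| ztc (a * zt_conj p))%Z.

Lemma prime_idealP a : reflect (zt_dvd p a) (a \in prime_ideal hp).
Proof.
have [p0 _ _] := hp.
apply: (iffP andP) => [[/dvdzP[u hu] /dvdzP[v hv]]|[c ->]].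
  exists (ZTau u v); apply: (mulIf (_ : zt_conj p != 0)).
    apply: contraNneq p0 => cp; rewrite -zt_norm_eq0.
    by have /(congr1 zre) := zt_mul_conj p; rewrite cp mulr0 => /= <-.
  rewrite -mulrA zt_mul_conj [ZTau u v * _]mulrC zt_intM /= ![zt_norm p * _]mulrC -hu -hv.
  by case: (a * _).
by rewrite -mulrA zt_mul_conj mulrC zt_intM /= !dvdz_mulr.
Qed.

Lemma prime_ideal_closed : idealr_closed (prime_ideal hp).
Proof.
have [p0 pu _] := hp; split.
- by apply/prime_idealP; exists 0; rewrite mul0r.
- apply/negP=> /prime_idealP[c c1]; case/negP: pu.
  by apply: (zt_unitPl (esym c1)).
- move=> a x y /prime_idealP[c ->] /prime_idealP[d ->].
  by apply/prime_idealP; exists (a * c + d); rewrite mulrDl mulrA.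
Qed.

Lemma prime_ideal_prime : prime_idealr_closed (prime_ideal hp).
Proof.
have [_ _ pM] := hp => a b /prime_idealP/pM[] h; apply/orP.
  by left; apply/prime_idealP.
by right; apply/prime_idealP.
Qed.

HB.instance Definition _ :=
  isIdealr.Build ztau (prime_ideal hp) prime_ideal_closed.
HB.instance Definition _ :=
  isPrimeIdealrClosed.Build ztau (prime_ideal hp) prime_ideal_prime.

Definition residue : Type := {ideal_quot (prime_ideal hp)}.

HB.instance Definition _ := GRing.ComNzRing.on residue.

Definition zt_mod (a : ztau) : residue := \pi_({ideal_quot (prime_ideal hp)}) a.

Lemma zt_mod_is_zmod_morphism : zmod_morphism zt_mod.
Proof. exact: (rmorphB \pi_({ideal_quot (prime_ideal hp)})). Qed.

Lemma zt_mod_is_monoid_morphism : monoid_morphism zt_mod.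
Proof.
split; first exact: (rmorph1 \pi_({ideal_quot (prime_ideal hp)})).
exact: (rmorphM \pi_({ideal_quot (prime_ideal hp)})).
Qed.

HB.instance Definition _ :=
  GRing.isZmodMorphism.Build ztau residue zt_mod zt_mod_is_zmod_morphism.
HB.instance Definition _ :=
  GRing.isMonoidMorphism.Build ztau residue zt_mod zt_mod_is_monoid_morphism.

Lemma zt_mod_eq0 a : reflect (zt_dvd p a) (zt_mod a == 0).
Proof.
rewrite -(rmorph0 zt_mod) -[_ == _]Quotient.idealrBE subr0; exact: prime_idealP.
Qed.

Lemma zt_mod_surj (x : residue) : exists a, zt_mod a = x.
Proof. by exists (repr x); rewrite /zt_mod reprK. Qed.

Lemma residue_reprK :
  cancel (fun x : residue => repr (x : {ideal_quot (prime_ideal hp)})) zt_mod.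
Proof. exact: reprK. Qed.

HB.instance Definition _ :=
  Choice_isCountable.Build residue (pcan_pickleK (can_pcan residue_reprK)).

Definition residue_enum : seq residue :=
  let s := [seq Posz m | m <- iota 0 `|zt_norm p|%N] in
  undup [seq zt_mod (ZTau a b) | a <- s, b <- s].

Lemma residue_enumP : Finite.axiom residue_enum.
Proof.
apply: Finite.uniq_enumP (undup_uniq _) _ => x; rewrite mem_undup.
have [[a b] <-] := zt_mod_surj x.
have [p0 _ _] := hp; have N0 : zt_norm p != 0 by rewrite zt_norm_eq0.
set N := zt_norm p in N0 *.
have memN c : (c %% N)%Z \in [seq Posz m | m <- iota 0 `|N|%N].
  apply/mapP; exists `|(c %% N)%Z|%N; last by rewrite gez0_abs // modz_ge0.
  by rewrite mem_iota /= add0n -ltz_nat gez0_abs ?modz_ge0 // ltz_mod.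
apply/allpairsP; exists ((a %% N)%Z, (b %% N)%Z); split; rewrite ?memN //=.
apply/eqP; rewrite -subr_eq0 -rmorphB /=; apply/zt_mod_eq0.
exists (ZTau (a %/ N)%Z (b %/ N)%Z * zt_conj p).
rewrite -mulrA [_ * p]mulrC zt_mul_conj mulrC zt_intM; congr ZTau.
  by rewrite {1}(divz_eq a N) addrK mulrC.
by rewrite {1}(divz_eq b N) addrK mulrC.
Qed.

HB.instance Definition _ := isFinite.Build residue residue_enumP.

Lemma residue_integral (x y : residue) : x * y = 0 -> (x == 0) || (y == 0).
Proof. exact: Quotient.rquot_IdomainAxiom. Qed.

Definition residue_inv (x : residue) : residue :=
  odflt 0 [pick y : residue | y * x == 1].

Lemma residue_mulVr x : x != 0 -> residue_inv x * x = 1.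
Proof.
move=> x0; rewrite /residue_inv; case: pickP => [y /eqP //|no].
have inj : injective (fun y : residue => y * x).
  move=> y z /eqP; rewrite -subr_eq0 -mulrBl => /eqP /residue_integral.
  by rewrite (negbTE x0) orbF subr_eq0 => /eqP.
by have := no (invF inj 1); rewrite (f_invF inj) eqxx.
Qed.

Lemma residue_inv0 : residue_inv 0 = 0.
Proof.
rewrite /residue_inv; case: pickP => // y.
by rewrite mulr0 eq_sym oner_eq0.
Qed.

HB.instance Definition _ :=
  GRing.ComNzRing_isField.Build residue residue_mulVr residue_inv0.

Definition residue_field : finFieldType := residue.

Definition zt_red : {rmorphism ztau -> residue_field} := zt_mod.

End Residue.

Definition nonzero_square (F : finFieldType) (a : F) : bool :=
  [exists c : F, (c != 0) && (a == c ^+ 2)].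

Definition legendre (p : ztau) (hp : zt_prime p) (a : ztau) : int :=
  if zt_red hp a == 0 then 0
  else if nonzero_square (zt_red hp a) then 1 else -1.

Section OrthogonalGroups.
Variables (F : finFieldType) (n' : nat).
Local Notation n := n'.+1.
(* The space V is F^n, written as column vectors; B is the Gram matrix. *)
Variable B : 'M[F]_n.
Implicit Types (x y v : 'cV[F]_n) (A : {'GL_n[F]}).

Definition bform x y : F := (x^T *m B *m y) 0 0.

Definition full_orthogonal : {set {'GL_n[F]}} :=
  [set A : {'GL_n[F]} | [forall x : 'cV[F]_n, forall y : 'cV[F]_n,
     bform (GLval A *m x) (GLval A *m y) == bform x y]].

Definition reflection v x : 'cV[F]_n :=
  x - (2 * (bform x v / bform v v)) *: v.

Definition square_reflections : {set {'GL_n[F]}} :=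
  [set A : {'GL_n[F]} | [exists v : 'cV[F]_n,
     nonzero_square (bform v v) &&
     [forall x : 'cV[F]_n, GLval A *m x == reflection v x]]].

Definition orthogonal1 : {set {'GL_n[F]}} := <<square_reflections>>%g.

Definition orth_sign : int :=
  if nonzero_square ((-1) ^+ n./2 * \det B) then 1 else -1.

Definition orth_space (q : nat) (eps : int) : Prop :=
  [/\ #|F| = q, odd q, ~~ odd n,
      B^T = B /\ B \in unitmx & orth_sign = eps].

Definition is_O (q : nat) (eps : int) (G : {set {'GL_n[F]}}) : Prop :=
  orth_space q eps /\ G = full_orthogonal.

Definition is_O1 (q : nat) (eps : int) (G : {set {'GL_n[F]}}) : Prop :=
  orth_space q eps /\ G = orthogonal1.

End OrthogonalGroups.

Definition mx4 (s : seq (seq ztau)) : 'M[ztau]_4 :=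
  \matrix_(i, j) nth 0 (nth [::] s i) j.

(* Only meaningful for k in {3, 4, 5, 6}. *)
Definition rho (k : nat) : ztau :=
  match k with
  | 3 => 1
  | 4 => 2%:R
  | 5 => tau ^+ 2
  | _ => 3%:R
  end.

Definition r0 : 'M[ztau]_4 := mx4
  [:: [:: -1; tau ^+ 2; 0; 0];
      [:: 0;  1;        0; 0];
      [:: 0;  0;        1; 0];
      [:: 0;  0;        0; 1] ].

Definition r1 (k : nat) : 'M[ztau]_4 := mx4
  [:: [:: 1;  0; 0; 0];
      [:: 1; -1; 1; rho k];
      [:: 0;  0; 1; 0];
      [:: 0;  0; 0; 1] ].

Definition r2 : 'M[ztau]_4 := mx4
  [:: [:: 1; 0;  0; 0];
      [:: 0; 1;  0; 0];
      [:: 0; 1; -1; 0];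
      [:: 0; 0;  0; 1] ].

Definition r3 : 'M[ztau]_4 := mx4
  [:: [:: 1; 0; 0;  0];
      [:: 0; 1; 0;  0];
      [:: 0; 0; 1;  0];
      [:: 0; 1; 0; -1] ].

Definition gram (k : nat) : 'M[ztau]_4 := let t2 := tau ^+ 2 in mx4
  [:: [:: 4%:R;          - 2%:R * t2;          0;             0];
      [:: - 2%:R * t2;   4%:R * t2;            - 2%:R * t2;   - 2%:R * t2 * rho k];
      [:: 0;             - 2%:R * t2;          4%:R * t2;     0];
      [:: 0;             - 2%:R * t2 * rho k;  0;             4%:R * t2 * rho k] ].

Definition cartan (k : nat) : 'M[ztau]_4 := mx4
  [:: [:: 2%:R; - tau ^+ 2; 0;    0];
      [:: -1;   2%:R;       -1;   - rho k];
      [:: 0;    -1;         2%:R; 0];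
      [:: 0;    -1;         0;    2%:R] ].

Lemma invol_unitmx (M : 'M[ztau]_4) : M *m M = 1%:M -> M \in unitmx.
Proof. by move=> MM; case/mulmx1_unit: MM. Qed.

Ltac mx4_invol :=
  apply: invol_unitmx; apply/matrixP;
  move=> [[|[|[|[|?]]]] ?] // [[|[|[|[|?]]]] ?] //;
  rewrite !mxE !big_ord_recr big_ord0 /= !mxE /= ?mulr1n ?mulr0n;
  rewrite ?(mul0r, mulr0, add0r, addr0, mul1r, mulr1, mulrNN, mulN1r, mulrN1,
            addNr, addrN) //.

Lemma r0_unit : r0 \in unitmx. Proof. mx4_invol. Qed.
Lemma r1_unit k : r1 k \in unitmx.
Proof. by rewrite /r1; move: (rho k) => x; mx4_invol. Qed.
Lemma r2_unit : r2 \in unitmx. Proof. mx4_invol. Qed.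
Lemma r3_unit : r3 \in unitmx. Proof. mx4_invol. Qed.

Lemma map_mx_is_unit (R S : comUnitRingType) (f : {rmorphism R -> S}) n
  (M : 'M[R]_n.+1) : M \in unitmx -> map_mx f M \is a GRing.unit.
Proof.
move=> uM; rewrite -[map_mx f M \is a GRing.unit]/(map_mx f M \in unitmx).
by rewrite unitmxE det_map_mx; apply: rmorph_unit; rewrite -unitmxE.
Qed.

Definition GL_map (R : comUnitRingType) (F : finFieldType)
  (f : {rmorphism R -> F}) n (M : 'M[R]_n.+1) (uM : M \in unitmx) :
  {'GL_n.+1[F]} := FinRing.Unit (map_mx_is_unit f uM).

Definition reflection_group (F : finFieldType) (f : {rmorphism ztau -> F})
  (k : nat) : {group {'GL_4[F]}} :=
  <<[set GL_map f r0_unit; GL_map f (r1_unit k);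
         GL_map f r2_unit; GL_map f r3_unit]>>%G.

(* Main.v *)
Require Import Defs.
From mathcomp Require Import all_boot all_order all_algebra all_fingroup all_field.
From mathcomp Require Import ring zify.

(** Call a vector [v] of nonzero norm a mirror if the reflection with root [v]
    lies in the group [G] generated by the four given reflections. Mirrors can
    be rescaled, and reflecting one mirror in another gives a mirror, because
    the reflection in the image is a conjugate. The core of the proof
    ([mirrors_complete]) is that mirrors fill whole norm classes: if [v] is a
    mirror, so is every [w] with the norm of [v]. The first three roots have
    square norm and the fourth has norm [rho] times a square. If [rho] is a
    square modulo [p], then [G] is generated by reflections of square norm and
    contains all of them. Otherwise both square classes of norms occur among
    the mirrors, so every reflection lies in [G], and reflections generate the
    full orthogonal group ([full_orthogonal_sub]).

    To fill a norm class, choose three mirrors [f0], [f1], [f2] with [f0]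
    orthogonal to [f2] and [f1] orthogonal to neither, spanning a
    nondegenerate 3-space. Over a finite field such a space is similar to the
    traceless two by two matrices under the determinant, and the whole 4-space
    is then modelled on all two by two matrices, the scalars being the
    orthogonal line ([model], [model_form]). On traceless matrices the
    reflection in [a] is [x |-> - a x a^-1] ([mrefl_cj]), so one studies the
    group [K] of matrices whose conjugation preserves the traceless mirrors;
    traceless mirrors themselves belong to [K].

    - [K] contains a unipotent [1 + N]. If not, every nonscalar element of [K]
      has exactly two poles, and the orbit count that classifies the finite
      rotation groups applies ([two_pole_orbit]): an element of order at least
      six modulo scalars has an axis preserved by all of [K], which the linked
      half turns [f0], [f1], [f2] exclude ([linked_half_turns_no_axis]). In
      each diagram a product of two mirrors has order at least six or is
      itself unipotent up to a scalar.

    - [K] contains [1 + u N] for all [u] in the residue field [F], which is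
      spanned by 1 and [tau] over its prime field. The angle [pi / 5] between
      [f0] and [f1] gives a conjugate [N'] of [N] whose pairing with [N] is
      not in the prime field ([irrational_pairing]), unless the prime field is
      [F] already. An argument in the style of Dickson's theorem on subgroups
      of SL2 then yields the root subgroup over [F] ([lower_generated]).

    - A conjugate of the root subgroup by a mirror is an opposite one. The two
      generate SL2, which is transitive on the vectors of a given nonzero norm
      in the 3-space ([sl2_transitive]); a mirror outside the 3-space and its
      orthogonal line spreads this to the slices parallel to the 3-space, and
      two reflections bring any vector of nonzero norm back to it
      ([refl_to_trless], [mirror_class_complete]).

    In characteristic 3 the field has nine elements and short words in the
    generators exhibit two mirrors whose difference is isotropic, which gives
    the root subgroup at once ([complete_of_parallel], [complete_nine]).

    That [F] has [|N p|] elements is obtained by decomposing residues modulo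
    the norm into residues modulo [p] and modulo its conjugate
    ([card_residue]). *)
Set Implicit Arguments.
Unset Strict Implicit.
Unset Printing Implicit Defensive.
Import Order.TTheory GRing.Theory Num.Theory.
Local Open Scope ring_scope.

(** * Two by two matrices *)

Section Mx2.
Variable F : fieldType.
Implicit Types (M N x : 'M[F]_2).

(** Every matrix of size two has this form, so an identity between such
    matrices becomes four polynomial identities ([mx2c]). *)
Definition mx2 (a b c d : F) : 'M[F]_2 :=
  \matrix_(i, j) if i == 0 then if j == 0 then a else b
                 else if j == 0 then c else d.

Lemma mx2_eta M : M = mx2 (M 0 0) (M 0 1) (M 1 0) (M 1 1).
Proof.
apply/matrixP => i j; rewrite mxE.
by case: i => [[|[|i]] hi] //; case: j => [[|[|j]] hj] //=; congr (M _ _); apply: val_inj.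
Qed.

Lemma mx2P M : exists a b c d, M = mx2 a b c d.
Proof. by do 4!eexists; exact: mx2_eta. Qed.

Lemma mx2_inj a b c d a' b' c' d' : mx2 a b c d = mx2 a' b' c' d' ->
  [/\ a = a', b = b', c = c' & d = d'].
Proof. by move/matrixP=> E; split; [have := E 0 0|have := E 0 1|have := E 1 0|have := E 1 1]; rewrite !mxE. Qed.

Lemma mx2D a b c d a' b' c' d' :
  mx2 a b c d + mx2 a' b' c' d' = mx2 (a + a') (b + b') (c + c') (d + d').
Proof. by rewrite [LHS]mx2_eta !mxE. Qed.
Lemma mx2N a b c d : - mx2 a b c d = mx2 (- a) (- b) (- c) (- d).
Proof. by rewrite [LHS]mx2_eta !mxE. Qed.
Lemma mx2Z k a b c d : k *: mx2 a b c d = mx2 (k * a) (k * b) (k * c) (k * d).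
Proof. by rewrite [LHS]mx2_eta !mxE. Qed.
Lemma mx2S k : k%:M = mx2 k 0 0 k.
Proof. by rewrite [LHS]mx2_eta !mxE. Qed.
Lemma mx2_1 : 1 = mx2 1 0 0 1.
Proof. exact: mx2S. Qed.
Lemma mx2_0 : 0 = mx2 0 0 0 0.
Proof. by rewrite [LHS]mx2_eta !mxE. Qed.
Lemma mx2M a b c d a' b' c' d' : mx2 a b c d * mx2 a' b' c' d' =
  mx2 (a * a' + b * c') (a * b' + b * d') (c * a' + d * c') (c * b' + d * d').
Proof. by rewrite [LHS]mx2_eta !mxE !big_ord_recl !big_ord0 !mxE /= !addr0. Qed.
Lemma mx2_tr a b c d : \tr (mx2 a b c d) = a + d.
Proof. by rewrite /mxtrace !big_ord_recl big_ord0 !mxE /= addr0. Qed.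
Lemma mx2_det a b c d : \det (mx2 a b c d) = a * d - b * c.
Proof.
rewrite (expand_det_row _ ord0) !big_ord_recl big_ord0 addr0.
by rewrite /cofactor /= !det_mx11 !mxE /= !expr0 !expr1 mul1r mulN1r mulrN.
Qed.

Definition mx2E := (mx2D, mx2N, mx2Z, mx2S, mx2_1, mx2_0, mx2M, mx2_tr, mx2_det).

End Mx2.

Ltac mx2c := rewrite ?mx2E; try (congr mx2); try ring.

Section Mx2Theory.
Variable F : fieldType.
Implicit Types (M N x a : 'M[F]_2).

Lemma mx2_unit M : (M \is a GRing.unit) = (\det M != 0).
Proof. by rewrite -[LHS]/(M \in unitmx) unitmxE unitfE. Qed.

Lemma cayley2 M : M * M = \tr M *: M - (\det M)%:M.
Proof. by have [a [b [c [d ->]]]] := mx2P M; mx2c. Qed.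

Lemma detM2 M N : \det (M * N) = \det M * \det N.
Proof. exact: det_mulmx. Qed.
Lemma trM2C M N : \tr (M * N) = \tr (N * M).
Proof. exact: mxtrace_mulC. Qed.

Definition cj M x := M * x * M^-1.

Lemma cjM M N x : M \is a GRing.unit -> N \is a GRing.unit ->
  cj (M * N) x = cj M (cj N x).
Proof. by move=> uM uN; rewrite /cj invrM // !mulrA. Qed.
Lemma cj_tr M x : M \is a GRing.unit -> \tr (cj M x) = \tr x.
Proof. by move=> uM; rewrite /cj trM2C mulrA mulVr // mul1r. Qed.
Lemma cj_det M x : M \is a GRing.unit -> \det (cj M x) = \det x.
Proof.
move=> uM; rewrite /cj !detM2 mulrAC -detM2 mulrV // det1 mul1r //.
Qed.
Lemma cjD M x y : cj M (x + y) = cj M x + cj M y.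
Proof. by rewrite /cj mulrDr mulrDl. Qed.
Lemma cjZ M c x : cj M (c *: x) = c *: cj M x.
Proof. by rewrite /cj -scalerAr -scalerAl. Qed.
Lemma cjMr M x y : M \is a GRing.unit -> cj M (x * y) = cj M x * cj M y.
Proof. by move=> uM; rewrite /cj !mulrA mulrVK. Qed.
Lemma cj1 M : M \is a GRing.unit -> cj M 1 = 1.
Proof. by move=> uM; rewrite /cj mulr1 mulrV. Qed.
Lemma cjS M c : M \is a GRing.unit -> cj M c%:M = c%:M.
Proof. by move=> uM; rewrite -scalemx1 cjZ cj1. Qed.
Lemma cjK M x : M \is a GRing.unit -> cj M^-1 (cj M x) = x.
Proof. by move=> uM; rewrite -cjM ?unitrV // mulVr // /cj mul1r invr1 mulr1. Qed.
Lemma cjVK M x : M \is a GRing.unit -> cj M (cj M^-1 x) = x.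
Proof. by move=> uM; rewrite -cjM ?unitrV // mulrV // /cj mul1r invr1 mulr1. Qed.
Lemma cjP M x y : M \is a GRing.unit -> M * x = y * M -> cj M x = y.
Proof. by move=> uM E; rewrite /cj E mulrK. Qed.
Lemma cj_scal c M x : c != 0 -> M \is a GRing.unit -> cj (c *: M) x = cj M x.
Proof.
move=> c0 uM; apply: cjP; first by rewrite mx2_unit detZ mulf_neq0 ?expf_neq0 -?mx2_unit.
by rewrite -scalerAl -scalerAr /cj mulrVK.
Qed.

Lemma trless_sqr a : \tr a = 0 -> a * a = (- \det a)%:M.
Proof. by move=> a0; rewrite cayley2 a0 scale0r add0r (raddfN (@scalar_mx F 2)). Qed.
End Mx2Theory.

(** * Squares in a finite field *)

Section FinField.
Variable F : finFieldType.
Hypothesis two : (2%:R : F) != 0.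

Lemma four_neq0 : 4%:R != 0 :> F.
Proof. by rewrite (natrM F 2 2) mulf_neq0. Qed.

Lemma card_natr : #|F|%:R = 0 :> F.
Proof.
have := cyclic.expg_cardG (in_setT (1 : F)); rewrite cardsT FinRing.zmodXgE => h.
exact: h.
Qed.

Lemma exists_notin (s : seq F) : (size s < #|F|)%N -> exists x, x \notin s.
Proof.
move=> sF; apply/existsP; rewrite -negb_forall; apply/negP => /forallP all_s.
have sub : predT \subset s by apply/subsetP => x _; exact: all_s.
by have := leq_trans (subset_leq_card sub) (card_size s); rewrite leqNgt sF.
Qed.

Definition squares : {set F} := [set x ^+ 2 | x : F].

(** The map [x |-> (x ^ 2, b)] is injective on nonzero [x] once the bit [b]
    tells [x] from [- x]; 0 is a further square. *)
Lemma two_card_squares : (#|F| < 2 * #|squares|)%N.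
Proof.
pose h (x : F) := (x ^+ 2, (enum_rank x < enum_rank (- x))%N).
pose A := setX (squares :\ 0) [set: bool].
have inj : {in [set~ 0] &, injective h}.
  move=> x y; rewrite !inE => x0 y0 [] /eqP; rewrite eqf_sqr => /orP[/eqP //|/eqP ->].
  rewrite opprK => E; have ne : y != - y.
    by rewrite -subr_eq0 opprK -mulr2n -mulr_natl mulf_neq0.
  case/eqP: ne; apply/enum_rank_inj/val_inj/eqP => /=; rewrite eqn_leq.
  by move: E; rewrite !ltnNge => /negb_inj; case: leqP => //= /ltnW ->.
have sub : h @: [set~ 0] \subset A.
  apply/subsetP => z /imsetP[x xA ->]; move: xA; rewrite in_setC1 => x0.
  by rewrite /A /h in_setX !inE /= sqrf_eq0 x0 andbT; apply/imsetP; exists x.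
have := subset_leq_card sub; rewrite card_in_imset // cardsX cardsT card_bool.
have s0 : 0 \in squares by apply/imsetP; exists 0; rewrite // expr0n.
rewrite cardsC1; have := cardsD1 0 squares; rewrite s0 => ->.
move: #|squares :\ 0| (finNzRing_gt1 F) => m; case: #|F| => [|n] _ /= le; lia.
Qed.

Lemma card_meet (A B : {set F}) : (#|F| < #|A| + #|B|)%N ->
  exists2 x, x \in A & x \in B.
Proof.
move=> ltF; have [e|[x /setIP[xA xB]]] := set_0Vmem (A :&: B); last by exists x.
have := cardsUI A B; rewrite e cards0 addn0 => E.
by have := max_card (A :|: B); rewrite E leqNgt ltF.
Qed.

(** The values of either summand fill more than half of the field, so the
    values of [a x ^ 2] and of [c - b y ^ 2] meet. *)
Lemma binary_universal (a b c : F) : a != 0 -> b != 0 ->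
  exists x y, a * x ^+ 2 + b * y ^+ 2 = c.
Proof.
move=> a0 b0.
have cardL : #|[set a * s | s in squares]| = #|squares|.
  by rewrite card_imset //; exact: mulfI.
have cardR : #|[set c - b * s | s in squares]| = #|squares|.
  by rewrite card_imset // => x y /addrI/oppr_inj/(mulfI b0).
have [|s /imsetP[_ /imsetP[x _ ->] ->] /imsetP[_ /imsetP[y _ ->] e]] :=
    @card_meet [set a * s | s in squares] [set c - b * s | s in squares].
  by rewrite cardL cardR addnn -mul2n two_card_squares.
by exists x, y; rewrite e subrK.
Qed.

Lemma nonzero_squareP (a : F) :
  reflect (exists2 c, c != 0 & a = c ^+ 2) (nonzero_square a).
Proof.
apply: (iffP existsP) => [[c /andP[c0 /eqP ->]]|[c c0 ->]]; exists c => //.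
by rewrite c0 eqxx.
Qed.

(** If [b] were not in [a] times the squares, that set and the squares, which
    have only 0 in common, would together miss [b] and still be too large. *)
Lemma square_class (a b : F) : a != 0 -> b != 0 ->
  ~~ nonzero_square a -> ~~ nonzero_square b -> exists2 c, c != 0 & b = c ^+ 2 * a.
Proof.
move=> a0 b0 na nb.
pose aS : {set F} := [set a * s | s in squares].
have cardR : #|aS| = #|squares|.
  by rewrite card_imset //; exact: mulfI.
have s0 : 0 \in squares by apply/imsetP; exists 0; rewrite // expr0n.
have bN : b \notin squares.
  apply: contraNN nb => /imsetP[c _ bc]; apply/nonzero_squareP; exists c => //.
  by apply: contraNneq b0 => c0; rewrite bc c0 expr0n.
have : b \in aS.
  apply: contraLR two_card_squares => bM; rewrite -leqNgt.
  have : (#|squares :|: aS| <= #|[set~ b]|)%N.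
    apply/subset_leq_card/subsetP => x; rewrite !inE.
    by apply: contraTneq => ->; rewrite negb_or bN.
  have : (#|squares :&: aS| <= 1)%N.
    rewrite -(cards1 (0 : F)); apply/subset_leq_card/subsetP => x.
    rewrite !inE => /andP[/imsetP[y _ ->] /imsetP[_ /imsetP[z _ ->] e]].
    rewrite sqrf_eq0; apply: contraNT na => y0; apply/nonzero_squareP.
    have z0 : z != 0 by apply: contraNneq y0 => z0; rewrite -sqrf_eq0 e z0 expr0n mulr0.
    exists (y / z); first by rewrite mulf_neq0 ?invr_neq0.
    by rewrite expr_div_n e mulfK // expf_neq0.
  have := cardsUI squares aS.
  rewrite cardR cardsC1; move: (finNzRing_gt1 F).
  move: #|_ :|: _| #|_ :&: _| #|squares| => u i m.
  move=> gt1 E1 E2 E3; rewrite -(ltn_predK gt1) mul2n -addnn -E1 -addn1.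
  exact: leq_add.
case/imsetP => _ /imsetP[c _ ->] e; exists c; last by rewrite mulrC.
by apply: contraNneq b0 => c0; rewrite e c0 expr0n mulr0.
Qed.

Lemma exists_nonsquare : exists a : F, a != 0 /\ ~~ nonzero_square a.
Proof.
have : (#|squares| < #|F|)%N.
  rewrite ltn_neqAle max_card andbT; apply/negP => /eqP E.
  have /imset_injP inj : #|[set x ^+ 2 | x in F]| == #|F| by rewrite E.
  have := inj 1 (-1) isT isT.
  rewrite sqrrN => /(_ (erefl _))/eqP; rewrite -subr_eq0 opprK.
  by rewrite -[1 + 1]/(2%:R) (negbTE two).
rewrite -cardsT => lt; have : (0 < #|~: squares|)%N.
  by have := cardsC squares; rewrite -cardsT; lia.
case/card_gt0P => a; rewrite inE => aN; exists a; split.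
  by apply: contraNneq aN => ->; apply/imsetP; exists 0; rewrite // expr0n.
by apply: contraNN aN => /nonzero_squareP[c _ ->]; apply/imsetP; exists c.
Qed.

End FinField.

(** * Conjugation by transvections *)

Section Transvections.
Variable F : finFieldType.
Hypothesis two : (2%:R : F) != 0.
Implicit Types (M N : 'M[F]_2) (S : pred 'M[F]_2).

Definition upper (u : F) : 'M[F]_2 := mx2 1 u 0 1.
Definition lower (u : F) : 'M[F]_2 := mx2 1 0 u 1.

Lemma upper_unit u : upper u \is a GRing.unit.
Proof. by rewrite mx2_unit mx2_det mulr0 subr0 mulr1 oner_eq0. Qed.
Lemma lower_unit u : lower u \is a GRing.unit.
Proof. by rewrite mx2_unit mx2_det mul0r subr0 mulr1 oner_eq0. Qed.

Lemma upperD u v : upper u * upper v = upper (u + v).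
Proof. by rewrite /upper; mx2c. Qed.
Lemma lowerD u v : lower u * lower v = lower (u + v).
Proof. by rewrite /lower; mx2c. Qed.

Lemma cj_upper u a b c d : cj (upper u) (mx2 a b c d) =
  mx2 (a + u * c) (b + u * d - u * (a + u * c)) c (d - u * c).
Proof. by apply: cjP; rewrite ?upper_unit // /upper; mx2c. Qed.
Lemma cj_lower u a b c d : cj (lower u) (mx2 a b c d) =
  mx2 (a - u * b) b (c + u * a - u * (d + u * b)) (d + u * b).
Proof. by apply: cjP; rewrite ?lower_unit // /lower; mx2c. Qed.

Definition stabilizes S M := M \is a GRing.unit /\ forall x, S x -> S (cj M x).

Lemma stabilizesM S M N : stabilizes S M -> stabilizes S N -> stabilizes S (M * N).
Proof.
move=> [uM SM] [uN SN]; split; first by rewrite unitrMl.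
by move=> x Sx; rewrite cjM //; apply/SM/SN.
Qed.

(** An injective map of a finite set into itself is onto. *)
Lemma stabilizesV S M : stabilizes S M -> stabilizes S M^-1.
Proof.
move=> [uM SM]; split=> [|x Sx]; first by rewrite unitrV.
pose A := [set x | S x].
have sub : cj M @: A \subset A.
  by apply/subsetP => y /imsetP[z zA ->]; rewrite !inE in zA *; exact: SM.
have : x \in cj M @: A.
  suff /eqP -> : cj M @: A == A by rewrite inE.
  rewrite eqEcard sub card_imset ?leqnn //.
  by move=> y1 y2 /(congr1 (cj M^-1)); rewrite !cjK.
by case/imsetP => y; rewrite inE => Sy ->; rewrite cjK.
Qed.

Lemma stabilizes_scal S c M : c != 0 -> stabilizes S (c *: M) <-> stabilizes S M.
Proof.
move=> c0.
have E : (c *: M \is a GRing.unit) = (M \is a GRing.unit).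
  by rewrite !mx2_unit detZ mulf_eq0 expf_eq0 /= (negbTE c0).
split=> -[uM SM].
  by rewrite E in uM; split=> // x /SM; rewrite cj_scal.
by split=> [|x /SM]; rewrite ?E ?cj_scal.
Qed.

Lemma stabilizes_eq S c M N : c != 0 -> N = c *: M -> stabilizes S N -> stabilizes S M.
Proof. by move=> c0 -> /(stabilizes_scal _ _ c0). Qed.

(** When the solution at hand has [u = 0], a line of slope [k] through it
    meets the conic in a second point; the slopes to avoid are 0 and the
    square roots of [D]. *)
Lemma conic_point (D E : F) : (4 < #|F|)%N -> D != 0 -> E != 0 ->
  exists A u, u != 0 /\ A ^+ 2 - D * u ^+ 2 = E.
Proof.
move=> F4 D0 E0; have D0' : - D != 0 by rewrite oppr_eq0.
have [A [u e]] := binary_universal two E (oner_neq0 F) D0'.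
have [u0|u0] := eqVneq u 0; last by exists A, u; split=> //; rewrite -e; ring.
have A0 : A != 0 by apply: contraNneq E0 => A0; rewrite -e u0 A0; apply/eqP; ring.
have [k kP] : exists k : F, k != 0 /\ k ^+ 2 - D != 0.
  have [/imsetP[d _ ->]|Dn] := boolP (D \in squares F).
    have [|k] := @exists_notin F [:: 0; d; - d]; first exact: leq_trans F4.
    rewrite !inE !negb_or => /and3P[k0 k1 k2]; exists k; split=> //.
    by rewrite subr_sqr mulf_neq0 // ?subr_eq0 // addr_eq0.
  exists 1; split; rewrite ?oner_eq0 // subr_eq0; apply: contraNneq Dn => <-.
  by apply/imsetP; exists 1.
case: kP => k0 kD.
pose v := - (2%:R * k * A) / (k ^+ 2 - D); exists (A + k * v), v; split.
  by rewrite mulf_neq0 ?invr_neq0 // oppr_eq0 !mulf_neq0.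
by rewrite -e u0 /v; field.
Qed.

(** Matrices with the given traceless determinant and a lower left entry [r]
    other than 0 are brought by upper transvections to one normal form [T r].
    A lower transvection passes from [T r] to any [T r'], the parameters that
    achieve this being the points of a conic. The scalar part [z] is inert
    under conjugation. *)
Lemma sl2_transitive S (z a b c a' b' c' : F) : (4 < #|F|)%N ->
  (forall u, stabilizes S (upper u)) -> (forall u, stabilizes S (lower u)) ->
  a ^+ 2 + b * c != 0 -> a' ^+ 2 + b' * c' = a ^+ 2 + b * c ->
  S (mx2 (z + a) b c (z - a)) -> S (mx2 (z + a') b' c' (z - a')).
Proof.
move=> F4 SU SL; set D := a ^+ 2 + b * c => D0 De.
pose T r := S (mx2 (z + 0) (D / r) r (z - 0)).
have toT x y r : r != 0 -> x ^+ 2 + y * r = D ->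
    S (mx2 (z + x) y r (z - x)) -> T r.
  move=> r0 e; have [_ H] := SU (- (x / r)); move/H; rewrite cj_upper /T.
  congr (S (mx2 _ _ _ _)); rewrite -?e; field => //.
have ofT x y r : r != 0 -> x ^+ 2 + y * r = D ->
    T r -> S (mx2 (z + x) y r (z - x)).
  move=> r0 e; have [_ H] := SU (x / r); rewrite /T; move/H; rewrite cj_upper.
  congr (S (mx2 _ _ _ _)); rewrite -?e; field => //.
(* a lower transvection makes the lower left entry nonzero: at most two of
   the parameters 0, 1, -1 can fail *)
have norm x y r : x ^+ 2 + y * r = D -> exists v,
    r + 2%:R * v * x - v ^+ 2 * y != 0.
  move=> e; have [r0|r0] := eqVneq r 0; last first.
    by exists 0; rewrite mulr0 !mul0r addr0 expr0n mul0r subr0.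
  have x0 : x != 0 by apply: contraNneq D0 => x0; rewrite -e x0 r0; apply/eqP; ring.
  have [e1|] := eqVneq (2%:R * x - y) 0; last first.
    by move=> h; exists 1; apply: contraNneq h; rewrite r0 => <-; apply/eqP; ring.
  exists (- 1); rewrite r0; have -> : y = 2%:R * x by apply/eqP; rewrite eq_sym -subr_eq0 e1.
  have -> : 0 + 2%:R * -1 * x - (-1) ^+ 2 * (2%:R * x) = - (2%:R * (2%:R * x)) by ring.
  by rewrite oppr_eq0 !mulf_neq0.
have lowS x y r v : cj (lower v) (mx2 (z + x) y r (z - x)) =
    mx2 (z + (x - v * y)) y (r + 2%:R * v * x - v ^+ 2 * y) (z - (x - v * y)).
  by rewrite cj_lower; congr mx2; ring.
have TT r r' : r != 0 -> r' != 0 -> T r -> T r'.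
  move=> r0 r'0 Tr; have [A [u [u0 e]]] := conic_point F4 D0 (mulf_neq0 r0 r'0).
  pose x := (A - r) / u; pose y := (D - x ^+ 2) / r.
  have Sx : S (mx2 (z + x) y r (z - x)) by apply: ofT => //; rewrite /y; field.
  have [_ H] := SL u; move/H: Sx; rewrite lowS.
  have -> : r + 2%:R * u * x - u ^+ 2 * y = r'.
    apply: (mulfI r0); rewrite -e /y /x; field; exact/andP.
  apply: toT => //; rewrite /y /x.
  have -> : r' = (A ^+ 2 - D * u ^+ 2) / r by rewrite e mulrC mulKf.
  by field; exact/andP.
move=> Sabc; have [v v0] := norm a b c erefl; have [v' v'0] := norm a' b' c' De.
have [_ /(_ _ Sabc)] := SL v; rewrite lowS => /toT => /(_ v0) Tv.
have {}Tv : T (c + 2%:R * v * a - v ^+ 2 * b) by apply: Tv; rewrite /D; ring.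
have := TT _ _ v0 v'0 Tv.
move/(@ofT (a' - v' * b') b'); rewrite -lowS => /(_ v'0) H.
rewrite -[mx2 _ _ _ _](cjK _ (lower_unit v')).
have [_] := stabilizesV (SL v'); apply; apply: H.
by rewrite -De; ring.
Qed.

Lemma upper_lower_unit u v : upper u * lower v \is a GRing.unit.
Proof. by rewrite unitrMl ?upper_unit ?lower_unit. Qed.

(** Up to a scalar, the product of two such matrices can be an upper
    transvection of parameter [u] times a lower one of parameter [u r ^ 2 /
    delta], for any nonzero [r]. Two of these with equal [u] differ by a lower
    transvection, of arbitrary parameter when [r ^ 2] is not 1. *)
Lemma even_words S delta : (4 < #|F|)%N -> delta != 0 ->
  (forall x y, \tr x = 0 -> \tr y = 0 -> \det x = delta -> \det y = delta ->
     stabilizes S (x * y)) ->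
  (forall u, stabilizes S (upper u)) /\ (forall u, stabilizes S (lower u)).
Proof.
move=> F4 d0 Sxy.
have SC u r : r != 0 -> stabilizes S (upper u * lower (u * r ^+ 2 / delta)).
  move=> r0; apply: (@stabilizes_eq _ (- delta) _
    (mx2 (u * r) (- delta / r - u * (u * r)) r (- (u * r)) * mx2 0 (- delta / r) r 0)).
  - by rewrite oppr_eq0.
  - by rewrite /upper /lower !mx2E; congr mx2; field; rewrite ?r0 ?d0.
  by apply: Sxy; rewrite ?mx2_tr ?mx2_det; field.
have SL u : stabilizes S (lower u).
  have [|r] := @exists_notin F [:: 0; 1; -1]; first exact: leq_trans F4.
  rewrite !inE !negb_or => /and3P[r0 r1 r2].
  have rr : r ^+ 2 - 1 != 0 by rewrite subr_sqr_1 mulf_neq0 // ?subr_eq0 // addr_eq0.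
  pose v := u * delta / (r ^+ 2 - 1).
  have -> : lower u = (upper v * lower (v * 1 ^+ 2 / delta))^-1 *
                      (upper v * lower (v * r ^+ 2 / delta)).
    apply: (mulrI (upper_lower_unit v (v * 1 ^+ 2 / delta))).
    rewrite mulVKr ?upper_lower_unit // -(mulrA (upper v)) lowerD; congr (_ * lower _).
    by rewrite /v; field; rewrite d0 rr.
  by apply/stabilizesM/SC => //; apply/stabilizesV/SC; rewrite oner_eq0.
split=> // u; have := SC u 1 (oner_neq0 _) => H.
have := stabilizesM H (SL (- (u * 1 ^+ 2 / delta))).
by rewrite -(mulrA (upper u)) lowerD addrN /lower -mx2_1 mulr1.
Qed.

(** A nonzero traceless matrix is cyclic, so it is determined up to
    conjugation by its determinant, nilpotent matrices included. *)
Lemma traceless_companion (x : 'M[F]_2) : \tr x = 0 -> x != 0 ->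
  exists2 M, M \is a GRing.unit & x = cj M (mx2 0 (- \det x) 1 0).
Proof.
have [a [b [c [d ->]]]] := mx2P x; rewrite mx2_tr mx2_det => tr0.
have {tr0 d}-> : d = - a by apply/eqP; rewrite -addr_eq0 addrC tr0.
move=> x0; have mk M : M \is a GRing.unit ->
    M * mx2 0 (- (a * - a - b * c)) 1 0 = mx2 a b c (- a) * M ->
    exists2 M, M \is a GRing.unit &
    mx2 a b c (- a) = cj M (mx2 0 (- (a * - a - b * c)) 1 0).
  by move=> uM e; exists M => //; rewrite (cjP uM e).
have [c0|c0] := eqVneq c 0; last first.
  by apply: (mk (mx2 1 a 0 c)); [rewrite mx2_unit mx2_det mul1r mulr0 subr0 | mx2c].
have [b0|b0] := eqVneq b 0; last first.
  apply: (mk (mx2 0 b 1 (- a))); last by mx2c.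
  by rewrite mx2_unit mx2_det mul0r mulr1 sub0r oppr_eq0.
have a0 : a != 0 by apply: contraNneq x0 => a0; rewrite a0 b0 c0 oppr0 mx2_0.
apply: (mk (mx2 1 a 1 (- a))); last by rewrite b0 c0; mx2c.
rewrite mx2_unit mx2_det; have -> : 1 * - a - a * 1 = - (2%:R * a) by ring.
by rewrite oppr_eq0 mulf_neq0.
Qed.

(** In the companion form of [x] the trace condition is linear in the entries
    of [y]. What remains of the determinant condition is a nondegenerate
    binary quadratic equation, or a linear one when [x] is nilpotent. *)
Lemma traceless_pairing (x : 'M[F]_2) delta f : \tr x = 0 -> x != 0 -> delta != 0 ->
  (f != 0) || (\det x != 0) ->
  exists y, [/\ \tr y = 0, \det y = delta & \tr (x * y) = f].
Proof.
move=> tr0 x0 d0 fx; have [M uM xM] := traceless_companion tr0 x0.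
set e := \det x in fx xM.
have [y [y1 y2 y3]] : exists y, [/\ \tr y = 0, \det y = delta &
    \tr (mx2 0 (- e) 1 0 * y) = f].
  have mk p r : p ^+ 2 + e * r ^+ 2 + f * r + delta = 0 ->
     exists y, [/\ \tr y = 0, \det y = delta & \tr (mx2 0 (- e) 1 0 * y) = f].
    move=> h; exists (mx2 p (f + e * r) r (- p)); rewrite !mx2E; split; try ring.
    by apply/eqP; rewrite -subr_eq0 -oppr_eq0 -[X in _ == X]h; apply/eqP; ring.
  have [e0|e0] := eqVneq e 0.
    have f0 : f != 0 by rewrite e0 eqxx orbF in fx.
    by apply: (mk 0 (- delta / f)); rewrite e0; field.
  have [p [r h]] := binary_universal two (f ^+ 2 / (4%:R * e) - delta) (oner_neq0 F) e0.
  have four := four_neq0 two.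
  apply: (mk p (r - f / (2%:R * e))).
  move: h; rewrite mul1r => /eqP; rewrite -subr_eq0 => /eqP h; rewrite -h; field.
  by rewrite e0 two four.
exists (cj M y); rewrite cj_tr // cj_det //; split=> //.
by rewrite {1}xM -cjMr // cj_tr.
Qed.

End Transvections.

(** * A quadratic 4-space made of two by two matrices *)

Section Model.
Variable F : finFieldType.
Hypothesis two : (2%:R : F) != 0.
Hypothesis F4 : (4 < #|F|)%N.
Variables (kap D : F).
Hypotheses (kap0 : kap != 0) (D0 : D != 0).
Local Notation M2 := 'M[F]_2.

Let four : 4%:R != 0 :> F. Proof. exact: four_neq0. Qed.

(** The form of norm [kap * \det x] on traceless matrices [x] and of norm [D *
    z ^ 2] on scalars [z%:M], the two being orthogonal ([mnormE]). *)
Definition mform (x y : M2) : F :=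
  - (kap / 2%:R) * \tr (x * y) + (kap + D) / 4%:R * (\tr x * \tr y).

Definition mrefl (v x : M2) : M2 :=
  x - (2%:R * (mform x v / mform v v)) *: v.

Lemma mformC x y : mform x y = mform y x.
Proof. by rewrite /mform trM2C [\tr x * _]mulrC. Qed.
Lemma mformDl x y w : mform (x + y) w = mform x w + mform y w.
Proof. by rewrite /mform mulrDl !mxtraceD; ring. Qed.
Lemma mformZl c x w : mform (c *: x) w = c * mform x w.
Proof. by rewrite /mform -scalerAl !mxtraceZ; ring. Qed.
Lemma mformBl x y w : mform (x - y) w = mform x w - mform y w.
Proof. by rewrite -scaleN1r mformDl mformZl mulN1r. Qed.

Lemma mformE z z' x y : \tr x = 0 -> \tr y = 0 ->
  mform (z%:M + x) (z'%:M + y) = - (kap / 2%:R) * \tr (x * y) + D * z * z'.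
Proof.
have [a [b [c [d ->]]]] := mx2P x; have [a' [b' [c' [d' ->]]]] := mx2P y.
rewrite !mx2_tr => /eqP; rewrite addrC addr_eq0 => /eqP ->.
move=> /eqP; rewrite addrC addr_eq0 => /eqP ->.
by rewrite /mform !mx2E; field; rewrite two four.
Qed.

Lemma mnormE z x : \tr x = 0 ->
  mform (z%:M + x) (z%:M + x) = kap * \det x + D * z ^+ 2.
Proof.
move=> x0; rewrite mformE // trless_sqr // mxtrace_scalar; move: (\det x) => d.
by rewrite mulr2n; field.
Qed.

Lemma trless_split (v : M2) : exists z x, v = z%:M + x /\ \tr x = 0.
Proof.
exists (\tr v / 2%:R), (v - (\tr v / 2%:R)%:M); rewrite addrC subrK; split=> //.
by rewrite mxtraceD -scaleN1r mxtraceZ mxtrace_scalar mulr2n; field.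
Qed.

Lemma mrefl_involutive v x : mform v v != 0 -> mrefl v (mrefl v x) = x.
Proof.
move=> v0; rewrite /mrefl mformBl mformZl -addrA -opprD -scalerDl.
set m := mform x v; set n := mform v v in v0 *.
have -> : 2%:R * (m / n) + 2%:R * ((m - 2%:R * (m / n) * n) / n) = 0 by field.
by rewrite scale0r subr0.
Qed.

Lemma mrefl_isom v x y : mform v v != 0 ->
  mform (mrefl v x) (mrefl v y) = mform x y.
Proof.
move=> v0; rewrite /mrefl mformBl mformZl ![mform _ (y - _)]mformC !mformBl !mformZl.
by rewrite ?(mformC v x) ?(mformC v y) ?(mformC y x); field.
Qed.

(** For traceless [a], conjugation by [a] fixes [a] and negates the traceless
    matrices orthogonal to [a], which anticommute with it. *)
Lemma mrefl_cj a x : \tr a = 0 -> \det a != 0 ->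
  mrefl a x = (\tr x)%:M - cj a x.
Proof.
move=> a0 da; apply/eqP; rewrite eq_sym subr_eq addrC -subr_eq eq_sym; apply/eqP.
have na : mform a a = kap * \det a.
  by have := mnormE 0 a0; rewrite raddf0 add0r => ->; ring.
apply: cjP; rewrite ?mx2_unit // /mrefl na /mform a0 !mulr0 addr0.
move: a0 da {na}; have [p [q [r [s ->]]]] := mx2P a; have [a' [b' [c' [d' ->]]]] := mx2P x.
rewrite mx2_tr mx2_det addrC => /eqP; rewrite addr_eq0 => /eqP -> nz.
by rewrite !mx2E; congr mx2; field; rewrite kap0 nz two.
Qed.

(** The two half turns compose to conjugation by a product, on scalars as well
    as on traceless matrices: the signs in [mrefl_cj] cancel. *)
Lemma mrefl_mrefl a b x : \tr a = 0 -> \tr b = 0 -> \det a != 0 -> \det b != 0 ->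
  mrefl a (mrefl b x) = cj (a * b) x.
Proof.
move=> a0 b0 da db.
have ua : a \is a GRing.unit by rewrite mx2_unit.
have ub : b \is a GRing.unit by rewrite mx2_unit.
rewrite (mrefl_cj x) // mrefl_cj // cjM // cjD -scaleN1r cjZ cjS //.
rewrite mxtraceD mxtraceZ cj_tr // mxtrace_scalar !scaleN1r opprD opprK addrA.
by rewrite (_ : _ - _ = 0) ?add0r // -raddfB -[RHS](raddf0 (@scalar_mx F 2)); congr _%:M; ring.
Qed.

(** [P] plays the set of mirrors of a reflection group, through its formal
    properties only. *)
Variable P : pred M2.
Hypothesis Pnorm : forall v, P v -> mform v v != 0.
Hypothesis Pscal : forall c v, c != 0 -> P v -> P (c *: v).
Hypothesis Prefl : forall v w, P v -> P w -> P (mrefl v w).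

Definition trless_part : pred M2 := fun x => (\tr x == 0) && P x.
Local Notation K := (stabilizes trless_part).

Lemma trless_det a : \tr a = 0 -> P a -> \det a != 0.
Proof.
move=> a0 /Pnorm; have := mnormE 0 a0; rewrite raddf0 add0r => ->.
by rewrite expr0n mulr0 addr0; apply: contraNneq => ->; rewrite mulr0.
Qed.

Lemma stabilizes_mirror a : \tr a = 0 -> P a -> K a.
Proof.
move=> a0 Pa; have da := trless_det a0 Pa.
split=> [|x /andP[/eqP x0 Px]]; first by rewrite mx2_unit.
have ua : a \is a GRing.unit by rewrite mx2_unit.
rewrite /trless_part cj_tr // x0 eqxx.
have -> : cj a x = (-1) *: mrefl a x.
  by rewrite mrefl_cj // x0 raddf0 sub0r scaleN1r opprK.
by apply: Pscal; rewrite ?oppr_eq0 ?oner_eq0 //; exact: Prefl.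
Qed.

Section Slices.
Hypothesis KU : forall u, K (upper u).
Hypothesis KL : forall u, K (lower u).
Variables f c : M2.
Hypotheses (Pf : P f) (f_tr : \tr f = 0) (f1 : mform f f = 1).
Hypotheses (Pc : P c) (c1 : mform c c = 1) (c_tr : \tr c != 0).
Hypothesis c_nscal : forall z, c != z%:M.

Lemma trless_mx2 (x : M2) : \tr x = 0 -> exists a b c, x = mx2 a b c (- a).
Proof.
have [a [b [r [d ->]]]] := mx2P x; rewrite mx2_tr => /eqP.
by rewrite addrC addr_eq0 => /eqP ->; exists a, b, r.
Qed.

Lemma slice_transitive (S : pred M2) z x y :
  (forall u, stabilizes S (upper u)) -> (forall u, stabilizes S (lower u)) ->
  \tr x = 0 -> \tr y = 0 -> \det x != 0 -> \det y = \det x ->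
  S (z%:M + x) -> S (z%:M + y).
Proof.
move=> SU SL /trless_mx2[a [b [r ->]]] /trless_mx2[a' [b' [r' ->]]].
rewrite !mx2_det !mx2S !mx2D !add0r => n0 e; apply: sl2_transitive => //.
  by rewrite -oppr_eq0; apply: contraNneq n0 => <-; apply/eqP; ring.
apply/eqP; rewrite -subr_eq0 -oppr_eq0; move/eqP: e.
by rewrite -subr_eq0 => /eqP <-; apply/eqP; ring.
Qed.

Lemma mnorm_trless x : \tr x = 0 -> mform x x = kap * \det x.
Proof.
move=> x0; have := mnormE 0 x0; rewrite raddf0 add0r => ->.
by rewrite expr0n mulr0 addr0.
Qed.

(** Vectors of norm 1 in the traceless space form one orbit of the group
    generated by transvections, and [f] is one of them. *)
Lemma mirror_trless_unit x : \tr x = 0 -> mform x x = 1 -> P x.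
Proof.
move=> x0; rewrite mnorm_trless // => kx.
have : trless_part (0%:M + f) by rewrite raddf0 add0r /trless_part f_tr eqxx Pf.
move/(@slice_transitive _ _ _ x KU KL f_tr x0 (trless_det f_tr Pf)).
rewrite raddf0 add0r => H; suff /andP[] : trless_part x by [].
by apply: H; apply: (mulfI kap0); rewrite kx -mnorm_trless // f1.
Qed.

(** The traceless vectors of norm 1 are mirrors by now, and their reflections
    compose in pairs to conjugations of the whole matrix space; by
    [even_words] these include the transvections. *)
Lemma stable_transvections (S : pred M2) :
  (forall v x, P v -> S x -> S (mrefl v x)) ->
  (forall u, stabilizes S (upper u)) /\ (forall u, stabilizes S (lower u)).
Proof.
move=> SP; have k0 : kap^-1 != 0 by rewrite invr_eq0.
apply: (even_words F4 k0) => x y x0 y0 dx dy.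
have dx0 : \det x != 0 by rewrite dx.
have dy0 : \det y != 0 by rewrite dy.
split=> [|z Sz]; first by rewrite unitrMl mx2_unit.
rewrite -mrefl_mrefl //; apply: (SP); first by apply: mirror_trless_unit; rewrite // mnorm_trless // dx mulfV.
by apply: SP => //; apply: mirror_trless_unit; rewrite // mnorm_trless // dy mulfV.
Qed.

Lemma mirror_slice z x y : \tr x = 0 -> \tr y = 0 -> \det x != 0 -> \det y = \det x ->
  P (z%:M + x) -> P (z%:M + y).
Proof. by have [PU PL] := stable_transvections Prefl; exact: slice_transitive. Qed.

(** A reflection moves the scalar part [z] to any prescribed value when the
    pairing with its root, of scalar part [z'] other than 0, is chosen
    accordingly. *)
Lemma mrefl_split z x z' y : \tr x = 0 -> \tr y = 0 ->
  mform (z'%:M + y) (z'%:M + y) = 1 ->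
  let g := 2%:R * (- (kap / 2%:R) * \tr (x * y) + D * z * z') in
  mrefl (z'%:M + y) (z%:M + x) = (z - g * z')%:M + (x - g *: y).
Proof.
move=> x0 y0 n1 g; rewrite /mrefl n1 divr1 mformE // -/g.
by rewrite scalerDr scale_scalar_mx opprD addrACA (raddfB (@scalar_mx F 2)).
Qed.

(** Reflecting a traceless mirror [y] in [c] gives the scalar part [d * z],
    where [d] is controlled by the pairing of [y] with [c]; it is chosen so
    that the traceless part of the image does not become isotropic. *)
Lemma slice_point : exists z x, [/\ z != 0, \tr x = 0, \det x != 0,
  mform (z%:M + x) (z%:M + x) = 1 & P (z%:M + x)].
Proof.
have [z [x [cE x0]]] := trless_split c.
have z0 : z != 0.
  apply: contraNneq c_tr => z0; rewrite cE z0 raddf0 add0r x0 //.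
have xn0 : x != 0 by apply: contraNneq (c_nscal z) => xe; rewrite cE xe addr0.
have [d [d0 d1]] : exists d : F, d != 0 /\ D * (d * z) ^+ 2 != 1.
  have [e|ne] := eqVneq (D * z ^+ 2) 1; last by exists 1; rewrite mul1r oner_eq0.
  have [|d] := @exists_notin F [:: 0; 1; -1]; first exact: leq_trans F4.
  rewrite !inE !negb_or => /and3P[d0 d1 d2]; exists d; split=> //.
  by rewrite exprMn mulrCA e mulr1 -subr_eq0 subr_sqr_1 mulf_neq0 // ?subr_eq0 // addr_eq0.
have k0 : kap^-1 != 0 by rewrite invr_eq0.
have dk0 : d / kap != 0 by rewrite mulf_neq0.
have [|y [y0 dy xy]] := traceless_pairing two x0 xn0 k0 (f := d / kap).
  by rewrite dk0.
have Py : P y by apply: mirror_trless_unit; rewrite // mnorm_trless // dy mulfV.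
have E : mrefl c y = (d * z)%:M + (y + d *: x).
  have := @mrefl_split 0 y z x y0 x0; rewrite -cE raddf0 !add0r => /(_ c1) ->.
  have -> : 2%:R * (- (kap / 2%:R) * \tr (y * x) + D * 0 * z) = - d.
    by rewrite trM2C xy; field; rewrite kap0 two.
  by rewrite sub0r mulNr opprK scaleNr opprK.
have tr0 : \tr (y + d *: x) = 0 by rewrite mxtraceD mxtraceZ y0 x0 mulr0 addr0.
have n1 : mform ((d * z)%:M + (y + d *: x)) ((d * z)%:M + (y + d *: x)) = 1.
  by rewrite -E mrefl_isom ?c1 ?oner_eq0 // mnorm_trless // dy mulfV.
exists (d * z), (y + d *: x); split=> //; first by rewrite mulf_neq0.
  by move: n1; rewrite mnormE // => n1; apply: contraNneq d1 => e; rewrite -n1 e mulr0 add0r.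
by rewrite -E; exact: Prefl.
Qed.

(** Reflect a mirror [s + a] in a mirror [s + b] of the same slice. The
    pairing of [a] and [b] is free ([traceless_pairing]) and determines the
    slice of the image. *)
Lemma mirror_generic_unit z x : \tr x = 0 -> \det x != 0 ->
  mform (z%:M + x) (z%:M + x) = 1 -> P (z%:M + x).
Proof.
move=> x0 dx n1; have [s [a [s0 a0 da a1 Pa]]] := slice_point.
pose g := (s - z) / s.
pose w := (D * s * s - g / 2%:R) * (2%:R / kap).
have an0 : a != 0 by apply: contraNneq da => ->; rewrite det0.
have [|b [b0 db ab]] := traceless_pairing two a0 an0 da (f := w); first by rewrite da orbT.
have Pb : P (s%:M + b) by apply: mirror_slice Pa.
have b1 : mform (s%:M + b) (s%:M + b) = 1 by rewrite mnormE // db -mnormE.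
have E : mrefl (s%:M + b) (s%:M + a) = z%:M + (a - g *: b).
  rewrite mrefl_split //.
  have -> : 2%:R * (- (kap / 2%:R) * \tr (a * b) + D * s * s) = g.
    by rewrite ab /w; field; rewrite kap0 two.
  by congr (_%:M + _); rewrite /g; field.
have Pz : P (z%:M + (a - g *: b)) by rewrite -E; exact: Prefl.
have t0 : \tr (a - g *: b) = 0 by rewrite -scaleNr mxtraceD mxtraceZ a0 b0 mulr0 addr0.
have z1 : mform (z%:M + (a - g *: b)) (z%:M + (a - g *: b)) = 1.
  by rewrite -E mrefl_isom ?b1 ?oner_eq0.
have de : \det x = \det (a - g *: b).
  apply: (mulfI kap0); apply: (addIr (D * z ^+ 2)).
  by rewrite -!mnormE // n1 z1.
by apply: mirror_slice Pz => //; rewrite -de.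
Qed.

Lemma square_roots (E : F) : exists r, forall z, E * z ^+ 2 = 1 -> z = r \/ z = - r.
Proof.
have [/existsP[r /eqP Er]|/existsPn no] := boolP [exists r, E * r ^+ 2 == 1].
  exists r => z Ez; have E0 : E != 0.
    by apply: contraNneq (oner_neq0 F) => e; rewrite -Er e mul0r.
  have /eqP : z ^+ 2 = r ^+ 2 by apply: (mulfI E0); rewrite Ez Er.
  by rewrite eqf_sqr => /orP[] /eqP; [left | right].
by exists 0 => z /eqP Ez; have := no z; rewrite Ez.
Qed.

(** Each condition rules out two opposite values; only the field with five
    elements is small enough to need a separate argument. *)
Lemma scalar_part_choice :
  exists2 z : F, z != 0 & (D * z ^+ 2 != 1) && (2%:R * D * z ^+ 2 != 1).
Proof.
have [r rP] := square_roots D; have [s sP] := square_roots (2%:R * D).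
have [F5|] := ltnP 5 #|F|.
  have [|z] := @exists_notin F [:: 0; r; - r; s; - s]; first exact: leq_trans F5.
  rewrite !inE !negb_or => /and5P[z0 z1 z2 z3 z4]; exists z => //.
  apply/andP; split; apply/eqP.
    by case/rP => e; [case/eqP: z1 | case/eqP: z2].
  by case/sP => e; [case/eqP: z3 | case/eqP: z4].
rewrite leq_eqVlt ltnNge F4 orbF => /eqP q5.
have five : 5%:R = 0 :> F by rewrite -q5 card_natr.
have three : 3%:R != 0 :> F.
  apply: contraNneq two => e; have -> : 2%:R = 5%:R - 3%:R :> F by ring.
  by rewrite five e subrr.
have [e1|n1] := eqVneq D 1.
  have E1 : D * 2%:R ^+ 2 - 1 = 3%:R by rewrite e1; ring.
  have E2 : 2%:R * D * 2%:R ^+ 2 - 1 = 5%:R + 2%:R by rewrite e1; ring.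
  by exists 2%:R => //; rewrite -subr_eq0 E1 three -subr_eq0 E2 five add0r.
have [e2|n2] := eqVneq (2%:R * D) 1; last first.
  by exists 1; rewrite ?oner_neq0 // expr1n !mulr1 n1.
have E1 : D * 2%:R ^+ 2 - 1 = 1.
  have -> : D * 2%:R ^+ 2 = 2%:R * (2%:R * D) by ring.
  by rewrite e2; ring.
have E2 : 2%:R * D * 2%:R ^+ 2 - 1 = 3%:R by rewrite e2; ring.
by exists 2%:R => //; rewrite -subr_eq0 E1 oner_neq0 -subr_eq0 E2.
Qed.

Lemma tr_mrefl_trless x y : \tr x = 0 -> \tr y = 0 -> \tr (mrefl y x) = 0.
Proof. by move=> x0 y0; rewrite /mrefl -scaleNr mxtraceD mxtraceZ x0 y0 mulr0 addr0. Qed.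

(** Mirrors [z + b] of norm 1 are available for a suitable [z], and the
    pairing of [b] with the traceless part of [v] can be chosen so that the
    reflection kills the scalar part. A scalar [v], which has no such pairing,
    is first moved off the scalar line. *)
Lemma refl_to_trless v : mform v v != 0 ->
  exists y1 y2, [/\ P y1, P y2 & \tr (mrefl y1 (mrefl y2 v)) = 0].
Proof.
have [z z0 /andP[zD zD2]] := scalar_part_choice.
pose d := (1 - D * z ^+ 2) / kap.
have d0 : d != 0 by rewrite mulf_neq0 ?invr_eq0 // subr_eq0 eq_sym.
have nz b : \tr b = 0 -> \det b = d -> mform (z%:M + b) (z%:M + b) = 1.
  by move=> b0 db; rewrite mnormE // db /d; field.
have Pz b : \tr b = 0 -> \det b = d -> P (z%:M + b).
  by move=> b0 db; apply: mirror_generic_unit; rewrite ?db ?nz.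
have one s a : \tr a = 0 -> a != 0 ->
    exists2 y, P y & \tr (mrefl y (s%:M + a)) = 0.
  move=> a0 an0; have [s0|s0] := eqVneq s 0.
    by exists f => //; rewrite s0 raddf0 add0r tr_mrefl_trless.
  pose w := (D * s * z - s / z / 2%:R) * (2%:R / kap).
  have w0 : w != 0.
    rewrite !mulf_neq0 ?invr_eq0 //.
    have -> : D * s * z - s / z / 2%:R = s / z / 2%:R * (2%:R * D * z ^+ 2 - 1).
      by field; rewrite z0 two.
    by rewrite !mulf_neq0 ?invr_eq0 // subr_eq0.
  have [|b [b0 db ab]] := traceless_pairing two a0 an0 d0 (f := w); first by rewrite w0.
  exists (z%:M + b); first exact: Pz.
  rewrite mrefl_split ?nz // mxtraceD mxtrace_scalar -scaleNr mxtraceD mxtraceZ a0 b0.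
  by rewrite ab mulr0 !addr0 /w mulr2n; field; rewrite kap0 two z0.
have [s [a [-> a0]]] := trless_split v; have [ae|an0] := eqVneq a 0; last first.
  have [y Py ty] := one s a a0 an0; exists f, y; split=> //.
  exact: tr_mrefl_trless.
rewrite ae addr0 => v0.
have s0 : s != 0.
  by apply: contraNneq v0 => ->; rewrite raddf0 /mform mul0r !raddf0 !mulr0 add0r.
have b0 : \tr (mx2 0 1 (- d) 0) = 0 :> F by rewrite mx2_tr addr0.
have db : \det (mx2 0 1 (- d) 0) = d by rewrite mx2_det; ring.
set b := mx2 _ _ _ _ in b0 db.
have E : mrefl (z%:M + b) (s%:M + 0) =
    (s - 2%:R * (D * s * z) * z)%:M + (0 - (2%:R * (D * s * z)) *: b).
  by rewrite mrefl_split ?mxtrace0 ?nz // mul0r mxtrace0 mulr0 add0r.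
have [||y Py ty] := one (s - 2%:R * (D * s * z) * z) (0 - (2%:R * (D * s * z)) *: b).
- by rewrite sub0r -scaleNr mxtraceZ b0 mulr0.
- rewrite sub0r oppr_eq0 scaler_eq0 !mulf_eq0 (negbTE two) (negbTE D0) (negbTE s0) (negbTE z0) /=.
  by apply: contraNneq d0 => e; rewrite -db e det0.
by exists y, (z%:M + b); split; rewrite ?Pz // -[s%:M]addr0 E.
Qed.

(** Two reflections in mirrors bring [v], and two others [w], to traceless
    vectors of equal norm, where transvections act transitively. *)
Lemma mirror_class_complete v w : P v -> mform w w = mform v v -> P w.
Proof.
move=> Pv e; have v0 := Pnorm Pv.
have w0 : mform w w != 0 by rewrite e.
have [y1 [y2 [Py1 Py2 tv]]] := refl_to_trless v0.
have [u1 [u2 [Pu1 Pu2 tw]]] := refl_to_trless w0.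
have Pv' : P (mrefl y1 (mrefl y2 v)) by apply: (Prefl) => //; apply: (Prefl).
suff Pw' : P (mrefl u1 (mrefl u2 w)).
  have -> : w = mrefl u2 (mrefl u1 (mrefl u1 (mrefl u2 w))).
    by rewrite !mrefl_involutive //; exact: Pnorm.
  by apply: (Prefl) => //; apply: (Prefl).
have := @mirror_slice 0 _ _ tv tw (trless_det tv Pv'); rewrite raddf0 !add0r; apply=> //.
by apply: (mulfI kap0); rewrite -!mnorm_trless // !mrefl_isom ?e //; exact: Pnorm.
Qed.
End Slices.
End Model.

(** * Counting poles *)

Section Poles.
Local Open Scope group_scope.
Local Open Scope nat_scope.
Variables (gT : finGroupType) (T : finType) (to : {action gT &-> T}).
Variables (G Z : {group gT}) (S : {set T}) (x : T).
Hypotheses (ZG : Z \subset G) (actS : [acts G, on S | to]).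
Hypothesis fixZ : forall g y, g \in Z -> y \in S -> to y g = y.
Hypothesis fixG : forall g, g \in G -> g \notin Z -> #|'Fix_(S | to)[g]| = 2.
Hypothesis stab2 : forall y, y \in S -> 2 * #|Z| <= #|'C_G[y | to]|.
Hypotheses (xS : x \in S) (stab6 : 6 * #|Z| <= #|'C_G[x | to]|).

(** The count behind the classification of finite rotation groups. Let [n] be
    the order of [G / Z] and [m_i] the stabiliser orders modulo [Z] of the
    orbits on [S]. Counting fixed points gives [2 - 2 / n = \sum_i (1 - 1 /
    m_i)]. All [m_i] are at least 2, and one of them is at least 6; since [1 /
    2 + 1 / 3 + 1 / 6 = 1], this leaves two orbits of one point or the
    dihedral type [(2, 2, m)], whose last orbit has two points. *)
Lemma two_pole_orbit : #|orbit to G x| <= 2.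
Proof.
set z := #|Z|; set g := #|G|; pose orb := orbit to G @: S.
have z0 : 0 < z by exact: cardG_gt0.
have stabZ y : y \in S -> Z \subset 'C_G[y | to].
  move=> yS; rewrite subsetI ZG; apply/subsetP => h hZ.
  by rewrite !inE; apply/subsetP => w; rewrite !inE => /eqP ->; apply/eqP/fixZ.
have part : partition orb S by exact: orbit_partition.
(* the identity above, multiplied by the order of [G] and rearranged *)
have burn : z * #|S| + 2 * (g - z) = #|orb| * g.
  have := Frobenius_Cauchy actS; rewrite -/orb -/g => <-.
  rewrite (big_setID Z) /= (setIidPr ZG) (eq_bigr (fun=> #|S|)); last first.
    move=> h hZ; apply/eqP; rewrite eqn_leq subset_leq_card ?subsetIl //=.
    apply/subset_leq_card/subsetP => y yS; rewrite inE yS.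
    by apply/afixP => k /set1P ->; exact: fixZ.
  rewrite sum_nat_const; congr addn.
  rewrite (eq_bigr (fun=> 2)); last by move=> h /setDP[]; exact: fixG.
  by rewrite sum_nat_const cardsD (setIidPr ZG) mulnC.
have szS : #|S| = \sum_(A in orb) #|A| by exact: card_partition.
have orbP A : A \in orb -> exists2 m, 2 <= m & z * #|A| * m = g.
  case/imsetP => y yS ->; have Zc := stabZ y yS.
  exists (#|'C_G[y | to]| %/ z); first by rewrite leq_divRL // stab2.
  rewrite /g -(card_orbit_stab to G y) mulnAC [z * _]mulnC divnK ?cardSg //.
  exact: mulnC.
have [m m6 xg] : exists2 m, 6 <= m & z * #|orbit to G x| * m = g.
  exists (#|'C_G[x | to]| %/ z); first by rewrite leq_divRL // stab6.
  rewrite /g -(card_orbit_stab to G x) mulnAC [z * _]mulnC divnK ?cardSg ?stabZ //.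
  exact: mulnC.
set O := orbit to G x in xg *.
have Oorb : O \in orb by apply: imset_f.
have E : z * #|O| + z * (\sum_(A in orb :\ O) #|A|) + 2 * (g - z) = #|orb| * g.
  by rewrite -mulnDr -burn szS (big_setD1 O Oorb).
have zg : z <= g by exact: subset_leq_card.
have cO : #|orb| = #|orb :\ O|.+1 by rewrite (cardsD1 O) Oorb.
have bound (B : {set {set T}}) : B \subset orb -> 2 * (z * (\sum_(A in B) #|A|)) <= #|B| * g.
  move=> sB; rewrite big_distrr big_distrr /= -sum_nat_const; apply: leq_sum => A AB.
  have [k k2 <-] := orbP A (subsetP sB A AB); rewrite mulnC; apply: leq_mul => //.
rewrite -(leq_pmul2l z0) [z * 2]mulnC; move: E; rewrite cO.
have := bound (orb :\ O) (subD1set _ _).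
set s := #|orb :\ O|; case E3 : s => [|[|[|s']]].
- move/eqP: E3; rewrite cards_eq0 => /eqP ->; rewrite big_set0; nia.
- nia.
- have /cards2P[A [B [AB eB]]] : #|orb :\ O| == 2 by rewrite -E3.
  have AO : A \in orb by apply: (subsetP (subD1set orb O)); rewrite eB !inE eqxx.
  have BO : B \in orb by apply: (subsetP (subD1set orb O)); rewrite eB !inE eqxx orbT.
  have [mA mA2 gA] := orbP A AO; have [mB mB2 gB] := orbP B BO.
  rewrite eB big_setU1 ?inE // big_set1 mulnDr => _ E.
  have O6 : 6 * (z * #|O|) <= g by rewrite -xg mulnC leq_mul2l m6 orbT.
  have A2 : 2 * (z * #|A|) <= g by rewrite -gA mulnC leq_mul2l mA2 orbT.
  have B2 : 2 * (z * #|B|) <= g by rewrite -gB mulnC leq_mul2l mB2 orbT.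
  have [mA3|mA3] := leqP 3 mA.
    have : 3 * (z * #|A|) <= g by rewrite -gA mulnC leq_mul2l mA3 orbT.
    move: O6 B2 E zg z0; clear; lia.
  have [mB3|mB3] := leqP 3 mB.
    have : 3 * (z * #|B|) <= g by rewrite -gB mulnC leq_mul2l mB3 orbT.
    move: O6 A2 E zg z0; clear; lia.
  have eA : mA = 2 by apply/eqP; rewrite eqn_leq mA2 -ltnS mA3.
  have eB' : mB = 2 by apply/eqP; rewrite eqn_leq mB2 -ltnS mB3.
  move: gA gB E zg z0; rewrite eA eB'; clear; lia.
- move=> le E; have O6 : 6 * (z * #|O|) <= g by rewrite -xg mulnC leq_mul2l m6 orbT.
  move: O6 le E zg z0; rewrite !mulSn; move: (s' * g) (z * \sum_(_ in _) _) => u v.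
  clear; lia.
Qed.
End Poles.

(** * Rotation groups without unipotents *)

Section Unipotent.
Variable F : finFieldType.
Hypothesis two : (2%:R : F) != 0.
Local Notation M2 := 'M[F]_2.
Implicit Types (M N x y : M2).

Lemma scalM z x : z%:M * x = z *: x.
Proof. exact: mul_scalar_mx. Qed.
Lemma Mscal z x : x * z%:M = z *: x.
Proof. exact: mul_mx_scalar. Qed.

(** The axis of the rotation given by conjugation with [M]. *)
Definition tpart M : M2 := M - (\tr M / 2%:R)%:M.

Lemma tr_tpart M : \tr (tpart M) = 0.
Proof. by rewrite /tpart raddfB /= mxtrace_scalar mulr2n; field. Qed.

Lemma tpartK M : M = (\tr M / 2%:R)%:M + tpart M.
Proof. by rewrite /tpart addrC subrK. Qed.

Lemma det_tpart M : \det (tpart M) = \det M - (\tr M / 2%:R) ^+ 2.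
Proof.
rewrite /tpart; have [a [b [c [d ->]]]] := mx2P M.
by rewrite !mx2E; field.
Qed.

Lemma tpart_eq0 M : (tpart M == 0) = is_scalar_mx M.
Proof.
apply/eqP/is_scalar_mxP => [e|[z ->]].
  by exists (\tr M / 2%:R); rewrite {1}[M]tpartK e addr0.
by rewrite /tpart mxtrace_scalar mulr2n -raddfB /= -[RHS](raddf0 (@scalar_mx F 2)); congr _%:M; field.
Qed.

(** The axis is determined up to scaling by the rotation, also when it is
    isotropic. *)
Lemma centralizer2 M x : ~~ is_scalar_mx M -> M * x = x * M -> \tr x = 0 ->
  exists k, x = k *: tpart M.
Proof.
rewrite -tpart_eq0 => m0 com x0.
have {com} : tpart M * x = x * tpart M.
  by rewrite /tpart mulrBl mulrBr com scalM Mscal.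
move: m0 x0 (tr_tpart M); move: (tpart M) => m.
have [a [b [c [d ->]]]] := mx2P m; have [p [q [r [s ->]]]] := mx2P x.
rewrite !mx2_tr => m0 /eqP; rewrite addrC addr_eq0 => /eqP -> /eqP.
rewrite addrC addr_eq0 => /eqP E; rewrite {}E in m0 *.
rewrite !mx2M => /mx2_inj[/eqP]; rewrite -subr_eq0 => /eqP e1 /eqP.
rewrite -subr_eq0 => /eqP e2 /eqP; rewrite -subr_eq0 => /eqP e3 _.
have e2' : 2%:R * (a * q - b * p) = 0 by rewrite -e2; ring.
have e3' : 2%:R * (c * p - a * r) = 0 by rewrite -e3; ring.
have {e2' e2}e2 : a * q - b * p = 0 by apply/eqP; move/eqP: e2'; rewrite mulf_eq0 (negbTE two).
have {e3' e3}e3 : c * p - a * r = 0 by apply/eqP; move/eqP: e3'; rewrite mulf_eq0 (negbTE two).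
have solve (k u v w : F) : k != 0 -> u * k = v * w -> u = v / k * w.
  by move=> k0 e; apply: (mulIf k0); rewrite e; field.
have [a0|a0] := eqVneq a 0; last first.
  exists (p / a); rewrite mx2Z; congr mx2; rewrite ?mulrN; try (congr (- _)); apply: solve => //.
  - by apply/eqP; rewrite -subr_eq0 -e2; apply/eqP; ring.
  - by apply/eqP; rewrite -subr_eq0 -oppr_eq0 -e3; apply/eqP; ring.
have [b0|b0] := eqVneq b 0; last first.
  exists (q / b); rewrite mx2Z; congr mx2; rewrite ?mulrN; try (congr (- _)); apply: solve => //.
  - by apply/eqP; rewrite -subr_eq0 -oppr_eq0 -e2; apply/eqP; ring.
  - by apply/eqP; rewrite -subr_eq0 -e1; apply/eqP; ring.
  - by apply/eqP; rewrite -subr_eq0 -oppr_eq0 -e2; apply/eqP; ring.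
have c0 : c != 0 by apply: contraNneq m0 => ->; rewrite a0 b0 oppr0 mx2_0.
exists (r / c); rewrite mx2Z; congr mx2; rewrite ?mulrN; try (congr (- _)); apply: solve => //.
- by apply/eqP; rewrite -subr_eq0 -e3; apply/eqP; ring.
- by apply/eqP; rewrite -subr_eq0 -oppr_eq0 -e1; apply/eqP; ring.
- by apply/eqP; rewrite -subr_eq0 -e3; apply/eqP; ring.
Qed.

(** Powers of [M] are [u_i M + v_i], where the [u_i] are Chebyshev polynomials
    in the trace; the hypothesis is that [u_2], ..., [u_5] do not vanish. *)
Lemma power_nonscalar M i : let T := \tr M in let d := \det M in
  ~~ is_scalar_mx M ->
  T * (T ^+ 2 - d) * (T ^+ 2 - 2%:R * d) * (T ^+ 4 - 3%:R * T ^+ 2 * d + d ^+ 2) != 0 ->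
  (0 < i < 6)%N -> ~~ is_scalar_mx (M ^+ i).
Proof.
move=> T d nM.
have sc u v : u != 0 -> ~~ is_scalar_mx (u *: M + v%:M).
  move=> u0; apply: contraNN nM => /is_scalar_mxP[z e]; apply/is_scalar_mxP.
  exists ((z - v) / u); apply: (scalerI u0); rewrite scale_scalar_mx.
  rewrite [u * _]mulrC divfK // (raddfB (@scalar_mx F 2)).
  exact: (canRL (addrK _) e).
have step u v : (u *: M + v%:M) * M = (T * u + v) *: M + (- (d * u))%:M.
  rewrite mulrDl -scalerAl cayley2 -/T -/d scalM.
  rewrite scalerBr scalerA addrAC -scalerDl scale_scalar_mx [u * T]mulrC.
  by rewrite (raddfN (@scalar_mx F 2)) [u * d]mulrC.
have e1 : M ^+ 1 = 1 *: M + 0%:M by rewrite expr1 scale1r raddf0 addr0.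
have p2 : M ^+ 2 = T *: M + (- d)%:M.
  by rewrite exprSr e1 step mulr1 addr0 mulr1.
have p3 : M ^+ 3 = (T ^+ 2 - d) *: M + (- (d * T))%:M by rewrite exprSr p2 step.
have p4 : M ^+ 4 = (T * (T ^+ 2 - 2%:R * d)) *: M + (- (d * (T ^+ 2 - d)))%:M.
  by rewrite exprSr p3 step; congr (_ *: _ + _); ring.
have p5 : exists v, M ^+ 5 = (T ^+ 4 - 3%:R * T ^+ 2 * d + d ^+ 2) *: M + v%:M.
  by eexists; rewrite exprSr p4 step; congr (_ *: _ + _); ring.
rewrite !mulf_eq0 !negb_or -!andbA => /and4P[n2 n3 n4 n5].
case: i => [|[|[|[|[|[|i]]]]]] // _.
- by rewrite p2 sc.
- by rewrite p3 sc.
- by rewrite p4 sc ?mulf_neq0.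
- by have [v ->] := p5; rewrite sc.
Qed.

Lemma tpartC M : M * tpart M = tpart M * M.
Proof. by rewrite /tpart mulrBl mulrBr scalM Mscal. Qed.

Definition gmat (A : {'GL_2[F]}) : M2 := @GLval 2 F A.

Lemma gmat_unit A : gmat A \is a GRing.unit.
Proof. exact: (valP A). Qed.
Lemma gmatM A B : gmat (A * B)%g = gmat A * gmat B.
Proof. by []. Qed.
Lemma gmat1 : gmat 1%g = 1.
Proof. by []. Qed.
Lemma gmatX A n : gmat (A ^+ n)%g = gmat A ^+ n.
Proof. by elim: n => // n IH; rewrite expgSr gmatM IH exprSr. Qed.
Lemma gmat_surj M : M \is a GRing.unit -> exists A, gmat A = M.
Proof. by move=> uM; exists (FinRing.Unit uM). Qed.

(** The inverse makes this a right action. *)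
Definition conj_fun (x : M2) (A : {'GL_2[F]}) : M2 := cj (gmat A)^-1 x.

Lemma conj_fun1 : conj_fun^~ 1%g =1 id.
Proof. by move=> x; rewrite /conj_fun /cj gmat1 !invr1 mul1r mulr1. Qed.
Lemma conj_funM x : act_morph conj_fun x.
Proof.
move=> A B; rewrite /conj_fun gmatM invrM ?gmat_unit // cjM ?unitrV ?gmat_unit //.
Qed.
Canonical conj_act := TotalAction conj_fun1 conj_funM.

Section Stabilizer.
Variable S0 : pred M2.
Local Notation K := (stabilizes S0).

Definition stab_set : {set {'GL_2[F]}} :=
  [set A : {'GL_2[F]} | [forall x, S0 x ==> S0 (cj (gmat A) x)]].

Lemma stab_setP A : reflect (K (gmat A)) (A \in stab_set).
Proof.
rewrite inE; apply: (iffP forallP) => [h|[_ h] x]; last by apply/implyP/h.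
by split=> [|x Sx]; [exact: gmat_unit | exact: (implyP (h x))].
Qed.

Lemma stab_group_set : group_set stab_set.
Proof.
apply/group_setP; split=> [|A B /stab_setP KA /stab_setP KB]; apply/stab_setP.
  by split; [exact: gmat_unit | move=> x; rewrite /cj gmat1 invr1 mulr1 mul1r].
by rewrite gmatM; apply: stabilizesM.
Qed.
Canonical stab_group := Group stab_group_set.

Lemma stab_setJ A B : A \in stab_set -> B \in stab_set -> (B ^ A)%g \in stab_set.
Proof.
move=> /stab_setP KA /stab_setP KB; apply/stab_setP; rewrite conjgE !gmatM.
by apply: stabilizesM; [exact: (stabilizesV KA) | exact: stabilizesM].
Qed.

Definition scalar_set : {set {'GL_2[F]}} := [set A in stab_set | is_scalar_mx (gmat A)].

Lemma scalar_setE A : (A \in scalar_set) = (A \in stab_set) && is_scalar_mx (gmat A).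
Proof. by rewrite [LHS]inE. Qed.

Lemma scalar_group_set : group_set scalar_set.
Proof.
apply/group_setP; split=> [|A B]; rewrite !scalar_setE.
  by rewrite (group1 stab_group) /=; apply/is_scalar_mxP; exists 1.
move=> /andP[gA /is_scalar_mxP[a Aa]] /andP[gB /is_scalar_mxP[b Bb]].
rewrite (@groupM _ stab_group) // andTb.
by apply/is_scalar_mxP; exists (a * b); rewrite gmatM Aa Bb scalM scale_scalar_mx.
Qed.
Canonical scalar_group := Group scalar_group_set.

Hypothesis no_unipotent : forall N, N != 0 -> N * N = 0 -> ~ K (1 + N).

(** A nonscalar matrix whose traceless part is isotropic is a scalar multiple
    of a unipotent. *)
Lemma det_tpart_neq0 M : K M -> ~~ is_scalar_mx M -> \det (tpart M) != 0.
Proof.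
move=> KM nM; apply/negP => /eqP d0; have [uM _] := KM.
have t0 : \tr M / 2%:R != 0.
  move: uM; rewrite mx2_unit; apply: contraNneq => e.
  by move: d0; rewrite det_tpart e expr0n subr0 => ->.
set z := \tr M / 2%:R in t0.
apply: (no_unipotent (N := z^-1 *: tpart M)).
- by rewrite scaler_eq0 invr_eq0 (negbTE t0) /= tpart_eq0.
- by rewrite -scalerAl -scalerAr trless_sqr ?tr_tpart // d0 oppr0 raddf0 !scaler0.
apply: (stabilizes_eq t0 (N := M)) => //.
by rewrite {1}[M]tpartK -/z scalerDr scalerA mulfV // scale1r scalemx1.
Qed.

Section Witness.
Variables (nu : F).
Hypothesis nu_class : forall d : F, d != 0 -> exists2 c, c != 0 & (c ^+ 2 * d == 1) || (c ^+ 2 * d == nu).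
Hypothesis nu_sep : nu != 0 /\ ~~ nonzero_square nu.

(** The axes of the nonscalar elements of the group, each normalised to
    determinant 1 or [nu], [nu] being a fixed nonsquare: this leaves two
    opposite poles on every axis. *)
Definition poles : {set M2} := [set x | [&& \tr x == 0, (\det x == 1) || (\det x == nu) &
  [exists A in stab_set, ~~ is_scalar_mx (gmat A) && (gmat A * x == x * gmat A)]]].

Lemma commute_cj M x : M \is a GRing.unit -> (cj M^-1 x == x) = (M * x == x * M).
Proof.
move=> uM; apply/eqP/eqP => [{1}<-|e].
  by rewrite /cj invrK !mulrA mulrV // mul1r.
by rewrite /cj invrK -mulrA -e mulrA mulVr // mul1r.
Qed.

Lemma acts_poles : [acts stab_group, on poles | conj_act].
Proof.
apply/subsetP => A gA; rewrite inE /= !inE /=; apply/subsetP => x.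
rewrite !inE /= /conj_fun => /and3P[/eqP x0 dx /existsP[B /and3P[gB nB /eqP cB]]].
have uA := gmat_unit A; have uV : (gmat A)^-1 \is a GRing.unit by rewrite unitrV.
rewrite cj_tr // cj_det // x0 eqxx dx /=; apply/existsP; pose C := (B ^ A)%g.
have CG : C \in stab_set by apply: stab_setJ.
exists C; rewrite CG.
have E : gmat C = cj (gmat A)^-1 (gmat B) by rewrite /C /cj invrK conjgE mulgA.
rewrite E -!cjMr // cB eqxx andbT andTb.
apply: contraNN nB => /is_scalar_mxP[z e]; apply/is_scalar_mxP; exists z.
by rewrite -[LHS](cjVK _ uA) e cjS.
Qed.

Lemma pole_of M : K M -> ~~ is_scalar_mx M -> exists2 k, k != 0 & k *: tpart M \in poles.
Proof.
move=> KM nM; have d0 := det_tpart_neq0 KM nM.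
have [k k0 kd] := nu_class d0; exists k => //.
rewrite inE mxtraceZ tr_tpart mulr0 eqxx detZ kd /=; apply/existsP.
have [uM _] := KM; have [A AM] := gmat_surj uM; exists A.
rewrite AM nM; apply/andP; split; first by apply/stab_setP; rewrite AM.
by rewrite andTb -scalerAl -scalerAr tpartC eqxx.
Qed.

Lemma pole_scale x k : x \in poles -> k *: x \in poles -> k = 1 \/ k = -1.
Proof.
rewrite !inE mxtraceZ detZ => /and3P[_ dx _] /and3P[_ kx _].
have [nu0 /nonzero_squareP nns] := nu_sep.
suff /eqP : k ^+ 2 = 1 by rewrite sqrf_eq1 => /orP[] /eqP; [left | right].
case/orP: dx kx => /eqP -> /orP[] /eqP //; rewrite ?mulr1 //.
- move=> e; case: nns; exists k => //; apply: contraNneq nu0 => k0.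
  by rewrite -e k0 expr0n.
- move=> e; have k0 : k != 0.
    by apply: contraNneq (oner_neq0 F) => k0; rewrite -e k0 expr0n mul0r.
  case: nns; exists k^-1; first by rewrite invr_eq0.
  by apply: (mulfI (expf_neq0 2 k0)); rewrite e exprVn mulfV ?expf_neq0.
by move=> e; apply: (mulIf nu0); rewrite e mul1r.
Qed.

Lemma pole_neq0 x : x \in poles -> x != 0.
Proof.
rewrite !inE => /and3P[_ dx _]; have [nu0 _] := nu_sep.
apply: contraTneq dx => ->; rewrite det0 negb_or ![0 == _]eq_sym nu0.
by rewrite oner_neq0.
Qed.

Lemma opp_pole x : x \in poles -> - x \in poles.
Proof.
rewrite !inE -scaleN1r mxtraceZ detZ sqrrN expr1n mul1r mulf_eq0 => /and3P[-> ->].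
case/existsP => A /and3P[gA nA /eqP cA]; rewrite orbT /=; apply/existsP; exists A.
by rewrite gA nA -scalerAl -scalerAr cA eqxx.
Qed.

Lemma fixed_poles A x : A \in stab_set -> ~~ is_scalar_mx (gmat A) ->
  x \in poles -> gmat A * x = x * gmat A ->
  forall y, y \in poles -> gmat A * y = y * gmat A -> y = x \/ y = - x.
Proof.
move=> gA nA px cx y py cy.
have px0 : \tr x = 0 by move: px; rewrite inE => /andP[/eqP].
have py0 : \tr y = 0 by move: py; rewrite inE => /andP[/eqP].
have [k xk] := centralizer2 nA cx px0; have [l yl] := centralizer2 nA cy py0.
have k0 : k != 0 by apply: contraNneq (pole_neq0 px) => k0; rewrite xk k0 scale0r.
have yx : y = (l / k) *: x by rewrite xk scalerA divfK.
rewrite yx in py; have := pole_scale px py.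
by rewrite yx => -[] ->; [left; rewrite scale1r | right; rewrite scaleN1r].
Qed.

Lemma card_fixed_poles A : A \in stab_set -> ~~ is_scalar_mx (gmat A) ->
  #|'Fix_(poles | conj_act)[A]%g| = 2%N.
Proof.
move=> gA nA; have KA := stab_setP _ gA.
have [k k0 px] := pole_of KA nA; set x := k *: _ in px.
have cx : gmat A * x = x * gmat A by rewrite /x -scalerAl -scalerAr tpartC.
have xx : x != - x.
  by rewrite -subr_eq0 opprK -mulr2n -scaler_nat scaler_eq0 (negbTE two) pole_neq0.
have -> : 'Fix_(poles | conj_act)[A]%g = [set x; - x]; last by rewrite cards2 xx.
have fixE y : (y \in 'Fix_(poles | conj_act)[A]%g) = (y \in poles) && (gmat A * y == y * gmat A).
  rewrite in_setI; congr andb; rewrite -(commute_cj y (gmat_unit A)).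
  by apply/afix1P/eqP.
apply/setP => y; rewrite fixE in_set2; apply/andP/orP.
  by case=> py /eqP cy; case: (fixed_poles gA nA px cx py cy) => ->; rewrite eqxx; [left | right].
case=> /eqP ->; first by rewrite px cx eqxx.
by rewrite opp_pole // mulrN mulNr cx eqxx.
Qed.

Lemma conj_act_fix A x : gmat A * x = x * gmat A -> conj_act x A = x.
Proof. by move/eqP; rewrite -commute_cj ?gmat_unit // => /eqP. Qed.

Lemma scalar_sub_stab x : scalar_group \subset 'C_stab_group[x | conj_act]%g.
Proof.
apply/subsetP => B; rewrite scalar_setE => /andP[gB /is_scalar_mxP[z e]].
rewrite in_setI; apply/andP; split=> //; apply/astab1P/conj_act_fix.
by rewrite e scalM Mscal.
Qed.

Lemma card_stab_two x : x \in poles ->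
  (2 * #|scalar_group| <= #|'C_stab_group[x | conj_act]%g|)%N.
Proof.
move=> px; have := px; rewrite inE => /and3P[_ _ /existsP[A /and3P[gA nA /eqP cA]]].
set C := 'C_stab_group[x | conj_act]%G.
have AC : A \in C.
  by rewrite in_setI; apply/andP; split=> //; apply/astab1P/conj_act_fix.
have ZC := scalar_sub_stab x.
rewrite -(Lagrange ZC) mulnC leq_pmul2l ?cardG_gt0 // ltn_neqAle eq_sym indexg_gt0 andbT.
apply: contraNneq nA => /eqP; rewrite indexg_eq1 => CZ.
by have := subsetP CZ A AC; rewrite scalar_setE => /andP[].
Qed.

(** The first six powers of [A] lie in different cosets of the scalars. *)
Lemma card_stab_six A x : A \in stab_set -> gmat A * x = x * gmat A ->
  (forall i, (0 < i < 6)%N -> ~~ is_scalar_mx (gmat A ^+ i)) ->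
  (6 * #|scalar_group| <= #|'C_stab_group[x | conj_act]%g|)%N.
Proof.
move=> gA cx nA; set C := 'C_stab_group[x | conj_act]%G.
have AC : A \in C.
  by rewrite in_setI; apply/andP; split=> //; apply/astab1P/conj_act_fix.
pose h (u : 'I_6 * {'GL_2[F]}) := (A ^+ u.1 * u.2)%g.
have sc B : B \in scalar_set -> exists z, gmat B = z%:M.
  by rewrite scalar_setE => /andP[_ /is_scalar_mxP].
have scV B : B \in scalar_set -> exists2 z, z != 0 & gmat B = z%:M.
  move=> /sc[z e]; exists z => //; have := gmat_unit B.
  by rewrite mx2_unit e det_scalar expf_eq0.
have le (i j : nat) B B' : (i <= j < 6)%N -> B \in scalar_set -> B' \in scalar_set ->
    (A ^+ i * B = A ^+ j * B')%g -> i = j.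
  move=> /andP[ij j6] /sc[z Bz] /scV[z' z'0 Bz'] e; apply/eqP.
  rewrite eqn_leq ij leqNgt; apply/negP => lt.
  have ji6 : (0 < j - i < 6)%N.
    by rewrite subn_gt0 lt (leq_ltn_trans (leq_subr _ _) j6).
  case/negP: (nA _ ji6).
  move: e; rewrite -{1}(subnKC ij) expgD -mulgA => /mulgI/(congr1 gmat).
  rewrite gmatM gmatX Bz Bz' Mscal => e; apply/is_scalar_mxP; exists (z / z').
  by apply: (scalerI z'0); rewrite -e scale_scalar_mx mulrC divfK.
have inj : {in setX [set: 'I_6] scalar_set &, injective h}.
  move=> [i B] [j B'] /setXP[_ ZB] /setXP[_ ZB'] e.
  have ij : i = j.
    apply: val_inj => /=; have [ij|ji] := leqP i j.
      by apply: (le i j B B') => //; rewrite ij ltn_ord.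
    by apply/esym/(le j i B' B) => //; rewrite (ltnW ji) ltn_ord.
  by move: e; rewrite ij /h /= => /mulgI ->.
have sub : h @: setX [set: 'I_6] scalar_set \subset C.
  apply/subsetP => _ /imsetP[[i B] /setXP[_ ZB] ->]; rewrite /h /= groupM ?groupX //.
  exact: (subsetP (scalar_sub_stab x)).
by have := subset_leq_card sub; rewrite (card_in_imset inj) cardsX cardsT card_ord.
Qed.

(** The orbit of [x] has at most two elements. As [A] permutes the orbit and
    fixes [x], it fixes a second element as well, which is then the other pole
    of [A], namely [- x]. *)
Lemma axis_stable A x : A \in stab_set -> x \in poles -> gmat A * x = x * gmat A ->
  (forall i, (0 < i < 6)%N -> ~~ is_scalar_mx (gmat A ^+ i)) ->
  forall M, K M -> exists k, cj M x = k *: x.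
Proof.
move=> gA px cx nA.
have ltO : (#|orbit conj_act stab_group x| <= 2)%N.
  apply: (@two_pole_orbit _ _ conj_act stab_group scalar_group poles x) => //.
  - by apply/subsetP => B; rewrite scalar_setE => /andP[].
  - exact: acts_poles.
  - move=> B y; rewrite scalar_setE => /andP[_ /is_scalar_mxP[z e]] _.
    by apply: conj_act_fix; rewrite e scalM Mscal.
  - by move=> B gB; rewrite scalar_setE gB /=; exact: card_fixed_poles.
  - exact: card_stab_two.
  - exact: card_stab_six nA.
have nA1 : ~~ is_scalar_mx (gmat A) by apply: (nA 1%N).
have fixO y : y \in orbit conj_act stab_group x -> y = x \/ y = - x.
  move=> yO; have py : y \in poles by apply: (subsetP (_ : _ \subset poles)) yO; rewrite acts_sub_orbit ?acts_poles.
  have [->|yx] := eqVneq y x; first by left.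
  apply: (fixed_poles gA nA1 px cx py); apply/eqP; rewrite -commute_cj ?gmat_unit //.
  have xO : x \in orbit conj_act stab_group x by exact: orbit_refl.
  have eO : orbit conj_act stab_group x = [set x; y].
    apply/eqP; rewrite eq_sym eqEcard cards2 eq_sym yx ltO andbT.
    by apply/subsetP => w /set2P[] ->.
  have : conj_act y A \in orbit conj_act stab_group x.
    by have /orbit_eqP <- := yO; apply: mem_orbit.
  rewrite eO => /set2P[] e; last exact/eqP.
  case/eqP: yx.
  by apply: (act_inj conj_act A); rewrite e conj_act_fix.
move=> M /stabilizesV KM; have [uM _] := KM.
have [B BM] := gmat_surj uM.
have gB : B \in stab_group by apply/stab_setP; rewrite BM.
have : conj_act x B = cj M x by rewrite /= /conj_fun BM invrK.
have [->|->] := fixO _ (mem_orbit conj_act x gB) => <-.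
  by exists 1; rewrite scale1r.
by exists (-1); rewrite scaleN1r.
Qed.

End Witness.

(** A rotation of order at least six in the group has a pole [x] with a stable
    axis. A half turn about [f] preserves the axis of [x] only if [f] is
    orthogonal to [x] or proportional to it. If one of [f0], [f1], [f2] were
    proportional to [x], its neighbour in the chain, being neither orthogonal
    nor proportional to it, would move the axis. So all three are orthogonal
    to [x], and they span. *)
Lemma linked_half_turns_no_axis f0 f1 f2 M :
  K f0 -> K f1 -> K f2 -> \tr f0 = 0 -> \tr f1 = 0 -> \tr f2 = 0 ->
  \tr (f0 * f2) = 0 -> \tr (f0 * f1) != 0 -> \tr (f1 * f2) != 0 ->
  (forall x, \tr x = 0 -> \tr (x * f0) = 0 -> \tr (x * f1) = 0 ->
     \tr (x * f2) = 0 -> x = 0) ->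
  K M -> ~~ is_scalar_mx M ->
  (let T := \tr M in let d := \det M in
  T * (T ^+ 2 - d) * (T ^+ 2 - 2%:R * d) * (T ^+ 4 - 3%:R * T ^+ 2 * d + d ^+ 2) != 0) ->
  False.
Proof.
move=> K0 K1 K2 t0 t1 t2 t02 t01 t12 span KM nM exo.
have [nu [nu0 nns]] := exists_nonsquare two.
have nu_class d : d != 0 -> exists2 c, c != 0 & (c ^+ 2 * d == 1) || (c ^+ 2 * d == nu).
  move=> d0; have [/nonzero_squareP[e e0 ->]|nd] := boolP (nonzero_square d).
    by exists e^-1; rewrite ?invr_eq0 // exprVn mulVf ?expf_neq0 // eqxx.
  by have [c c0 ->] := square_class two d0 nu0 nd nns; exists c; rewrite // eqxx orbT.
have [k k0 px] := pole_of nu_class KM nM; set x := k *: _ in px.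
have [uM _] := KM; have [A AM] := gmat_surj uM.
have gA : A \in stab_set by apply/stab_setP; rewrite AM.
have stab := axis_stable nu_class (conj nu0 nns) gA px.
have cx : gmat A * x = x * gmat A by rewrite AM /x -scalerAl -scalerAr tpartC.
have {}stab N : K N -> exists l, cj N x = l *: x.
  by apply: stab => // i i6; rewrite AM; apply: power_nonscalar.
have x0 : \tr x = 0 by rewrite /x mxtraceZ tr_tpart mulr0.
have xn0 : x != 0 := pole_neq0 (conj nu0 nns) px.
have dx : \det x != 0 by rewrite /x detZ mulf_neq0 ?expf_neq0 ?det_tpart_neq0.
have ux : x \is a GRing.unit by rewrite mx2_unit.
have alt f : K f -> \tr f = 0 -> \tr (x * f) = 0 \/ exists b, f = b *: x.
  move=> Kf ft; have [uf _] := Kf; have [l e] := stab f Kf.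
  have fx : f * x = l *: (x * f) by rewrite scalerAl -e /cj mulrVK.
  have anti : f * x + x * f = (\tr (x * f))%:M.
    move: ft x0; have [a [b [c [d ->]]]] := mx2P f; have [a' [b' [c' [d' ->]]]] := mx2P x.
    rewrite !mx2_tr => /eqP; rewrite addrC addr_eq0 => /eqP -> /eqP.
    by rewrite addrC addr_eq0 => /eqP ->; rewrite !mx2E; congr mx2; ring.
  have [->|tn] := eqVneq (\tr (x * f)) 0; [by left | right].
  set T := \tr (x * f) in anti tn.
  have E : (l + 1) *: (x * f) = T%:M by rewrite scalerDl scale1r -fx.
  have l1 : l + 1 != 0.
    apply: contraNneq tn => l1.
    by have /matrixP/(_ 0 0) := E; rewrite l1 scale0r !mxE mulr1n => <-.
  exists (- (T / (l + 1) / \det x)); apply: (mulrI ux); apply: (scalerI l1).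
  rewrite E -scalerAr trless_sqr // !scale_scalar_mx; congr _%:M.
  by field; rewrite l1 dx.
(* were [f] on the axis, [g] would be orthogonal or proportional to it *)
have far f g : K g -> \tr g = 0 -> \tr (f * g) != 0 -> (forall b, g != b *: f) ->
    forall b, f != b *: x.
  move=> Kg g0 fg gf b; apply/negP => /eqP fx.
  have b0 : b != 0 by apply: contraNneq fg => b0; rewrite fx b0 scale0r mul0r mxtrace0.
  case: (alt g Kg g0) => [xg|[c gx]].
    by case/eqP: fg; rewrite fx -scalerAl mxtraceZ xg mulr0.
  by case/eqP: (gf (c / b)); rewrite fx scalerA divfK.
have n01 b : f1 != b *: f0.
  apply/eqP => e; case/eqP: t12; rewrite e -scalerAl mxtraceZ t02 mulr0 //.
have n10 b : f0 != b *: f1.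
  apply/eqP => e; case/eqP: t01; rewrite e -scalerAl mxtraceZ.
  have : b * \tr (f1 * f2) = 0 by rewrite -mxtraceZ scalerAl -e.
  by move/eqP; rewrite mulf_eq0 (negbTE t12) orbF => /eqP ->; rewrite mul0r.
have n12 b : f1 != b *: f2.
  apply/eqP => e; case/eqP: t01; rewrite e -scalerAr mxtraceZ t02 mulr0 //.
have x0' f : K f -> \tr f = 0 -> (forall b, f != b *: x) -> \tr (x * f) = 0.
  by move=> Kf f0' nf; case: (alt f Kf f0') => // -[b e]; case/eqP: (nf b).
case/eqP: xn0; apply: span => //; apply: x0' => //.
- exact: (far f0 f1).
- by apply: (far f1 f0) => //; rewrite trM2C.
- by apply: (far f2 f1) => //; rewrite trM2C.
Qed.
End Stabilizer.
End Unipotent.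

(** * Transvections over a quadratic extension of the prime field *)

Section Dickson.
Variable F : finFieldType.
Hypothesis two : (2%:R : F) != 0.
Hypothesis three : (3%:R : F) != 0.
Local Notation M2 := 'M[F]_2.

(** The prime field of [F], as the image of the natural numbers. *)
Definition prime_sub (x : F) : Prop := exists n : nat, x = n%:R.
Definition prime_span (y : F) : Prop :=
  forall x, exists a b, [/\ prime_sub a, prime_sub b & x = a + b * y].
Local Notation k0 := prime_sub.

Lemma prime_sub_nat n : k0 n%:R. Proof. by exists n. Qed.
Lemma prime_subD x y : k0 x -> k0 y -> k0 (x + y).
Proof. by move=> [m ->] [n ->]; exists (m + n)%N; rewrite natrD. Qed.
Lemma prime_subM x y : k0 x -> k0 y -> k0 (x * y).
Proof. by move=> [m ->] [n ->]; exists (m * n)%N; rewrite natrM. Qed.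
Lemma prime_subX x n : k0 x -> k0 (x ^+ n).
Proof. by move=> [m ->]; exists (m ^ n)%N; rewrite natrX. Qed.
(** The number [#|F| - 1] represents -1. *)
Lemma prime_subN x : k0 x -> k0 (- x).
Proof.
move=> kx; rewrite -mulN1r; apply: prime_subM => //; exists #|F|.-1.
apply/eqP; rewrite eq_sym -addr_eq0 -(natrD _ _ 1) addn1 prednK ?card_natr //.
by apply/card_gt0P; exists 0.
Qed.
Lemma prime_subB x y : k0 x -> k0 y -> k0 (x - y).
Proof. by move=> kx ky; apply: prime_subD => //; apply: prime_subN. Qed.
Lemma prime_subV x : k0 x -> k0 x^-1.
Proof.
move=> kx; have [->|x0] := eqVneq x 0; first by rewrite invr0; exists 0%N.
have F1 := card_finNzRing_gt1 F.
have -> : x^-1 = x ^+ (#|F| - 2); last exact: prime_subX.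
apply: (mulfI x0); apply: (mulfI x0); rewrite mulfV // mulr1 -!exprS.
have -> : (#|F| - 2).+2 = #|F| by rewrite -addn2 subnK.
by rewrite expf_card.
Qed.
Lemma prime_sub1 : k0 1. Proof. exact: (prime_sub_nat 1). Qed.
Lemma prime_sub0 : k0 0. Proof. exact: (prime_sub_nat 0). Qed.

Ltac prime_sub_tac := repeat first [assumption | apply: prime_sub1 | apply: prime_sub0 | apply: prime_sub_nat
  | apply: prime_subV | apply: prime_subX | apply: prime_subN | apply: prime_subM | apply: prime_subD].

Variable S : pred M2.
Local Notation K := (stabilizes S).

Section Quadratic.
Variable lam : F.
Hypothesis lamN : ~ k0 lam.
Hypothesis span : prime_span lam.

Lemma prime_span_free a b : k0 a -> k0 b -> a + b * lam = 0 -> a = 0 /\ b = 0.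
Proof.
move=> ka kb e; have b0 : b = 0.
  apply/eqP/negPn/negP => b0; apply: lamN; have -> : lam = - a / b; last by prime_sub_tac.
  by apply: (mulIf b0); rewrite divfK //; apply/eqP; rewrite -subr_eq0 opprK mulrC addrC e.
by split=> //; move: e; rewrite b0 mul0r addr0.
Qed.

(** Dickson's theorem on the subgroup of SL2 generated by two opposite
    transvections, in the case of a quadratic extension. A product of
    transvections of the group is rewritten as [g'] times a lower triangular
    matrix with diagonal [t^-1, t], which is therefore in the group as well.
    It normalises the lower transvections and multiplies their parameters by
    [t ^ 2]. As [t ^ 2] is not in the prime field, parameters in the prime
    field and in its multiple by [t ^ 2] together give all of [F]. *)
Lemma lower_generated : (forall i, k0 i -> K (lower i)) ->
  (forall j, k0 j -> K (upper (j * lam))) -> forall u, K (lower u).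
Proof.
move=> KL KU; have [n' [s [kn' ks lam2]]] := span (lam ^+ 2).
have [n [kn {n' kn'} lam2]] : exists n, k0 n /\ lam ^+ 2 = s * lam - n.
  by exists (- n'); split; [prime_sub_tac | rewrite lam2 opprK addrC].
(* [l1] serves to make the diagonal entry [t] nonzero, [l2] to put [t ^ 2]
   outside the prime field; there are elements 1, 2, 3 to choose from *)
have [l [kl l0 l1 l2]] : exists l, [/\ k0 l, l != 0, 1 + l + s + n != 0 & 2%:R * (1 + l) + s != 0].
  have av a b : exists l, [/\ k0 l, l != 0, l != a & l != b].
    have [?|n1] := eqVneq 1 a; last have [?|n1'] := eqVneq 1 b.
    - have [?|n2] := eqVneq 2%:R b; last first.
        exists 2%:R; split=> //; first exact: prime_sub_nat.
        by subst a; rewrite -subr_eq0 (_ : _ - _ = 1) ?oner_eq0 //; ring.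
      exists 3%:R; subst a b; split=> //; first exact: prime_sub_nat.
        by rewrite -subr_eq0 (_ : _ - _ = 2%:R) //; ring.
      by rewrite -subr_eq0 (_ : _ - _ = 1) ?oner_eq0 //; ring.
    - have [?|n2] := eqVneq 2%:R a; last first.
        exists 2%:R; split=> //; first exact: prime_sub_nat.
        by subst b; rewrite -subr_eq0 (_ : _ - _ = 1) ?oner_eq0 //; ring.
      exists 3%:R; subst a b; split=> //; first exact: prime_sub_nat.
        by rewrite -subr_eq0 (_ : _ - _ = 1) ?oner_eq0 //; ring.
      by rewrite -subr_eq0 (_ : _ - _ = 2%:R) //; ring.
    by exists 1; rewrite oner_neq0; split=> //; exact: prime_sub1.
  have [l [kl l0 la lb]] := av (- (1 + s + n)) (- (1 + s / 2%:R)).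
  exists l; split=> //.
    by move: la; rewrite -subr_eq0 opprK (_ : l + _ = 1 + l + s + n) //; ring.
  have -> : 2%:R * (1 + l) + s = 2%:R * (l - - (1 + s / 2%:R)) by field.
  by rewrite mulf_neq0 // subr_eq0.
have nz : 1 + l + lam != 0.
  by apply/eqP => e; apply: lamN; have -> : lam = - (1 + l); [apply/eqP; rewrite -addr_eq0 addrC e | prime_sub_tac].
have [al [be [kal kbe ab]]] := span ((1 + lam) / (1 + l + lam)).
have E : 1 + lam = (al + be * lam) * (1 + l + lam) by rewrite -ab divfK.
have al0 : al != 0.
  apply/eqP => al0; have [|||e1 e2] := @prime_span_free (1 + be * n) (1 - be * (1 + l + s)); try by prime_sub_tac.
    transitivity (1 + lam - be * (s * lam - n + lam * (1 + l))); first ring.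
    by rewrite -lam2 E al0; ring.
  case/eqP: l1; have be0 : be != 0.
    by apply: contraPneq e1 => ->; rewrite mul0r addr0; apply/eqP/oner_neq0.
  apply: (mulfI be0); rewrite mulr0; transitivity ((1 + be * n) - (1 - be * (1 + l + s))); first ring.
  by rewrite e1 e2 subr0.
pose t := (1 + l + lam) * al.
have t0 : t != 0 by rewrite mulf_neq0.
pose g := lower l^-1 * upper (l * lam); pose g' := lower be * upper (al^-1 * lam).
have Kg : K g by apply: stabilizesM; [apply: KL | apply: KU]; prime_sub_tac.
have Kg' : K g' by apply: stabilizesM; [apply: KL | apply: KU]; prime_sub_tac.
have [c gE] : exists c, upper (1 * lam) * g = g' * mx2 t^-1 0 c t.
  exists (l^-1 - be * (1 + lam * l^-1)); rewrite /g /g' /upper /lower !mx2M.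
  have lam0 : lam != 0 by apply/eqP => e; apply: lamN; rewrite e; exact: prime_sub0.
  have bE : be = ((1 + lam) / (1 + l + lam) - al) / lam by rewrite ab addrAC subrr add0r mulfK.
  by congr mx2; rewrite ?bE /t; field; rewrite ?lam0 ?l0 ?nz ?al0.
have Kb : K (mx2 t^-1 0 c t).
  have [ug' _] := Kg'; rewrite -[mx2 _ _ _ _](mulKr ug') -gE.
  by apply: stabilizesM; [exact: stabilizesV | apply: stabilizesM => //; apply: KU; prime_sub_tac].
have KL2 j : k0 j -> K (lower (t ^+ 2 * j)).
  move=> kj; have [ub _] := Kb.
  have -> : lower (t ^+ 2 * j) = mx2 t^-1 0 c t * lower j * (mx2 t^-1 0 c t)^-1.
    by apply/esym/cjP => //; rewrite /lower !mx2M; congr mx2; field.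
  by apply: stabilizesM; [apply: stabilizesM => //; exact: KL | exact: stabilizesV].
move=> u; have [x [y [kx ky ->]]] := span u.
pose c1 := 2%:R * (1 + l) + s; pose c0 := (1 + l) ^+ 2 - n.
have tE : t ^+ 2 = al ^+ 2 * (c0 + c1 * lam).
  have -> : c0 + c1 * lam = (1 + l) ^+ 2 + 2%:R * (1 + l) * lam + (s * lam - n) by rewrite /c0 /c1; ring.
  by rewrite -lam2 /t; ring.
have -> : x + y * lam = (x - y * c0 / c1) + t ^+ 2 * (y / (al ^+ 2 * c1)).
  by rewrite tE; field; rewrite al0 l2.
rewrite -lowerD; apply: stabilizesM; [apply: KL | apply: KL2]; rewrite /c0 /c1; prime_sub_tac.
Qed.
End Quadratic.

(** Conjugating the set conjugates its stabiliser; this is how a pair of root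
    subgroups is put in standard position. *)
Lemma stabilizes_cj (P M : M2) : P \is a GRing.unit ->
  stabilizes (fun x => S (cj P x)) M <-> K (cj P M).
Proof.
move=> uP; have uPV : P^-1 \is a GRing.unit by rewrite unitrV.
have uE : (cj P M \is a GRing.unit) = (M \is a GRing.unit) by rewrite !mx2_unit cj_det.
have cjE x : M \is a GRing.unit -> cj (cj P M) (cj P x) = cj P (cj M x).
  move=> uM; have uPM : P * M \is a GRing.unit by rewrite unitrMl.
  by rewrite -[cj P M]/(P * M * P^-1) cjM // cjK // -cjM // .
split=> -[uM h]; split; rewrite ?uE // in uM *.
  by move=> x Sx; rewrite -[x](cjVK _ uP) cjE //; apply: h; rewrite cjVK.
by move=> x Sx; rewrite -cjE //; apply: h.
Qed.

(** By Cayley-Hamilton, as the determinant vanishes first. *)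
Lemma nilpotent_tr (N : M2) : N * N = 0 -> \tr N = 0 /\ \det N = 0.
Proof.
move=> N2; have d0 : \det N = 0.
  by have := congr1 (fun m : M2 => \det m) N2; rewrite detM2 det0 => /eqP; rewrite mulf_eq0 orbb => /eqP.
split=> //; have := cayley2 N; rewrite N2 d0 raddf0 subr0 => /esym/eqP.
by rewrite scaler_eq0 => /orP[/eqP //|/eqP ->]; rewrite mxtrace0.
Qed.

(** [N] has its standard form in a suitable basis by [traceless_companion]. A
    lower transvection centralises it and can be used to make [N'] strictly
    upper triangular, because the pairing, which is the upper right entry of
    [N'], is not 0. *)
Lemma standard_pair (N N' : M2) lam : N * N = 0 -> N' * N' = 0 -> \tr (N * N') = lam ->
  lam != 0 -> exists2 P, P \is a GRing.unit &
    cj P (mx2 0 0 1 0) = N /\ cj P (mx2 0 lam 0 0) = N'.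
Proof.
move=> N2 N'2 tNN l0; have [tN dN] := nilpotent_tr N2; have [tN' dN'] := nilpotent_tr N'2.
have N0 : N != 0 by apply: contraNneq l0 => e; rewrite -tNN e mul0r mxtrace0.
have [M uM NM] := traceless_companion two tN N0; rewrite dN oppr0 in NM.
have uMV : M^-1 \is a GRing.unit by rewrite unitrV.
have : exists x : M2, N' = cj M x by exists (cj M^-1 N'); rewrite cjVK.
case=> x xE; move: tNN tN' dN'; rewrite xE NM -cjMr // !cj_tr // cj_det // => txE tx dx.
have [a [b [c [d xm]]]] := mx2P x.
move: txE tx dx; rewrite xm mx2M !mx2_tr mx2_det !(mul0r, mul1r, add0r, addr0) => bl.
move=> /eqP; rewrite addrC addr_eq0 => /eqP dE e.
have uL u : M * lower u \is a GRing.unit by rewrite unitrMl ?lower_unit.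
exists (M * lower (- (a / lam))); first exact: uL.
rewrite !cjM ?lower_unit // !cj_lower; split; congr cj; congr mx2; rewrite ?dE -?bl; try ring.
- by field; rewrite bl.
- by move: e; rewrite dE => /eqP; rewrite subr_eq0 => /eqP e; field: e; rewrite bl.
- by field; rewrite bl.
Qed.

Lemma lower_pow (N : M2) u v : N * N = 0 -> (1 + u *: N) * (1 + v *: N) = 1 + (u + v) *: N.
Proof.
move=> N2; rewrite mulrDl mul1r mulrDr mulr1 -scalerAl -scalerAr N2 !scaler0 addr0.
by rewrite -addrA -scalerDl [v + u]addrC.
Qed.

Lemma prime_transvections (N : M2) : N * N = 0 -> K (1 + N) -> forall i, k0 i -> K (1 + i *: N).
Proof.
move=> N2 KN _ [n ->]; elim: n => [|n IH].
  rewrite scale0r addr0; split; first exact: unitr1.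
  by move=> x; rewrite /cj invr1 mulr1 mul1r.
by rewrite -natr1 -lower_pow // scale1r; exact: stabilizesM.
Qed.
End Dickson.

(** * Root subgroups from one unipotent *)

Section Full.
Variable F : finFieldType.
Hypothesis two : (2%:R : F) != 0.
Local Notation M2 := 'M[F]_2.
Local Notation k0 := (@prime_sub F).
Implicit Types (N a x : M2).

(** A decidable form of [prime_sub]: multiples of 1 repeat after [#|F|] steps.
    *)
Definition prime_sub_bool (x : F) := [exists i : 'I_#|F|, x == i%:R].
Lemma prime_subP (x : F) : reflect (k0 x) (prime_sub_bool x).
Proof.
apply: (iffP existsP) => [[i /eqP ->]|[n ->]]; first by exists i.
have F0 : (0 < #|F|)%N by apply/card_gt0P; exists 0.
exists (Ordinal (ltn_pmod n F0)) => /=.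
by rewrite {1}(divn_eq n #|F|) natrD natrM card_natr mulr0 add0r.
Qed.

Lemma cj_trless a x : \tr a = 0 -> \det a != 0 -> \tr x = 0 ->
  cj a x = - (x + (\tr (a * x) / \det a) *: a).
Proof.
move=> a0 da x0; apply: cjP; rewrite ?mx2_unit //.
move: a0 da x0; have [p [q [r [s ->]]]] := mx2P a; have [p' [q' [r' [s' ->]]]] := mx2P x.
rewrite !mx2_tr mx2_det => /eqP; rewrite addrC addr_eq0 => /eqP -> nz /eqP.
by rewrite addrC addr_eq0 => /eqP ->; rewrite !mx2E; congr mx2; field.
Qed.

Lemma tr_nilpotent_cj N a : N * N = 0 -> \tr a = 0 -> \det a != 0 ->
  \tr (N * cj a N) = - (\tr (N * a) ^+ 2 / \det a).
Proof.
move=> N2 a0 da; have [tN dN] := nilpotent_tr N2.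
rewrite cj_trless // mulrN mulrDr N2 add0r -scalerAr raddfN /= mxtraceZ (trM2C a).
by rewrite mulrAC.
Qed.

Lemma anticommute a x : \tr a = 0 -> \tr x = 0 -> \tr (x * a) = 0 -> a * x = - (x * a).
Proof.
have [p [q [r [s ->]]]] := mx2P a; have [p' [q' [r' [s' ->]]]] := mx2P x.
rewrite mx2M !mx2_tr => /eqP; rewrite addrC addr_eq0 => /eqP -> /eqP.
rewrite addrC addr_eq0 => /eqP -> e; rewrite !mx2E; congr mx2; try ring.
  by apply/eqP; rewrite -subr_eq0 -e; apply/eqP; ring.
by apply/eqP; rewrite -subr_eq0 -e; apply/eqP; ring.
Qed.

Variable t : F.
Hypothesis three : (3%:R : F) != 0.
Hypothesis t2 : t ^+ 2 = t + 1.
Hypothesis Ft : prime_span t.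
Variable S : pred M2.
Local Notation K := (stabilizes S).

(** Try for [a] the roots [f0], [f1] and the two images of one in the other.
    Up to sign the pairings are [X ^ 2 / d], [Y ^ 2 / d], [(X + t Y) ^ 2 / d]
    and [(Y + t X) ^ 2 / d] with [X = \tr (N f0)] and [Y = \tr (N f1)]. If all
    lie in the prime field, the difference of the last two forces [X ^ 2 = Y ^
    2], and then the last one forces [X = Y = 0]. So [N] anticommutes with
    [f0] and [f1] and commutes with the rotation [f0 f1], whose axis is not
    isotropic, whereas [N] is. *)
Lemma irrational_pairing (N f0 f1 : M2) (d : F) : ~ k0 t ->
  N != 0 -> N * N = 0 -> K f0 -> K f1 ->
  \tr f0 = 0 -> \tr f1 = 0 -> \det f0 = d -> \det f1 = d -> d != 0 ->
  \tr (f0 * f1) = t * d -> exists2 a, K a & ~ k0 (\tr (N * cj a N)).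
Proof.
move=> tN N0 N2 K0 K1 t0 t1 d0 d1 dn0 t01; have [trN dN] := nilpotent_tr N2.
have [u0 _] := K0; have [u1 _] := K1.
have dn0' : \det f0 != 0 by rewrite d0.
have dn1' : \det f1 != 0 by rewrite d1.
have K2 : K (cj f0 f1) by apply: stabilizesM; [exact: stabilizesM | exact: stabilizesV].
have K3 : K (cj f1 f0) by apply: stabilizesM; [exact: stabilizesM | exact: stabilizesV].
have alt a : K a -> (exists2 b, K b & ~ k0 (\tr (N * cj b N))) \/ k0 (\tr (N * cj a N)).
  by move=> Ka; have [k|nk] := prime_subP (\tr (N * cj a N)); [right | left; exists a].
case: (alt f0 K0) => // A0; case: (alt f1 K1) => // A1.
case: (alt _ K2) => // A2; case: (alt _ K3) => // A3; case: notF.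
rewrite !tr_nilpotent_cj ?cj_tr ?cj_det ?d0 ?d1 // in A0 A1 A2 A3.
have c01 : cj f0 f1 = - (f1 + t *: f0).
  rewrite cj_trless //; congr (- (_ + _ *: _)); apply: (canLR (mulfK dn0')).
  by rewrite d0; exact: t01.
have c10 : cj f1 f0 = - (f0 + t *: f1).
  rewrite cj_trless //; congr (- (_ + _ *: _)); apply: (canLR (mulfK dn1')).
  by rewrite d1 trM2C; exact: t01.
have trE x y : \tr (N * - (x + t *: y)) ^+ 2 = (\tr (N * x) + t * \tr (N * y)) ^+ 2.
  by rewrite mulrN raddfN /= sqrrN mulrDr -scalerAr mxtraceD mxtraceZ.
rewrite c01 trE in A2; rewrite c10 trE in A3.
set X := \tr (N * f0) in A0 A2 A3; set Y := \tr (N * f1) in A1 A2 A3.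
have XY : X ^+ 2 = Y ^+ 2.
  apply/eqP; rewrite -subr_eq0; apply/negP => /negP XY; apply: tN.
  have -> : t = ((Y + t * X) ^+ 2 / d - (X + t * Y) ^+ 2 / d) / (X ^+ 2 / d - Y ^+ 2 / d).
    have E : (Y + t * X) ^+ 2 - (X + t * Y) ^+ 2 = (X ^+ 2 - Y ^+ 2) * (t ^+ 2 - 1) by ring.
    rewrite -!mulrBl E t2 addrK; field; exact/andP.
  move: A0 A1 A2 A3 => /prime_subN + /prime_subN + /prime_subN + /prime_subN; rewrite !opprK => A0 A1 A2 A3.
  by apply: prime_subM; [exact: prime_subB | apply: prime_subV; exact: prime_subB].
have A0' : k0 (X ^+ 2 / d) by rewrite -[_ / _]opprK; exact: prime_subN.
have X0 : X = 0.
  apply/eqP/negP => /negP X0; apply: tN.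
  have n0 : X ^+ 2 / d != 0 by rewrite mulf_neq0 ?expf_neq0 ?invr_eq0.
  have A2' : k0 ((Y + t * X) ^+ 2 / d) by rewrite -[_ / _]opprK; exact: prime_subN.
  have tk e : k0 e -> e != 0 -> (Y + t * X) ^+ 2 / d = X ^+ 2 / d * (2%:R + e * t) -> k0 t.
    move=> ke e0 E; have -> : t = ((Y + t * X) ^+ 2 / d / (X ^+ 2 / d) - 2%:R) / e.
      by rewrite E [X ^+ 2 / d * _]mulrC mulfK // addrAC subrr add0r mulrC mulKf.
    by apply: prime_subM; [apply: prime_subB; [apply: prime_subM => //; exact: prime_subV | exact: prime_sub_nat] | exact: prime_subV].
  have XX (e : F) : e ^+ 2 = 1 -> Y = e * X -> (Y + t * X) ^+ 2 / d = X ^+ 2 / d * (2%:R + (2%:R * e + 1) * t).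
    move=> e2 ->; have -> : (e * X + t * X) ^+ 2 = X ^+ 2 * (e ^+ 2 + 2%:R * e * t + t ^+ 2) by ring.
    by rewrite e2 t2; field.
  move/eqP: XY; rewrite eq_sym eqf_sqr => /orP[] /eqP Ye.
    apply: (tk 3%:R) => //; first exact: prime_sub_nat.
    rewrite (XX 1); [congr (_ * (_ + _)); ring | by rewrite expr1n | by rewrite mul1r].
  apply: (tk (-1)); rewrite ?oppr_eq0 ?oner_eq0 //; first by apply: prime_subN; exact: prime_sub1.
  rewrite (XX (-1)); [congr (_ * (_ + _)); ring | by rewrite sqrrN expr1n | by rewrite mulN1r].
have Y0 : Y = 0 by apply/eqP; rewrite -sqrf_eq0 -XY X0 expr0n.
have com : f0 * f1 * N = N * (f0 * f1).
  by rewrite -mulrA (anticommute t1 trN Y0) mulrN (mulrA f0 N) (anticommute t0 trN X0) mulNr opprK (mulrA N).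
have four := four_neq0 two.
have dM : \det (tpart (f0 * f1)) != 0.
  rewrite (det_tpart two) (detM2 f0 f1) d0 d1 t01.
  have -> : d * d - (t * d / 2%:R) ^+ 2 = d ^+ 2 * (4%:R - t ^+ 2) / 4%:R.
    by field; rewrite ?two ?four.
  rewrite !mulf_neq0 ?expf_neq0 ?invr_eq0 //.
  apply/eqP => e; apply: tN; have -> : t = 3%:R; last exact: prime_sub_nat.
  by apply/eqP; rewrite -subr_eq0 -oppr_eq0 -e t2; apply/eqP; ring.
have nM : ~~ is_scalar_mx (f0 * f1).
  by rewrite -tpart_eq0 //; apply: contraNneq dM => ->; rewrite det0.
have [k Nk] := centralizer2 two nM com trN.
move: dN; rewrite Nk detZ => /eqP; rewrite mulf_eq0 (negbTE dM) orbF expf_eq0 /= => /eqP k00.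
by case/eqP: N0; rewrite Nk k00 scale0r.
Qed.

(** If [t] is in the prime field, integral powers of [1 + N] suffice.
    Otherwise [N] and its conjugate by [a] form a standard pair with parameter
    outside the prime field, and [lower_generated] applies. *)
Lemma full_transvections (N f0 f1 : M2) (d : F) :
  N != 0 -> N * N = 0 -> K (1 + N) -> K f0 -> K f1 ->
  \tr f0 = 0 -> \tr f1 = 0 -> \det f0 = d -> \det f1 = d -> d != 0 ->
  \tr (f0 * f1) = t * d -> forall u, K (1 + u *: N).
Proof.
move=> N0 N2 KN K0 K1 t0 t1 d0 d1 dn0 t01.
have KNi := prime_transvections N2 KN.
have [kt|nkt] := prime_subP t.
  move=> u; apply: KNi; have [x [y [kx ky ->]]] := Ft u.
  by apply: prime_subD => //; exact: prime_subM.
have [a Ka] := irrational_pairing nkt N0 N2 K0 K1 t0 t1 d0 d1 dn0 t01.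
set lam := \tr _ => nkl; have [ua _] := Ka.
have l0 : lam != 0 by apply/eqP => e; apply: nkl; rewrite e; exact: prime_sub0.
have N'2 : cj a N * cj a N = 0 by rewrite -cjMr // N2 /cj mulr0 mul0r.
have [P uP [PN PN']] := standard_pair two N2 N'2 erefl l0.
have spanl : prime_span lam.
  move=> x; have [x0 [y0 [kx ky ->]]] := Ft x; have [p [q [kp kq lE]]] := Ft lam.
  have q0 : q != 0 by apply/eqP => q0; apply: nkl; rewrite lE q0 mul0r addr0.
  exists (x0 - y0 * p / q), (y0 / q); split.
  - by apply: prime_subB => //; apply: prime_subM; [exact: prime_subM | exact: prime_subV].
  - by apply: prime_subM => //; exact: prime_subV.
  by rewrite lE; field.
have lowE u : cj P (lower u) = 1 + u *: N.
  rewrite -PN -cjZ -[1](cj1 uP) -cjD; congr cj; rewrite /lower; mx2c.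
have KL := @lower_generated F two three (fun x => S (cj P x)) lam nkl spanl.
move=> u; rewrite -lowE; apply/(stabilizes_cj S _ uP); apply: KL => [i ki|j kj].
  by apply/(stabilizes_cj S _ uP); rewrite lowE; exact: KNi.
apply/(stabilizes_cj S _ uP).
have -> : cj P (upper (j * lam)) = cj a (1 + j *: N).
  rewrite cjD cj1 // cjZ -PN' -cjZ -[1](cj1 uP) -cjD; congr cj; rewrite /upper; mx2c.
by apply: stabilizesM; [apply: stabilizesM => //; exact: KNi | exact: stabilizesV].
Qed.
End Full.

(** * Norm classes of mirrors in the matrix model *)

(** For two mirrors with [x = 4 cos ^ 2] of their angle, [x = 4] makes the
    product of the reflections unipotent; the values 0, 1, 2 and the roots of
    [x ^ 2 - 3 x + 1] belong to rotations of order 2, 3, 4 and 5. What is left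
    is an order of at least six. *)
Definition long_rotation (F : fieldType) (x : F) :=
  (x == 4%:R) || (x * (x - 1) * (x - 2%:R) * (x ^+ 2 - 3%:R * x + 1) != 0).

Section Combine.
Variable F : finFieldType.
Hypothesis two : (2%:R : F) != 0.
Hypothesis F4 : (4 < #|F|)%N.
Variables (kap D : F).
Hypotheses (kap0 : kap != 0) (D0 : D != 0).
Local Notation M2 := 'M[F]_2.
Local Notation form := (mform kap D).
Local Notation refl := (mrefl kap D).

Lemma form_trless (x y : M2) : \tr x = 0 -> form x y = - (kap / 2%:R) * \tr (x * y).
Proof. by move=> x0; rewrite /mform x0 mul0r mulr0 addr0. Qed.

Lemma form_cj g (x y : M2) : g \is a GRing.unit -> form (cj g x) (cj g y) = form x y.
Proof. by move=> ug; rewrite /mform -cjMr // !cj_tr. Qed.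

Lemma refl_cj g (x y : M2) : g \is a GRing.unit -> refl (cj g x) (cj g y) = cj g (refl x y).
Proof. by move=> ug; rewrite /mrefl !form_cj // cjD -!scaleNr cjZ. Qed.

Variable P : pred M2.
Hypothesis Pnorm : forall v, P v -> form v v != 0.
Hypothesis Pscal : forall c v, c != 0 -> P v -> P (c *: v).
Hypothesis Prefl : forall v w, P v -> P w -> P (refl v w).
Local Notation K := (stabilizes (trless_part P)).

(** The mirrors [f0], [f1], [f2] are linked in a chain and span the traceless
    space; [c] lies neither in this space nor on the scalar line. *)
Variables f0 f1 f2 c : M2.
Hypotheses (P0 : P f0) (P1 : P f1) (P2 : P f2) (Pc : P c).
Hypotheses (t0 : \tr f0 = 0) (t1 : \tr f1 = 0) (t2 : \tr f2 = 0).
Hypotheses (n0 : form f0 f0 = 1) (n1 : form f1 f1 = 1) (nc : form c c = 1).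
Hypotheses (f02 : form f0 f2 = 0) (f01 : form f0 f1 != 0) (f12 : form f1 f2 != 0).
Hypothesis span : forall x, \tr x = 0 -> form x f0 = 0 -> form x f1 = 0 ->
  form x f2 = 0 -> x = 0.
Hypotheses (c_tr : \tr c != 0) (c_nscal : forall z, c != z%:M).

Let k2 : - (kap / 2%:R) != 0.
Proof. by rewrite oppr_eq0 mulf_neq0 ?invr_eq0. Qed.

Let K_P a : \tr a = 0 -> P a -> K a.
Proof. exact: (stabilizes_mirror two kap0 Pnorm Pscal Prefl). Qed.

(** Some [f_i] is not orthogonal to [N]. The half turn about it carries [N] to
    a nilpotent that pairs with [N], and the two root subgroups become the
    upper and lower transvections in a suitable basis. *)
Lemma mirrors_of_root_group N : N != 0 -> N * N = 0 -> (forall u, K (1 + u *: N)) ->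
  forall v w, P v -> form w w = form v v -> P w.
Proof.
move=> N0 N2 KN; have [trN dN] := nilpotent_tr N2.
have [a [Pa a0 Na]] : exists a, [/\ P a, \tr a = 0 & \tr (N * a) != 0].
  have [e0|] := eqVneq (\tr (N * f0)) 0; last by exists f0.
  have [e1|] := eqVneq (\tr (N * f1)) 0; last by exists f1.
  have [e2|] := eqVneq (\tr (N * f2)) 0; last by exists f2.
  by case/eqP: N0; apply: span => //; rewrite form_trless // ?e0 ?e1 ?e2 mulr0.
have Ka := K_P a0 Pa; have [ua _] := Ka.
have da : \det a != 0 by rewrite -mx2_unit.
set lam := \tr (N * cj a N); have l0 : lam != 0.
  by rewrite /lam tr_nilpotent_cj // oppr_eq0 mulf_neq0 ?expf_neq0 ?invr_eq0.
have N'2 : cj a N * cj a N = 0 by rewrite -cjMr // N2 /cj mulr0 mul0r.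
have [g ug [gN gN']] := standard_pair two N2 N'2 erefl l0.
pose P' : pred M2 := fun x => P (cj g x).
have ugV : g^-1 \is a GRing.unit by rewrite unitrV.
have Kcj M : K (cj g M) -> stabilizes (trless_part P') M.
  move=> KgM; have [uM h] := (stabilizes_cj (trless_part P) M ug).2 KgM; split=> // x.
  by have := h x; rewrite /trless_part /P' !cj_tr.
have KL u : stabilizes (trless_part P') (lower u).
  apply: Kcj; have -> : cj g (lower u) = 1 + u *: N.
    rewrite -gN -cjZ -[1](cj1 ug) -cjD; congr cj; rewrite /lower; mx2c.
  exact: KN.
have KU u : stabilizes (trless_part P') (upper u).
  apply: Kcj; have -> : cj g (upper u) = cj a (1 + (u / lam) *: N).
    rewrite cjD cj1 // cjZ -gN' -cjZ -[1](cj1 ug) -cjD; congr cj; rewrite /upper.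
    by rewrite !mx2E; congr mx2; field.
  by apply: stabilizesM; [apply: stabilizesM => //; exact: KN | exact: stabilizesV].
have Pn x : P' x -> form x x != 0 by move=> /Pnorm; rewrite form_cj.
have Pr x y : P' x -> P' y -> P' (refl x y).
  by move=> Px Py; rewrite /P' -refl_cj //; exact: Prefl.
have P'0 : P' (cj g^-1 f0) by rewrite /P' cjVK.
have P'c : P' (cj g^-1 c) by rewrite /P' cjVK.
have ct : \tr (cj g^-1 c) != 0 by rewrite cj_tr.
have cs z : cj g^-1 c != z%:M.
  by apply: contraNneq (c_nscal z) => e; rewrite -[c](cjVK _ ug) e cjS.
move=> v w Pv e; rewrite -[w](cjVK _ ug).
have := mirror_class_complete two F4 kap0 D0 Pn Pr KU KL P'0 _ _ P'c _ ct cs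
  (v := cj g^-1 v) (w := cj g^-1 w).
by apply; rewrite ?cj_tr ?form_cj // /P' cjVK.
Qed.

Variable t : F.
Hypothesis three : (3%:R : F) != 0.
Hypothesis tt : t ^+ 2 = t + 1.
Hypothesis Ft : prime_span t.
Hypothesis f01t : form f0 f1 = - t / 2%:R.

(** Suppose that a norm class is incomplete. Then there is no unipotent in the
    stabiliser, by [full_transvections] and [mirrors_of_root_group]. But the
    product of [a] and [b] is a unipotent up to a scalar when [x = 4], and
    otherwise a rotation of order at least six, which
    [linked_half_turns_no_axis] forbids. *)
Lemma mirrors_of_long_rotation a b x : P a -> P b -> \tr a = 0 -> \tr b = 0 ->
  (forall k, b != k *: a) ->
  4%:R * form a b ^+ 2 = x * (form a a * form b b) ->
  long_rotation x ->
  forall v w, P v -> form w w = form v v -> P w.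
Proof.
move=> Pa Pb a0 b0 nab xE xx v w Pv e.
have nrm y : \tr y = 0 -> form y y = kap * \det y := @mnorm_trless F two kap D y.
apply/negPn/negP => nPw.
have d0 : \det f0 = kap^-1 by apply: (mulfI kap0); rewrite -nrm // n0 mulfV.
have d1 : \det f1 = kap^-1 by apply: (mulfI kap0); rewrite -nrm // n1 mulfV.
have d01 : \tr (f0 * f1) = t * kap^-1.
  by apply: (mulfI k2); rewrite -form_trless // f01t; field; rewrite kap0 two.
have no_unip N : N != 0 -> N * N = 0 -> ~ K (1 + N).
  move=> N0 N2 KN; case/negP: nPw; apply: (mirrors_of_root_group N0 N2 _ Pv e).
  have kV : kap^-1 != 0 by rewrite invr_eq0.
  exact: (full_transvections two three tt Ft N0 N2 KN (K_P t0 P0) (K_P t1 P1) t0 t1 d0 d1 kV d01).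
have [ua _] := K_P a0 Pa; have [ub _] := K_P b0 Pb.
have KM : K (a * b) by apply: stabilizesM; exact: K_P.
have nM : ~~ is_scalar_mx (a * b).
  apply/negP => /is_scalar_mxP[z ez]; case/eqP: (nab (- z / \det a)).
  have da : \det a != 0 by rewrite -mx2_unit.
  apply: (mulrI ua); rewrite ez -scalerAr trless_sqr // scale_scalar_mx.
  by congr _%:M; field.
set T := \tr (a * b); set d := \det (a * b).
have TE : T ^+ 2 = x * d.
  have : kap ^+ 2 * T ^+ 2 = kap ^+ 2 * (x * d).
    move: xE; rewrite form_trless // !nrm // /d detM2 -/T => h.
    transitivity (4%:R * (- (kap / 2%:R) * T) ^+ 2); first by field.
    by rewrite h; ring.
  by apply: mulfI; rewrite expf_neq0.
have dn0 : d != 0 by rewrite /d detM2 mulf_neq0 // -mx2_unit.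
case/orP: xx => [/eqP x4|xx].
  have := @det_tpart_neq0 F two _ no_unip _ KM nM; rewrite det_tpart // -/T -/d.
  move=> h; case/negP: h; rewrite expr_div_n TE x4; apply/eqP; field; rewrite (natrM F 2 2) mulf_neq0 //.
have g02 : \tr (f0 * f2) = 0 by apply: (mulfI k2); rewrite -form_trless // f02 mulr0.
have g01 : \tr (f0 * f1) != 0.
  by apply: contraNneq f01 => e0; rewrite form_trless // e0 mulr0.
have g12 : \tr (f1 * f2) != 0.
  by apply: contraNneq f12 => e0; rewrite form_trless // e0 mulr0.
have sp y : \tr y = 0 -> \tr (y * f0) = 0 -> \tr (y * f1) = 0 -> \tr (y * f2) = 0 -> y = 0.
  by move=> y0 e0 e1 e2; apply: span => //; rewrite form_trless // ?e0 ?e1 ?e2 mulr0.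
have H := linked_half_turns_no_axis two no_unip (K_P t0 P0) (K_P t1 P1) (K_P t2 P2)
  t0 t1 t2 g02 g01 g12 sp KM nM.
apply: H => /=.
rewrite -/T -/d.
have -> : T ^+ 4 = (T ^+ 2) ^+ 2 by rewrite -exprM.
move: xx; rewrite !mulf_eq0 !negb_or -!andbA => /and4P[x0 x1 x2 x3].
have T0 : T != 0 by rewrite -sqrf_eq0 TE mulf_neq0.
rewrite T0 TE /=.
have -> : x * d - d = (x - 1) * d by ring.
have -> : x * d - 2%:R * d = (x - 2%:R) * d by ring.
have -> : (x * d) ^+ 2 - 3%:R * (x * d) * d + d ^+ 2 = (x ^+ 2 - 3%:R * x + 1) * d ^+ 2 by ring.
by rewrite !mulf_neq0 ?expf_neq0.
Qed.
End Combine.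

(** * Mirrors of a matrix group *)

Section Space.
Variable F : finFieldType.
Variable B : 'M[F]_4.
Hypothesis Bsym : B^T = B.
Local Notation V := 'cV[F]_4.
Local Notation "<< x , y >>" := (bform B x y).
Implicit Types (x y v w : V).

Lemma bformC x y : <<x, y>> = <<y, x>>.
Proof.
rewrite /bform -[LHS]/(((x^T *m B *m y)) 0 0) -[in LHS](trmxK (_ *m y)) mxE.
by rewrite !trmx_mul trmxK Bsym mulmxA.
Qed.
Lemma bformDl x y w : <<x + y, w>> = <<x, w>> + <<y, w>>.
Proof. by rewrite /bform linearD /= !mulmxDl mxE. Qed.
Lemma bformZl c x w : <<c *: x, w>> = c * <<x, w>>.
Proof. by rewrite /bform linearZ /= -!scalemxAl mxE. Qed.
Lemma bformDr x y w : <<w, x + y>> = <<w, x>> + <<w, y>>.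
Proof. by rewrite bformC bformDl !(bformC w). Qed.
Lemma bformZr c x w : <<w, c *: x>> = c * <<w, x>>.
Proof. by rewrite bformC bformZl (bformC w). Qed.
Lemma bformNl x w : <<- x, w>> = - <<x, w>>.
Proof. by rewrite -scaleN1r bformZl mulN1r. Qed.
Lemma bformNr x w : <<w, - x>> = - <<w, x>>.
Proof. by rewrite bformC bformNl (bformC w). Qed.
Lemma bform0l w : <<0, w>> = 0.
Proof. by rewrite -(scale0r 0) bformZl mul0r. Qed.
Lemma bform0r w : <<w, 0>> = 0.
Proof. by rewrite bformC bform0l. Qed.

Definition bformE := (bformDl, bformZl, bformDr, bformZr, bformNl, bformNr, bform0l, bform0r).

Local Notation refl := (reflection B).

Lemma reflD v x y : refl v (x + y) = refl v x + refl v y.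
Proof.
rewrite /reflection bformDl; set a := <<x, v>>; set b := <<y, v>>; set c := <<v, v>>.
have -> : 2 * ((a + b) / c) = 2 * (a / c) + 2 * (b / c) by ring.
by rewrite scalerDl opprD addrACA.
Qed.
Lemma reflZ v c x : refl v (c *: x) = c *: refl v x.
Proof. by rewrite /reflection bformZl scalerBr scalerA; congr (_ - _ *: _); ring. Qed.
Lemma refl_scal v c x : c != 0 -> refl (c *: v) x = refl v x.
Proof.
move=> c0; rewrite /reflection !bformZl !bformZr scalerA; congr (_ - _ *: _).
have [->|v0] := eqVneq <<v, v>> 0; first by rewrite !mulr0 invr0; ring.
by field; rewrite ?c0 ?v0.
Qed.
Lemma refl_invol v x : <<v, v>> != 0 -> refl v (refl v x) = x.
Proof.
move=> v0; rewrite /reflection bformDl bformNl bformZl -addrA -opprD -scalerDl.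
set a := <<x, v>>; set b := <<v, v>> in v0 *.
have -> : 2 * (a / b) + 2 * ((a - 2 * (a / b) * b) / b) = 0 by field.
by rewrite scale0r subr0.
Qed.
Lemma refl_isom v x y : <<v, v>> != 0 -> <<refl v x, refl v y>> = <<x, y>>.
Proof.
move=> v0; rewrite /reflection !bformE (bformC v y); field => //.
Qed.

(** A reflection preserves the form, so it conjugates the reflection in [w] to
    the one in the image of [w]. *)
Lemma refl_refl v w x : <<v, v>> != 0 ->
  refl (refl v w) x = refl v (refl w (refl v x)).
Proof.
move=> v0; have xE : <<x, refl v w>> = <<refl v x, w>>.
  by rewrite -(refl_isom x _ v0) refl_invol.
rewrite [in LHS]/reflection xE refl_isom //.
set c := 2 * _; have -> : refl w (refl v x) = refl v x + (- c) *: w.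
  by rewrite scaleNr.
by rewrite reflD reflZ refl_invol // scaleNr.
Qed.

Section Mirrors.
Variable G : {group {'GL_4[F]}}.

Definition gl (A : {'GL_4[F]}) : 'M[F]_4 := @GLval 4 F A.

Lemma gl_ext (A A' : {'GL_4[F]}) : (forall x : 'cV[F]_4, gl A *m x = gl A' *m x) -> A = A'.
Proof.
move=> e; apply: val_inj; apply/matrixP => i j.
by have := e (@delta_mx F 4 1 j 0); rewrite -!colE => /matrixP/(_ i 0); rewrite !mxE.
Qed.

Definition mirror v := (<<v, v>> != 0) &&
  [exists A in G, [forall x : V, gl A *m x == refl v x]].

Lemma mirrorP v : reflect (<<v, v>> != 0 /\
  exists2 A, A \in G & forall x : V, gl A *m x = refl v x) (mirror v).
Proof.
apply: (iffP andP) => -[v0 h]; split=> //.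
  by case/exists_inP: h => A GA /forallP h; exists A => // x; apply/eqP.
by case: h => A GA h; apply/exists_inP; exists A => //; apply/forallP => x; rewrite h.
Qed.

Lemma mirror_neq0 v : mirror v -> <<v, v>> != 0.
Proof. by case/andP. Qed.

Lemma mirror_scal c v : c != 0 -> mirror v -> mirror (c *: v).
Proof.
move=> c0 /mirrorP[v0 [A GA h]]; apply/mirrorP; split.
  by rewrite !bformE !mulf_neq0.
by exists A => // x; rewrite h refl_scal.
Qed.

Lemma mirror_refl v w : mirror v -> mirror w -> mirror (refl v w).
Proof.
move=> /mirrorP[v0 [A GA hA]] /mirrorP[w0 [A' GA' hA']]; apply/mirrorP; split.
  by rewrite refl_isom.
exists (A * A' * A)%g; first by rewrite !groupM.
by move=> x; rewrite refl_refl // -hA -hA' -hA !mulmxA.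
Qed.
End Mirrors.
End Space.

(** * Four linked mirrors *)

Section Chain.
Variable F : finFieldType.
Hypothesis two : (2%:R : F) != 0.
Hypothesis F4 : (4 < #|F|)%N.
Variable B : 'M[F]_4.
Hypothesis Bsym : B^T = B.
Local Notation V := 'cV[F]_4.
Local Notation M2 := 'M[F]_2.
Local Notation "<< x , y >>" := (bform B x y).
Variable G : {group {'GL_4[F]}}.
Local Notation mir := (mirror B G).
Local Notation refl := (reflection B).

(** An orthogonal basis adapted to a chain of mirrors: [u0] and [u2] are its
    outer members, [u1] is the component of the middle one orthogonal to both,
    and [u3] completes the basis. *)
Variables (u0 u1 u2 u3 : V) (gam rho D : F).
Hypotheses (n0 : <<u0, u0>> = 1) (n1 : <<u1, u1>> = gam) (n2 : <<u2, u2>> = rho)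
  (n3 : <<u3, u3>> = D).
Hypotheses (o01 : <<u0, u1>> = 0) (o02 : <<u0, u2>> = 0) (o03 : <<u0, u3>> = 0)
  (o12 : <<u1, u2>> = 0) (o13 : <<u1, u3>> = 0) (o23 : <<u2, u3>> = 0).
Hypotheses (gam0 : gam != 0) (rho0 : rho != 0) (D0 : D != 0).

Definition comb (a b c d : F) : V := a *: u0 + b *: u1 + c *: u2 + d *: u3.

Lemma comb_form a b c d a' b' c' d' : <<comb a b c d, comb a' b' c' d'>> =
  a * a' + gam * (b * b') + rho * (c * c') + D * (d * d').
Proof.
rewrite /comb !(bformDl, bformDr Bsym, bformZl, bformZr Bsym).
rewrite (bformC Bsym u1 u0) (bformC Bsym u2 u0) (bformC Bsym u3 u0).
rewrite (bformC Bsym u2 u1) (bformC Bsym u3 u1) (bformC Bsym u3 u2).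
by rewrite n0 n1 n2 n3 o01 o02 o03 o12 o13 o23; ring.
Qed.

Lemma combD a b c d a' b' c' d' : comb a b c d + comb a' b' c' d' =
  comb (a + a') (b + b') (c + c') (d + d').
Proof. by rewrite /comb !scalerDl; rewrite addrACA [X in X + _]addrACA (addrACA (a *: u0)). Qed.

Lemma combZ k a b c d : k *: comb a b c d = comb (k * a) (k * b) (k * c) (k * d).
Proof. by rewrite /comb !scalerDr !scalerA. Qed.

Local Notation kap := (gam * rho).
Let kap0 : kap != 0. Proof. exact: mulf_neq0. Qed.
Let four0 : 4%:R != 0 :> F. Proof. exact: four_neq0. Qed.

Section Isotropic.
Variables x y : F.
Hypothesis xy : gam * x ^+ 2 + rho * y ^+ 2 = -1.

(** The hyperbolic pair behind the matrix model: the matrices with a single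
    entry 1 off the diagonal go to multiples of the isotropic vectors [u0 + x
    u1 + y u2] and [- u0 + x u1 + y u2], the diagonal matrix with entries 1,
    -1 to the vector of the first three coordinates orthogonal to both, and
    the identity to [u3]. *)
Definition model (m : M2) : V :=
  comb (m 0 1 - m 1 0 * (kap / 4%:R))
       (x * (m 0 1 + m 1 0 * (kap / 4%:R)) + (m 0 0 - m 1 1) / 2%:R * (rho * y))
       (y * (m 0 1 + m 1 0 * (kap / 4%:R)) - (m 0 0 - m 1 1) / 2%:R * (gam * x))
       ((m 0 0 + m 1 1) / 2%:R).

Lemma modelE p q r s : model (mx2 p q r s) =
  comb (q - r * (kap / 4%:R))
       (x * (q + r * (kap / 4%:R)) + (p - s) / 2%:R * (rho * y))
       (y * (q + r * (kap / 4%:R)) - (p - s) / 2%:R * (gam * x))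
       ((p + s) / 2%:R).
Proof. by rewrite /model !mxE. Qed.

Lemma modelD m m' : model (m + m') = model m + model m'.
Proof.
have [p [q [r [s ->]]]] := mx2P m; have [p' [q' [r' [s' ->]]]] := mx2P m'.
by rewrite mx2D !modelE combD; congr comb; ring.
Qed.
Lemma modelZ k m : model (k *: m) = k *: model m.
Proof.
have [p [q [r [s ->]]]] := mx2P m.
by rewrite mx2Z !modelE combZ; congr comb; ring.
Qed.

Lemma model_form m m' : <<model m, model m'>> = mform kap D m m'.
Proof.
have [p [q [r [s ->]]]] := mx2P m; have [p' [q' [r' [s' ->]]]] := mx2P m'.
rewrite !modelE comb_form /mform mx2M !mx2_tr.
set k := kap / 4%:R.
transitivity ((q - r * k) * (q' - r' * k)
  + (gam * x ^+ 2 + rho * y ^+ 2) * ((q + r * k) * (q' + r' * k))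
  + kap * (gam * x ^+ 2 + rho * y ^+ 2) * ((p - s) / 2%:R * ((p' - s') / 2%:R))
  + D * ((p + s) / 2%:R * ((p' + s') / 2%:R))); first by ring.
by rewrite xy /k; field; rewrite two four0.
Qed.

Lemma mform_nondeg m : (forall m', mform kap D m m' = 0) -> m = 0.
Proof.
have [p [q [r [s ->]]]] := mx2P m => h.
have h1 := h (mx2 0 1 0 0); have h2 := h (mx2 0 0 1 0).
have h3 := h (mx2 1 0 0 (-1)); have h4 := h (mx2 1 0 0 1).
rewrite /mform !mx2M !mx2_tr in h1 h2 h3 h4.
have r0 : r = 0.
  apply: (mulfI kap0); rewrite mulr0; apply: (mulfI two); rewrite mulr0 -[RHS](mulr0 (-4%:R)) -h1.
  by field; rewrite two four0.
have q0 : q = 0.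
  apply: (mulfI kap0); rewrite mulr0; apply: (mulfI two); rewrite mulr0 -[RHS](mulr0 (-4%:R)) -h2.
  by field; rewrite two four0.
have e3 : p - s = 0.
  apply: (mulfI kap0); rewrite mulr0 -[RHS](mulr0 (-2%:R)) -h3.
  by field; rewrite two four0.
have e4 : p + s = 0.
  apply: (mulfI D0); rewrite mulr0 -[RHS](mulr0 2%:R) -h4.
  by field; rewrite two four0.
have p0 : p = 0 by apply: (mulfI two); rewrite mulr0 -[RHS]add0r -{1}e3 -{1}e4; ring.
have s0 : s = 0 by rewrite -e4 p0 add0r.
by rewrite p0 q0 r0 s0 mx2_0.
Qed.

Lemma model_inj : injective model.
Proof.
move=> m m' e; apply/eqP; rewrite -subr_eq0; apply/eqP/mform_nondeg => a.
rewrite -model_form modelD -scaleN1r modelZ e scaleN1r subrr; exact: bform0l.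
Qed.

Lemma model_surj v : exists m, model m = v.
Proof.
have := inj_card_onto model_inj; rewrite !card_mx => /(_ (leqnn _) v) /codomP[m ->].
by exists m.
Qed.

Lemma model_refl m m' : model (mrefl kap D m m') = refl (model m) (model m').
Proof. by rewrite /mrefl /reflection modelD -scaleNr modelZ !model_form scaleNr. Qed.

(** The inverse of [model] in the coordinates of the orthogonal basis. *)
Definition premodel (a b c d : F) : M2 :=
  mx2 (- b * y + c * x + d)
      (a / 2%:R - b * (gam * x / 2%:R) - c * (rho * y / 2%:R))
      (2%:R / kap * (- a - b * (gam * x) - c * (rho * y)))
      (b * y - c * x + d).

Lemma premodelK a b c d : model (premodel a b c d) = comb a b c d.
Proof.
rewrite modelE; congr comb.
- by field; rewrite two four0 gam0 rho0.
- transitivity (- b * (gam * x ^+ 2 + rho * y ^+ 2)); last by rewrite xy mulrN1 opprK.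
  by field; rewrite two four0 gam0 rho0.
- transitivity (- c * (gam * x ^+ 2 + rho * y ^+ 2)); last by rewrite xy mulrN1 opprK.
  by field; rewrite two four0 gam0 rho0.
- by field; rewrite two.
Qed.

Lemma premodel_surj m : exists a b c d, m = premodel a b c d.
Proof.
suff: exists a b c d, model m = comb a b c d.
  by case=> a [b [c [d e]]]; exists a, b, c, d; apply: model_inj; rewrite e premodelK.
by rewrite /model; do 4!eexists.
Qed.

Lemma tr_premodel a b c d : \tr (premodel a b c d) = 2%:R * d.
Proof. by rewrite mx2_tr; ring. Qed.

Lemma premodel_form a b c d a' b' c' d' :
  mform kap D (premodel a b c d) (premodel a' b' c' d') =
  a * a' + gam * (b * b') + rho * (c * c') + D * (d * d').
Proof. by rewrite -model_form !premodelK comb_form. Qed.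

Let P : pred M2 := fun m => mir (model m).

Lemma model_mirror_norm m : P m -> mform kap D m m != 0.
Proof. by move/mirror_neq0; rewrite model_form. Qed.
Lemma model_mirror_scal k m : k != 0 -> P m -> P (k *: m).
Proof. by move=> k0 Pm; rewrite /P modelZ; exact: mirror_scal. Qed.
Lemma model_mirror_refl m m' : P m -> P m' -> P (mrefl kap D m m').
Proof. by move=> Pm Pm'; have := mirror_refl Bsym Pm Pm'; rewrite -model_refl. Qed.

Variables (t a0 a1 a2 a3 : F).
Hypotheses (m0 : mir (comb 1 0 0 0)) (m1 : mir (comb (- t / 2%:R) 1 (- 1 / 2%:R) 0))
  (m2 : mir (comb 0 0 1 0)) (mc : mir (comb a0 a1 a2 a3)).
Hypotheses (ne1 : t ^+ 2 / 4%:R + gam + rho / 4%:R = 1)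
  (nc : a0 ^+ 2 + gam * a1 ^+ 2 + rho * a2 ^+ 2 + D * a3 ^+ 2 = 1)
  (a30 : a3 != 0) (a012 : [|| a0 != 0, a1 != 0 | a2 != 0]) (t0 : t != 0).

Let f0 := premodel 1 0 0 0.
Let f1 := premodel (- t / 2%:R) 1 (- 1 / 2%:R) 0.
Let f2 := premodel 0 0 1 0.
Let c := premodel a0 a1 a2 a3.
Let P0 : P f0. Proof. by rewrite /P premodelK. Qed.
Let P1 : P f1. Proof. by rewrite /P premodelK. Qed.
Let P2 : P f2. Proof. by rewrite /P premodelK. Qed.
Let Pc : P c. Proof. by rewrite /P premodelK. Qed.
Let tr0 : \tr f0 = 0. Proof. by rewrite tr_premodel mulr0. Qed.
Let tr1 : \tr f1 = 0. Proof. by rewrite tr_premodel mulr0. Qed.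
Let tr2 : \tr f2 = 0. Proof. by rewrite tr_premodel mulr0. Qed.
Let form0 : mform kap D f0 f0 = 1. Proof. by rewrite premodel_form; ring. Qed.
Let form1 : mform kap D f1 f1 = 1.
Proof.
rewrite premodel_form; apply: etrans ne1; by field; rewrite two four0.
Qed.
Let formc : mform kap D c c = 1.
Proof. by rewrite premodel_form -!expr2. Qed.
Let form02 : mform kap D f0 f2 = 0. Proof. by rewrite premodel_form; ring. Qed.
Let form01 : mform kap D f0 f1 = - t / 2%:R. Proof. by rewrite premodel_form; ring. Qed.
Let form12 : mform kap D f1 f2 = - rho / 2%:R. Proof. by rewrite premodel_form; ring. Qed.
Let form01' : mform kap D f0 f1 != 0.
Proof. by rewrite form01 mulf_neq0 ?oppr_eq0 ?invr_eq0. Qed.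
Let form12' : mform kap D f1 f2 != 0.
Proof. by rewrite form12 mulf_neq0 ?oppr_eq0 ?invr_eq0. Qed.

Let span m : \tr m = 0 -> mform kap D m f0 = 0 -> mform kap D m f1 = 0 ->
  mform kap D m f2 = 0 -> m = 0.
Proof.
have [p [q [r [s ->]]]] := premodel_surj m; rewrite tr_premodel !premodel_form.
move=> /eqP; rewrite mulf_eq0 (negbTE two) => /eqP s0 h0 h1 h2.
have p0 : p = 0 by rewrite -h0; ring.
have r0 : r = 0 by apply: (mulfI rho0); rewrite mulr0 -h2; ring.
have q0 : q = 0 by apply: (mulfI gam0); rewrite mulr0 -h1 p0 r0; ring.
by rewrite p0 q0 r0 s0 /premodel mx2_0; congr mx2; ring.
Qed.

Let c_tr : \tr c != 0. Proof. by rewrite tr_premodel mulf_neq0. Qed.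
Let c_nscal z : c != z%:M.
Proof.
apply/eqP => e; have h (m : M2) : \tr m = 0 -> mform kap D c m = 0.
  by move=> m0'; rewrite e mformC form_trless // -mulmxE mul_mx_scalar mxtraceZ m0' !mulr0.
have h0 := h f0 tr0; have h1 := h f1 tr1; have h2 := h f2 tr2.
rewrite !premodel_form in h0 h1 h2.
have p0 : a0 = 0 by rewrite -h0; ring.
have r0 : a2 = 0 by apply: (mulfI rho0); rewrite mulr0 -h2; ring.
have q0 : a1 = 0 by apply: (mulfI gam0); rewrite mulr0 -h1 p0 r0; ring.
by move: a012; rewrite p0 q0 r0 eqxx.
Qed.

Lemma complete_of_root_group N : N != 0 -> N * N = 0 ->
  (forall u, stabilizes (trless_part P) (1 + u *: N)) ->
  forall v w, mir v -> <<w, w>> = <<v, v>> -> mir w.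
Proof.
move=> N0 N2 KN v w; have [m <-] := model_surj v; have [m' <-] := model_surj w.
rewrite !model_form.
exact: (mirrors_of_root_group two F4 kap0 D0 model_mirror_norm model_mirror_scal model_mirror_refl P0 P1 P2 Pc tr0 tr1
  tr2 form0 formc span c_tr c_nscal N0 N2 KN).
Qed.

Lemma model_complete_of_rotation p1 p2 p3 q1 q2 q3 z :
  (3%:R : F) != 0 -> t ^+ 2 = t + 1 ->
  prime_span t ->
  mir (comb p1 p2 p3 0) -> mir (comb q1 q2 q3 0) ->
  (forall k, comb q1 q2 q3 0 != k *: comb p1 p2 p3 0) ->
  4%:R * <<comb p1 p2 p3 0, comb q1 q2 q3 0>> ^+ 2 =
    z * (<<comb p1 p2 p3 0, comb p1 p2 p3 0>> * <<comb q1 q2 q3 0, comb q1 q2 q3 0>>) ->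
  long_rotation z ->
  forall v w, mir v -> <<w, w>> = <<v, v>> -> mir w.
Proof.
move=> three tt Ft; rewrite -!premodelK !model_form => Pp Pq npq zE zz v w.
have [m <-] := model_surj v; have [m' <-] := model_surj w; rewrite !model_form.
apply: (mirrors_of_long_rotation two F4 kap0 D0 model_mirror_norm model_mirror_scal model_mirror_refl P0 P1 P2 Pc tr0 tr1
  tr2 form0 form1 formc form02 form01' form12' span c_tr c_nscal three tt Ft form01 Pp Pq
  _ _ _ zE zz).
- by rewrite tr_premodel mulr0.
- by rewrite tr_premodel mulr0.
by move=> k; apply: contraNneq (npq k) => ->; rewrite modelZ.
Qed.

(** In characteristic 3, [n = f1 - f2] is isotropic and orthogonal to [f1],
    since 2 = -1 makes the angle [pi / 3] between [f1] and [f2] degenerate.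
    Hence the product of the mirrors [f1 + z n] and [f1] is, up to a scalar,
    unipotent with a parameter proportional to [z]. The mirror with [z = 1] is
    the image of [f1] in [f2] up to sign; together with the one with [z = th]
    it gives parameters spanning [F]. *)
Lemma model_complete_of_parallel th :
  (3%:R : F) = 0 -> rho = 1 ->
  prime_span th ->
  mir (comb (- t / 2%:R) 1 (- 1 / 2%:R) 0 +
       th *: (comb (- t / 2%:R) 1 (- 1 / 2%:R) 0 - comb 0 0 1 0)) ->
  forall v w, mir v -> <<w, w>> = <<v, v>> -> mir w.
Proof.
move=> three r1 Fth; rewrite -!premodelK -/f1 -/f2 -scaleN1r -modelZ -modelD -modelZ -modelD scaleN1r => Pth.
have K_P a : \tr a = 0 -> P a -> stabilizes (trless_part P) a.
  exact: (stabilizes_mirror two kap0 model_mirror_norm model_mirror_scal model_mirror_refl).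
have neg1 : 2%:R = -1 :> F.
  by apply/eqP; rewrite eq_sym -subr_eq0 -opprD oppr_eq0 -(natrD F 1 2) three.
pose n := f1 - f2; have trn : \tr n = 0 by rewrite /n raddfB /= tr1 tr2 subr0.
have form12n : mform kap D f1 f2 = 1 by rewrite form12 r1 neg1 divrr // unitrN1.
have form22 : mform kap D f2 f2 = 1 by rewrite premodel_form r1; ring.
have nE m : mform kap D n m = mform kap D f1 m - mform kap D f2 m by exact: mformBl.
have nf1 : mform kap D n f1 = 0.
  by rewrite nE form1 (mformC _ _ f2) form12n subrr.
have nn : mform kap D n n = 0.
  rewrite nE (mformC _ _ f1) nf1 (mformC _ _ f2) nE form12n form22; ring.
have n0' : n != 0.
  apply: contraNneq form01' => ne; have : mform kap D n f0 = 0.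
    by rewrite ne /mform mul0r mxtrace0 mul0r !mulr0 addr0.
  by rewrite nE !(mformC _ _ _ f0) form02 subr0 => ->.
have detE m : \tr m = 0 -> mform kap D m m = kap * \det m by exact: mnorm_trless.
have n2' : n * n = 0.
  rewrite trless_sqr //; have /eqP := nn; rewrite detE // mulf_eq0 (negbTE kap0) /= => /eqP ->.
  by rewrite oppr0 raddf0.
have k2 : - (kap / 2%:R) != 0 by rewrite oppr_eq0 mulf_neq0 ?invr_eq0.
have anti : f1 * n = - (n * f1).
  by apply: anticommute => //; apply: (mulfI k2); rewrite mulr0 -nf1 form_trless.
have d1 : \det f1 = kap^-1 by apply: (mulfI kap0); rewrite -detE // form1 mulfV.
pose N := n * f1.
have uf1 : f1 \is a GRing.unit by rewrite mx2_unit d1 invr_eq0.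
have N0 : N != 0.
  by apply: contraNneq n0' => e; rewrite -[n](mulrK uf1) -/N e mul0r.
have N2 : N * N = 0.
  by rewrite /N mulrA -(mulrA n) anti mulrN mulrA n2' mul0r oppr0 mul0r.
have KN z : P (f1 + z *: n) -> stabilizes (trless_part P) (1 + (- (z * kap)) *: N).
  move=> Pz; have kz : - kap^-1 != 0 by rewrite oppr_eq0 invr_eq0.
  apply: (stabilizes_eq kz (N := (f1 + z *: n) * f1)); last first.
    apply: stabilizesM; last exact: K_P.
    by apply: K_P => //; rewrite mxtraceD mxtraceZ tr1 trn mulr0 addr0.
  rewrite mulrDl trless_sqr // d1 -scalerAl -/N scalerDr scalerA.
  by rewrite mulrNN mulrCA mulVf // mulr1 -[RHS]/(_ + _) scalemx1.
have Pone : P (f1 + 1 *: n).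
  have -> : f1 + 1 *: n = (-1) *: mrefl kap D f2 f1.
    rewrite /mrefl form12n form22 divr1 mulr1 neg1 scale1r /n.
    rewrite !scaleN1r opprK addrA -mulr2n -scaler_nat neg1 scaleN1r opprD //.
  by apply: model_mirror_scal; [rewrite oppr_eq0 oner_eq0 | exact: model_mirror_refl].
apply: (complete_of_root_group N0 N2) => u.
have [a [b [ka kb e]]] := Fth (- u / kap).
have sq z : (z *: N) * (z *: N) = 0 by rewrite -scalerAl -scalerAr N2 !scaler0.
have -> : 1 + u *: N = (1 + a *: ((- (1 * kap)) *: N)) * (1 + b *: ((- (th * kap)) *: N)).
  rewrite !scalerA lower_pow //; congr (_ + _ *: _).
  transitivity (- kap * (a + b * th)); last by ring.
  by rewrite -e; field; rewrite ?gam0 ?rho0.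
have K1 := prime_transvections (sq _) (KN _ Pone) ka.
have K2 := prime_transvections (sq _) (KN _ Pth) kb.
exact: stabilizesM K1 K2.
Qed.
End Isotropic.

(** The isotropic vectors that the matrix model needs exist because binary
    forms over [F] are universal. *)
Section Complete.
Variables (t a0 a1 a2 a3 : F).
Local Notation e1 := (comb (- t / 2%:R) 1 (- 1 / 2%:R) 0).
Hypotheses (m0 : mir (comb 1 0 0 0)) (m1 : mir e1)
  (m2 : mir (comb 0 0 1 0)) (mc : mir (comb a0 a1 a2 a3)).
Hypotheses (ne1 : t ^+ 2 / 4%:R + gam + rho / 4%:R = 1)
  (nc : a0 ^+ 2 + gam * a1 ^+ 2 + rho * a2 ^+ 2 + D * a3 ^+ 2 = 1)
  (a30 : a3 != 0) (a012 : [|| a0 != 0, a1 != 0 | a2 != 0]) (t0 : t != 0).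

Lemma complete_of_rotation p1 p2 p3 q1 q2 q3 z :
  (3%:R : F) != 0 -> t ^+ 2 = t + 1 ->
  prime_span t ->
  mir (comb p1 p2 p3 0) -> mir (comb q1 q2 q3 0) ->
  (forall k, comb q1 q2 q3 0 != k *: comb p1 p2 p3 0) ->
  4%:R * <<comb p1 p2 p3 0, comb q1 q2 q3 0>> ^+ 2 =
    z * (<<comb p1 p2 p3 0, comb p1 p2 p3 0>> * <<comb q1 q2 q3 0, comb q1 q2 q3 0>>) ->
  long_rotation z ->
  forall v w, mir v -> <<w, w>> = <<v, v>> -> mir w.
Proof.
have [x [y xy]] := binary_universal two (-1) gam0 rho0.
exact: (model_complete_of_rotation xy m0 m1 m2 mc).
Qed.

Lemma complete_of_parallel th :
  (3%:R : F) = 0 -> rho = 1 ->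
  prime_span th ->
  mir (e1 + th *: (e1 - comb 0 0 1 0)) ->
  forall v w, mir v -> <<w, w>> = <<v, v>> -> mir w.
Proof.
have [x [y xy]] := binary_universal two (-1) gam0 rho0.
exact: (model_complete_of_parallel xy m0 m1 m2 mc).
Qed.
End Complete.
End Chain.

(** * Generation of the orthogonal group by reflections *)

Section CartanDieudonne.
Variable F : finFieldType.
Hypothesis two : (2%:R : F) != 0.
Variable B : 'M[F]_4.
Hypothesis Bsym : B^T = B.
Local Notation V := 'cV[F]_4.
Local Notation "<< x , y >>" := (bform B x y).
Variable G : {group {'GL_4[F]}}.
Local Notation mir := (mirror B G).
Local Notation refl := (reflection B).
Implicit Types (x y z : V).

Definition isometry (A : {'GL_4[F]}) := forall x y, <<gl A *m x, gl A *m y>> = <<x, y>>.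

Lemma isometryM A A' : isometry A -> isometry A' -> isometry (A * A')%g.
Proof. by move=> iA iA' x y; rewrite -!mulmxA iA iA'. Qed.

Lemma fullP A : reflect (isometry A) (A \in full_orthogonal B).
Proof.
rewrite inE; apply: (iffP forallP) => [h x y|h x]; first by apply/eqP; have /forallP := h x; apply.
by apply/forallP => y; rewrite -(h x y).
Qed.

Lemma refl_fix x z : <<z, x>> = 0 -> refl x z = z.
Proof. by move=> zx; rewrite /reflection zx mul0r mulr0 scale0r subr0. Qed.

Hypothesis all_mirrors : forall w, <<w, w>> != 0 -> mir w.

(** One reflection or two exchange vectors of equal nonzero norm, since [x -
    y] and [x + y] are not both isotropic: their norms add up to four times
    that of [x]. *)
Lemma transport x y : <<x, x>> = <<y, y>> -> <<x, x>> != 0 ->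
  exists2 A, A \in G & [/\ isometry A, gl A *m y = x &
    forall z, <<z, x>> = 0 -> <<z, y>> = 0 -> gl A *m z = z].
Proof.
move=> xy x0.
have step w : <<w, w>> != 0 -> exists2 A, A \in G & isometry A /\ forall z, gl A *m z = refl w z.
  move=> w0; have /mirrorP[_ [A GA hA]] := all_mirrors w0.
  by exists A => //; split=> // a b; rewrite !hA refl_isom.
have Nsub : <<x - y, x - y>> = 2 * (<<x, x>> - <<y, x>>).
  by rewrite !(bformDl, bformNl, bformDr Bsym, bformNr Bsym) -xy (bformC Bsym x y); ring.
have Nadd : <<x + y, x + y>> = 2 * (<<x, x>> + <<y, x>>).
  by rewrite !(bformDl, bformDr Bsym) -xy (bformC Bsym x y); ring.
have [e|n0] := eqVneq <<x - y, x - y>> 0; last first.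
  have [A GA [iA hA]] := step _ n0; exists A => //; split=> // [|z zx zy].
    rewrite hA /reflection Nsub (bformDr Bsym) (bformNr Bsym) -xy.
    rewrite Nsub in n0; have d0 : <<x, x>> - <<y, x>> != 0 by apply: contraNneq n0 => ->; rewrite mulr0.
    have -> : 2 * ((<<y, x>> - <<x, x>>) / (2 * (<<x, x>> - <<y, x>>))) = -1 by field; rewrite d0 two.
    by rewrite scaleN1r opprK addrC subrK.
  by rewrite hA refl_fix // (bformDr Bsym) (bformNr Bsym) zx zy subrr.
have xyE : <<y, x>> = <<x, x>>.
  by apply/eqP; rewrite eq_sym -subr_eq0; move/eqP: e; rewrite Nsub mulf_eq0 (negbTE two).
have a0 : <<x + y, x + y>> != 0.
  rewrite Nadd xyE (_ : 2 * _ = 2 * (2 * <<x, x>>)); last by ring.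
  by rewrite mulf_neq0 // mulf_neq0.
have [A GA [iA hA]] := step _ a0; have [A' GA' [iA' hA']] := step _ x0.
exists (A' * A)%g; first by rewrite groupM.
split=> [||z zx zy]; first exact: isometryM.
  rewrite -[gl _]/(gl A' *m gl A) -mulmxA hA hA'.
  have -> : refl (x + y) y = - x.
    rewrite /reflection Nadd (bformDr Bsym) -xy xyE.
    have -> : 2 * ((<<x, x>> + <<x, x>>) / (2 * (<<x, x>> + <<x, x>>))) = 1.
      have -> : <<x, x>> + <<x, x>> = 2 * <<x, x>> by ring.
      by field; rewrite ?two ?x0.
    by rewrite scale1r opprD addrCA subrr addr0.
  rewrite /reflection bformNl mulNr divff // mulrN1 scaleNr opprK.
  by rewrite -[2]/(1 + 1) scalerDl scale1r addrA addNr add0r.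
rewrite -[gl _]/(gl A' *m gl A) -mulmxA hA hA' !refl_fix // (bformDr Bsym) zx zy addr0 //.
Qed.

Variables u0 u1 u2 u3 : V.
Hypotheses (n0 : <<u0, u0>> != 0) (n1 : <<u1, u1>> != 0) (n2 : <<u2, u2>> != 0)
  (n3 : <<u3, u3>> != 0).
Hypotheses (o01 : <<u0, u1>> = 0) (o02 : <<u0, u2>> = 0) (o03 : <<u0, u3>> = 0)
  (o12 : <<u1, u2>> = 0) (o13 : <<u1, u3>> = 0) (o23 : <<u2, u3>> = 0).
Hypothesis spanning : forall v, exists a b c d, v = comb u0 u1 u2 u3 a b c d.

(** The Cartan-Dieudonne theorem. Multiplying an isometry by elements of [G]
    makes it fix one vector after the other of an orthogonal basis; the later
    factors fix what is orthogonal to the vectors they exchange, hence the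
    basis vectors treated before. *)
Lemma full_orthogonal_sub : full_orthogonal B \subset G.
Proof.
apply/subsetP => A /fullP iA.
have fix_perp C x z : isometry C -> gl C *m z = z -> <<z, x>> = 0 -> <<z, gl C *m x>> = 0.
  by move=> iC Cz; rewrite -{2}Cz iC.
have nrm C x : isometry C -> <<x, x>> = <<gl C *m x, gl C *m x>> by move=> iC; rewrite iC.
have [A0 G0 [i0 f00 p0]] := transport (nrm A u0 iA) n0.
pose C0 := (A0 * A)%g; have iC0 : isometry C0 by apply: isometryM.
have c00 : gl C0 *m u0 = u0 by rewrite -[gl C0]/(gl A0 *m gl A) -mulmxA.
have [A1 G1 [i1 f11 p1]] := transport (nrm C0 u1 iC0) n1.
pose C1 := (A1 * C0)%g; have iC1 : isometry C1 by apply: isometryM.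
have c11 : gl C1 *m u1 = u1 by rewrite -[gl C1]/(gl A1 *m gl C0) -mulmxA.
have c10 : gl C1 *m u0 = u0.
  by rewrite -[gl C1]/(gl A1 *m gl C0) -mulmxA c00 p1 // fix_perp.
have [A2 G2 [i2 f22 p2]] := transport (nrm C1 u2 iC1) n2.
pose C2 := (A2 * C1)%g; have iC2 : isometry C2 by apply: isometryM.
have c22 : gl C2 *m u2 = u2 by rewrite -[gl C2]/(gl A2 *m gl C1) -mulmxA.
have c20 : gl C2 *m u0 = u0.
  by rewrite -[gl C2]/(gl A2 *m gl C1) -mulmxA c10 p2 // fix_perp.
have c21 : gl C2 *m u1 = u1.
  by rewrite -[gl C2]/(gl A2 *m gl C1) -mulmxA c11 p2 // fix_perp.
have [A3 G3 [i3 f33 p3]] := transport (nrm C2 u3 iC2) n3.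
pose C3 := (A3 * C2)%g.
have c33 : gl C3 *m u3 = u3 by rewrite -[gl C3]/(gl A3 *m gl C2) -mulmxA.
have c30 : gl C3 *m u0 = u0.
  by rewrite -[gl C3]/(gl A3 *m gl C2) -mulmxA c20 p3 // fix_perp.
have c31 : gl C3 *m u1 = u1.
  by rewrite -[gl C3]/(gl A3 *m gl C2) -mulmxA c21 p3 // fix_perp.
have c32 : gl C3 *m u2 = u2.
  by rewrite -[gl C3]/(gl A3 *m gl C2) -mulmxA c22 p3 // fix_perp.
have C3id (v : V) : gl C3 *m v = v.
  have [a [b [c [d ->]]]] := spanning v.
  by rewrite /comb !mulmxDr -!scalemxAr c30 c31 c32 c33.
have C31 : C3 = 1%g.
  by apply: gl_ext => v; rewrite C3id [RHS]mul1mx.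
have -> : A = (A3 * A2 * A1 * A0)^-1%g.
  by apply: (mulgI (A3 * A2 * A1 * A0)%g); rewrite mulgV -C31 /C3 /C2 /C1 /C0 !mulgA.
by rewrite groupV !groupM.
Qed.
End CartanDieudonne.

(** * The residue field *)

Lemma zt_intE (m : int) : ZTau m 0 = m%:~R.
Proof.
have E a b : ZTau (a + b) 0 = ZTau a 0 + ZTau b 0 :> ztau by congr ZTau; rewrite addr0.
elim/int_ind: m => [//|n IH|n IH]; first by rewrite -addn1 PoszD E IH rmorphD.
by rewrite -addn1 PoszD opprD E IH rmorphD.
Qed.

Lemma zt_conjD x y : zt_conj (x + y) = zt_conj x + zt_conj y.
Proof. by case: x y => [a b] [c d]; congr ZTau => /=; ring. Qed.
Lemma zt_conjN x : zt_conj (- x) = - zt_conj x.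
Proof. by case: x => [a b]; congr ZTau => /=; ring. Qed.
Lemma zt_conjM x y : zt_conj (x * y) = zt_conj x * zt_conj y.
Proof. by case: x y => [a b] [c d]; congr ZTau => /=; ring. Qed.
Lemma zt_conjK : involutive zt_conj.
Proof. by case=> [a b]; congr ZTau => /=; ring. Qed.

Section ResidueField.
Variables (F : finFieldType) (red : {rmorphism ztau -> F}) (p : ztau).
Hypothesis redP : forall a, reflect (zt_dvd p a) (red a == 0).
Hypothesis red_surj : forall x, exists a, red a == x.
Hypothesis p0 : p != 0.
Local Notation N := (zt_norm p).

Lemma norm_neq0 : N != 0.
Proof. by rewrite zt_norm_eq0. Qed.

Definition lift_res (x : F) : ztau := xchoose (red_surj x).
Lemma lift_resK x : red (lift_res x) = x.
Proof. exact/eqP/(xchooseP (red_surj x)). Qed.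

Local Notation m := `|N|%N.

Definition coord_mod (z : ztau) : nat * nat := (`|(zre z %% N)%Z|%N, `|(ztc z %% N)%Z|%N).

Lemma coord_modP z z' : coord_mod z = coord_mod z' <-> exists c, z = z' + ZTau N 0 * c.
Proof.
have modE (a b : int) : `|(a %% N)%Z|%N = `|(b %% N)%Z|%N <-> exists c, a = b + N * c.
  split=> [e|[c ->]]; last by rewrite addrC mulrC modzMDl.
  have {}e : (a %% N)%Z = (b %% N)%Z.
    by rewrite -[LHS]gez0_abs ?modz_ge0 ?norm_neq0 // e gez0_abs ?modz_ge0 ?norm_neq0.
  exists ((a %/ N)%Z - (b %/ N)%Z); rewrite {1}(divz_eq a N) {1}(divz_eq b N) e; ring.
split=> [[/modE[c ec] /modE[d ed]]|[[c d] ->]].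
  by exists (ZTau c d); rewrite zt_intM; case: z z' ec ed => [a b] [a' b'] /= -> ->.
by rewrite zt_intM /coord_mod /=; congr (_, _); apply/modE; [exists c | exists d].
Qed.

Lemma coord_mod_lt z : ((coord_mod z).1 < m)%N && ((coord_mod z).2 < m)%N.
Proof.
have lt a : (`|(a %% N)%Z| < m)%N.
  by rewrite -ltz_nat gez0_abs ?modz_ge0 ?norm_neq0 // ltz_mod // norm_neq0.
by rewrite /= !lt.
Qed.

(** As [N = p * zt_conj p], a residue modulo [N] amounts to a residue modulo
    [p] and one modulo the conjugate of [p], and conjugation identifies the
    latter with another residue modulo [p]; hence the square of [#|F|] is the
    square of the norm. *)
Lemma card_residue : #|F| = m.
Proof.
pose f (u : F * F) : 'I_m * 'I_m :=
  let z := lift_res u.1 + p * zt_conj (lift_res u.2) in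
  (Ordinal (proj1 (andP (coord_mod_lt z))), Ordinal (proj2 (andP (coord_mod_lt z)))).
have pc : p * zt_conj p = ZTau N 0 := zt_mul_conj p.
have redp c : red (p * c) = 0 by apply/eqP/redP; exists c; rewrite mulrC.
have fE u v : f u = f v -> coord_mod (lift_res u.1 + p * zt_conj (lift_res u.2)) =
    coord_mod (lift_res v.1 + p * zt_conj (lift_res v.2)).
  by case=> e1 e2; rewrite [LHS]surjective_pairing [RHS]surjective_pairing /= e1 e2.
have inj : injective f.
  move=> [x y] [x' y'] /fE/coord_modP[c] /=; rewrite -pc -!mulrA => e.
  have xx : x = x'.
    rewrite -(lift_resK x) -(lift_resK x'); have := congr1 red e.
    by rewrite !rmorphD /= !redp !addr0.
  move: e; rewrite xx -addrA -mulrDr => /addrI/(mulfI p0)/(congr1 zt_conj).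
  rewrite zt_conjD zt_conjM !zt_conjK => /(congr1 red).
  by rewrite rmorphD /= redp addr0 !lift_resK => ->.
have surj v : exists u, f u = v.
  case: v => [[i im] [j jm]]; pose z := ZTau i%:Z j%:Z.
  have /redP[c ec] : red (z - lift_res (red z)) == 0 by rewrite rmorphB /= lift_resK subrr.
  have /redP[e ee] : red (zt_conj c - lift_res (red (zt_conj c))) == 0.
    by rewrite rmorphB /= lift_resK subrr.
  exists (red z, red (zt_conj c)).
  have /coord_modP E : exists d, lift_res (red z) + p * zt_conj (lift_res (red (zt_conj c))) =
      z + ZTau N 0 * d.
    exists (- zt_conj e); rewrite -pc.
    have -> : zt_conj (lift_res (red (zt_conj c))) = c - zt_conj e * zt_conj p.
      rewrite -zt_conjM -ee zt_conjD zt_conjN zt_conjK.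
      by rewrite opprB addrCA subrr addr0.
    have -> : lift_res (red z) = z - c * p by rewrite -ec opprB addrCA subrr addr0.
    ring.
  have sm (k : nat) : (k < m)%N -> `|(k%:Z %% N)%Z|%N = k.
    by move=> km; rewrite -modz_abs modz_nat absz_nat modn_small.
  by congr (_, _); apply: val_inj => /=; [have := congr1 fst E | have := congr1 snd E];
    rewrite /= sm.
have sq : #|{: F * F}| = #|{: 'I_m * 'I_m}|.
  rewrite -(card_codom inj); apply: eq_card => v; rewrite !inE.
  by have [u <-] := surj v; rewrite codom_f.
rewrite !card_prod card_ord in sq.
by apply/eqP; rewrite -(eqn_exp2r _ _ (ltn0Sn 1)) -!mulnn sq.
Qed.

Local Notation t := (red tau).
Lemma tau_sqr : t ^+ 2 = t + 1.
Proof. by rewrite -rmorphXn -(rmorph1 red) -rmorphD. Qed.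

Lemma tau_neq0 : t != 0.
Proof.
by apply: contra_eqN tau_sqr => /eqP ->; rewrite expr0n add0r eq_sym oner_eq0.
Qed.

Lemma prime_sub_int (n : int) : prime_sub (n%:~R : F).
Proof.
case: n => n; first exact: (prime_sub_nat F n).
by rewrite NegzE rmorphN /=; apply: prime_subN; exact: (prime_sub_nat F n.+1).
Qed.

Lemma redE a b : red (ZTau a b) = a%:~R + b%:~R * t.
Proof.
have -> : ZTau a b = ZTau a 0 + ZTau b 0 * tau.
  by congr ZTau => /=; ring.
by rewrite !zt_intE rmorphD rmorphM /= !rmorph_int.
Qed.

Lemma residue_span : prime_span t.
Proof.
move=> x; have [[a b] /eqP <-] := red_surj x; exists a%:~R, b%:~R.
by rewrite redE; split=> //; exact: prime_sub_int.
Qed.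

Hypothesis p_unit : p \isn't a GRing.unit.
Hypothesis p_odd : zt_odd p.

(** If [2 = c * p], the norms of [c] and [p] multiply to 4, and that of [p] is
    not 1 or -1. Norm 1 or -1 for [c] makes [p] an associate of 2, and so does
    norm 2 or -2 for [p]: if [a ^ 2 + a b - b ^ 2] is even, then [a] and [b]
    are even and 2 divides [p]. *)
Lemma two_neq0 : (2%:R : F) != 0.
Proof.
rewrite -(rmorph_nat red); apply/negP => /redP[c e].
have [u uu] : exists2 u, u \is a GRing.unit & p = u * 2%:R; last by move=> h; apply: p_odd; exists u.
have NcN : (`|zt_norm c| * `|N| = 4)%N by rewrite -abszM -zt_normM -e.
have c_u : `|zt_norm c|%N = 1%N -> exists2 u, u \is a GRing.unit & p = u * 2%:R.
  move=> Nc; have uc : c \is a GRing.unit by rewrite -topredE /= /zt_unit Nc.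
  by exists c^-1; rewrite ?unitrV // e mulKr.
have N1 : `|N|%N != 1%N by apply: contraNN p_unit => h; exact: h.
have [N2|N2] := eqVneq `|N|%N 2%N; last first.
  apply: c_u; move: NcN N1 N2; case: `|N|%N => [|[|[|[|[|n]]]]] //; lia.
have [M NM] : exists M : int, N = 2 * M.
  by have /dvdzP[M ->] : (2 %| N)%Z; [rewrite dvdzE N2 | exists M; rewrite mulrC].
have par (a : int) : exists x r : int, a = 2 * x + r /\ (r = 0 \/ r = 1).
  exists (a %/ 2)%Z, (a %% 2)%Z; split; first by rewrite {1}(divz_eq a 2) mulrC.
  by have := modz_ge0 a (_ : 2 != 0 :> int); have := ltz_pmod a (_ : 0 < 2 :> int); lia.
have [x [r [ax rr]]] := par (zre p); have [y [s [bs ss]]] := par (ztc p).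
have [r0 s0] : r = 0 /\ s = 0.
  move: NM; rewrite /zt_norm ax bs.
  have -> : (2 * x + r) ^+ 2 + (2 * x + r) * (2 * y + s) - (2 * y + s) ^+ 2 =
    2 * (2 * x ^+ 2 + 2 * x * r + 2 * x * y + x * s + r * y - 2 * y ^+ 2 - 2 * y * s)
      + (r ^+ 2 + r * s - s ^+ 2) :> int by ring.
  move: (_ - 2 * y * s) => X; case: rr => ->; case: ss => ->; lia.
have pE : p = ZTau x y * 2%:R.
  move: ax bs; rewrite r0 s0 !addr0; case: (p) => a b /= -> ->.
  by congr ZTau => /=; ring.
exists (ZTau x y) => //; apply/unitrP; exists c.
have c1 : c * ZTau x y = 1.
  apply: (mulIf (_ : 2%:R != 0 :> ztau)) => //.
  by rewrite mul1r -mulrA -pE -e.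
by rewrite [ZTau x y * c]mulrC c1.
Qed.

(** A field of even order would have an additive element of order 2. *)
Lemma card_residue_odd : odd #|F|.
Proof.
apply/negPn/negP; rewrite -dvdn2 => d2.
have [||x _ ox] := @pgroup.Cauchy _ 2 [set: F]%G; rewrite ?cardsT //.
have := expg_order x; rewrite ox FinRing.zmodXgE => e.
have x0 : x = 0.
  apply/eqP; have : 2%:R * x == 0 by rewrite mulr_natl; apply/eqP; exact: e.
  by rewrite mulf_eq0 (negbTE two_neq0).
by move: ox; rewrite x0 -[0]/(1%g : F) order1.
Qed.

(** The elements 0, 1, -1, [tau], [- tau] stay different. *)
Lemma card_residue_gt4 : (4 < #|F|)%N.
Proof.
have t2 := tau_sqr; have two0 := two_neq0; have t0 := tau_neq0.
have t1 : t != 1.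
  apply: contra_eqN t2 => /eqP ->; rewrite expr1n -subr_eq0 opprD addrA subrr sub0r.
  by rewrite oppr_eq0 oner_eq0.
have tm : t != -1.
  apply: contra_eqN t2 => /eqP ->; rewrite sqrrN expr1n addNr oner_eq0 //.
have dbl (x : F) : x != 0 -> x != - x.
  by move=> x0; rewrite -subr_eq0 opprK -mulr2n -mulr_natl mulf_neq0.
have uniq5 : uniq [:: 0; 1; -1; t; - t].
  rewrite /= !inE !negb_or -(eqr_oppLR 1 t) eqr_opp !(eq_sym 0) !oppr_eq0 !oner_neq0.
  by rewrite t0 (eq_sym 1 t) t1 (eq_sym (-1)) tm !dbl ?oner_neq0.
by have /card_uniqP e := uniq5; have := max_card (mem [:: 0; 1; -1; t; - t]); rewrite e.
Qed.
End ResidueField.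

(** * Chains of mirrors in the reflection group *)

Section Vec.
Variable F : fieldType.
Definition vec (a b c d : F) : 'cV[F]_4 := \col_i nth 0 [:: a; b; c; d] i.

Lemma vecP (x : 'cV[F]_4) : exists a b c d, x = vec a b c d.
Proof.
exists (x 0 0), (x 1 0), (x (inord 2) 0), (x (inord 3) 0); apply/matrixP => i j.
rewrite ord1 mxE; case: i => [[|[|[|[|i]]]] hi] //=; congr (x _ _); apply: val_inj => //=; rewrite inordK //.
Qed.
Lemma vecD a b c d a' b' c' d' : vec a b c d + vec a' b' c' d' =
  vec (a + a') (b + b') (c + c') (d + d').
Proof. by apply/matrixP => -[[|[|[|[|i]]]] hi] j; rewrite !mxE. Qed.
Lemma vecZ k a b c d : k *: vec a b c d = vec (k * a) (k * b) (k * c) (k * d).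
Proof. by apply/matrixP => -[[|[|[|[|i]]]] hi] j; rewrite !mxE. Qed.
Lemma vecN a b c d : - vec a b c d = vec (- a) (- b) (- c) (- d).
Proof. by rewrite -scaleN1r vecZ; congr vec; ring. Qed.
Lemma vec_inj a b c d a' b' c' d' : vec a b c d = vec a' b' c' d' ->
  [/\ a = a', b = b', c = c' & d = d'].
Proof.
move/matrixP => e; split.
- by have := e 0 0; rewrite !mxE.
- by have := e 1 0; rewrite !mxE.
- by have := e (Ordinal (isT : (2 < 4)%N)) 0; rewrite !mxE.
- by have := e (Ordinal (isT : (3 < 4)%N)) 0; rewrite !mxE.
Qed.
Definition vecE := (vecD, vecZ, vecN).
End Vec.

Section Concrete.
Variables (F : finFieldType) (f : {rmorphism ztau -> F}) (k : nat).
Hypothesis two : (2%:R : F) != 0.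
Local Notation t := (f tau).
Local Notation rh := (f (rho k)).
Local Notation B := (map_mx f (gram k)).
Local Notation G := (reflection_group f k).
Local Notation mir := (mirror B G).

Let t2 : t ^+ 2 = t + 1. Proof. exact: tau_sqr. Qed.

Lemma gram_sym : B^T = B.
Proof.
apply/matrixP => -[[|[|[|[|i]]]] hi] -[[|[|[|[|j]]]] hj] //; rewrite !mxE //=.
Qed.

Lemma gram_vec a b c d : B *m vec a b c d =
  vec (4%:R * a - 2%:R * t ^+ 2 * b)
      (- 2%:R * t ^+ 2 * a + 4%:R * t ^+ 2 * b - 2%:R * t ^+ 2 * c - 2%:R * t ^+ 2 * rh * d)
      (- 2%:R * t ^+ 2 * b + 4%:R * t ^+ 2 * c)
      (- 2%:R * t ^+ 2 * rh * b + 4%:R * t ^+ 2 * rh * d).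
Proof.
apply/matrixP => -[[|[|[|[|i]]]] hi] j //; rewrite !mxE !big_ord_recl big_ord0 /= !mxE /=;
  rewrite ?(rmorph0, rmorphM, rmorphN, rmorph_nat, rmorphXn) /=; ring.
Qed.

Lemma bform_vec a b c d a' b' c' d' : bform B (vec a b c d) (vec a' b' c' d') =
  4%:R * a * a' - 2%:R * t ^+ 2 * (a * b' + b * a') + 4%:R * t ^+ 2 * (b * b')
  - 2%:R * t ^+ 2 * (b * c' + c * b') + 4%:R * t ^+ 2 * (c * c')
  - 2%:R * t ^+ 2 * rh * (b * d' + d * b') + 4%:R * t ^+ 2 * rh * (d * d').
Proof.
rewrite /bform -mulmxA gram_vec !mxE !big_ord_recl big_ord0 /= !mxE /=; ring.
Qed.

Let g0 : {'GL_4[F]} := GL_map f r0_unit.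
Let g1 : {'GL_4[F]} := GL_map f (r1_unit k).
Let g2 : {'GL_4[F]} := GL_map f r2_unit.
Let g3 : {'GL_4[F]} := GL_map f r3_unit.

Ltac gen_tac := apply/matrixP => -[[|[|[|[|i]]]] hi] j //;
  rewrite !mxE !big_ord_recl big_ord0 /= !mxE /=;
  rewrite ?(rmorph0, rmorph1, rmorphN, rmorphXn) /=; ring.

Lemma g0_vec a b c d : gl g0 *m vec a b c d = vec (- a + t ^+ 2 * b) b c d.
Proof. rewrite -[gl g0]/(map_mx f r0); gen_tac. Qed.
Lemma g1_vec a b c d : gl g1 *m vec a b c d = vec a (a - b + c + rh * d) c d.
Proof. rewrite -[gl g1]/(map_mx f (r1 k)); gen_tac. Qed.
Lemma g2_vec a b c d : gl g2 *m vec a b c d = vec a b (b - c) d.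
Proof. rewrite -[gl g2]/(map_mx f r2); gen_tac. Qed.
Lemma g3_vec a b c d : gl g3 *m vec a b c d = vec a b c (b - d).
Proof. rewrite -[gl g3]/(map_mx f r3); gen_tac. Qed.

Let t0 : t != 0. Proof. exact: tau_neq0. Qed.
Let four : 4%:R != 0 :> F. Proof. exact: four_neq0. Qed.

(** All four norms are squares, except for the factor [rho] in the last one:
    this factor decides between the two groups. *)
Lemma root0_norm : bform B (vec 1 0 0 0) (vec 1 0 0 0) = 2%:R ^+ 2.
Proof. by rewrite bform_vec; ring. Qed.
Lemma root1_norm : bform B (vec 0 1 0 0) (vec 0 1 0 0) = (2%:R * t) ^+ 2.
Proof. by rewrite bform_vec; ring. Qed.
Lemma root2_norm : bform B (vec 0 0 1 0) (vec 0 0 1 0) = (2%:R * t) ^+ 2.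
Proof. by rewrite bform_vec; ring. Qed.
Lemma root3_norm : bform B (vec 0 0 0 1) (vec 0 0 0 1) = rh * (2%:R * t) ^+ 2.
Proof. by rewrite bform_vec; ring. Qed.

Lemma g0_refl x : gl g0 *m x = reflection B (vec 1 0 0 0) x.
Proof.
have [a [b [c [d ->]]]] := vecP x.
rewrite g0_vec /reflection root0_norm bform_vec !vecE; congr vec; field; rewrite ?two ?four //.
Qed.
Lemma g1_refl x : gl g1 *m x = reflection B (vec 0 1 0 0) x.
Proof.
have [a [b [c [d ->]]]] := vecP x.
rewrite g1_vec /reflection root1_norm bform_vec !vecE; congr vec; field; rewrite ?two ?four ?t0 //.
Qed.
Lemma g2_refl x : gl g2 *m x = reflection B (vec 0 0 1 0) x.
Proof.
have [a [b [c [d ->]]]] := vecP x.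
rewrite g2_vec /reflection root2_norm bform_vec !vecE; congr vec; field; rewrite ?two ?four ?t0 //.
Qed.

Hypothesis rh0 : rh != 0.

Lemma g3_refl x : gl g3 *m x = reflection B (vec 0 0 0 1) x.
Proof.
have [a [b [c [d ->]]]] := vecP x.
rewrite g3_vec /reflection root3_norm bform_vec !vecE; congr vec; field; rewrite ?two ?four ?t0 ?rh0 //.
Qed.

Let in_G : [/\ g0 \in G, g1 \in G, g2 \in G & g3 \in G].
Proof. by split; apply: mem_gen; rewrite !inE eqxx ?orbT. Qed.

Lemma mir0 : mir (vec 1 0 0 0).
Proof.
apply/mirrorP; split; first by rewrite root0_norm expf_neq0.
by have [? _ _ _] := in_G; exists g0 => //; exact: g0_refl.
Qed.
Lemma mir1 : mir (vec 0 1 0 0).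
Proof.
apply/mirrorP; split; first by rewrite root1_norm expf_neq0 ?mulf_neq0.
by have [_ ? _ _] := in_G; exists g1 => //; exact: g1_refl.
Qed.
Lemma mir2 : mir (vec 0 0 1 0).
Proof.
apply/mirrorP; split; first by rewrite root2_norm expf_neq0 ?mulf_neq0.
by have [_ _ ? _] := in_G; exists g2 => //; exact: g2_refl.
Qed.
Lemma mir3 : mir (vec 0 0 0 1).
Proof.
apply/mirrorP; split; first by rewrite root3_norm !mulf_neq0 ?expf_neq0 ?mulf_neq0.
by have [_ _ _ ?] := in_G; exists g3 => //; exact: g3_refl.
Qed.

Lemma mir_eq v w c : mir v -> c != 0 -> w = c *: v -> mir w.
Proof. by move=> mv c0 ->; exact: (mirror_scal gram_sym). Qed.

Lemma mir_g0 a b c d : mir (vec a b c d) -> mir (vec (- a + t ^+ 2 * b) b c d).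
Proof. by move/(mirror_refl gram_sym mir0); rewrite -g0_refl g0_vec. Qed.
Lemma mir_g1 a b c d : mir (vec a b c d) -> mir (vec a (a - b + c + rh * d) c d).
Proof. by move/(mirror_refl gram_sym mir1); rewrite -g1_refl g1_vec. Qed.
Lemma mir_g2 a b c d : mir (vec a b c d) -> mir (vec a b (b - c) d).
Proof. by move/(mirror_refl gram_sym mir2); rewrite -g2_refl g2_vec. Qed.
Lemma mir_g3 a b c d : mir (vec a b c d) -> mir (vec a b c (b - d)).
Proof. by move/(mirror_refl gram_sym mir3); rewrite -g3_refl g3_vec. Qed.

Hypothesis F4 : (4 < #|F|)%N.
Hypothesis Ft : prime_span t.
Hypothesis disc0 : 3%:R - t ^+ 2 - rh != 0.

Definition classes_complete := forall v w, mir v -> bform B w w = bform B v v -> mir w.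

(** The first, second and fourth roots form a chain with angles [pi / 5] and
    [pi / k]. Coordinates are taken with respect to the normalised outer roots
    [u0], [u2], the component [u1] of the second root orthogonal to them and
    that of the third root, [u3]. The long rotation is the product of the
    first reflection with that in [g1 v3], for [x = tau ^ 2 rho], or of the
    second and the fourth, for [x = rho]. *)
Lemma complete_chain_0_1_3 : (3%:R : F) != 0 -> 4%:R - t ^+ 2 - rh != 0 ->
  long_rotation (t ^+ 2 * rh) || long_rotation rh -> classes_complete.
Proof.
move=> three gam0 lr.
pose g := (4%:R - t ^+ 2 - rh) / 4%:R; have g0' : g != 0 by rewrite mulf_neq0 ?invr_eq0.
pose b := 2%:R / (4%:R - t ^+ 2 - rh).
pose D := (3%:R - t ^+ 2 - rh) / (4%:R - t ^+ 2 - rh).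
have D0 : D != 0 by rewrite mulf_neq0 ?invr_eq0.
pose h := (2%:R * t)^-1.
pose u0 : 'cV[F]_4 := vec (1 / 2%:R) 0 0 0.
pose u1 : 'cV[F]_4 := vec (t / 4%:R) h 0 (h / 2%:R).
pose u2 : 'cV[F]_4 := vec 0 0 0 h.
pose u3 : 'cV[F]_4 := vec (b * (t / 4%:R)) (b * h) h (b * (h / 2%:R)).
have n0 : bform B u0 u0 = 1 by rewrite bform_vec; field.
have n1 : bform B u1 u1 = g by rewrite bform_vec /g /h; field; rewrite ?two ?four ?t0.
have n2 : bform B u2 u2 = rh by rewrite bform_vec /h; field; rewrite ?two ?four ?t0.
have n3 : bform B u3 u3 = D.
  by rewrite bform_vec /D /b /h; field; rewrite ?two ?four ?t0 ?gam0.
have o01 : bform B u0 u1 = 0 by rewrite bform_vec /h; field; rewrite ?two ?four ?t0.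
have o02 : bform B u0 u2 = 0 by rewrite bform_vec /h; ring.
have o03 : bform B u0 u3 = 0 by rewrite bform_vec /b /h; field; rewrite ?two ?four ?t0 ?gam0.
have o12 : bform B u1 u2 = 0 by rewrite bform_vec /h; field; rewrite ?two ?four ?t0.
have o13 : bform B u1 u3 = 0 by rewrite bform_vec /b /h; field; rewrite ?two ?four ?t0 ?gam0.
have o23 : bform B u2 u3 = 0 by rewrite bform_vec /b /h; field; rewrite ?two ?four ?t0 ?gam0.
have cE p q r s : comb u0 u1 u2 u3 p q r s =
  vec (p / 2%:R + (q + s * b) * (t / 4%:R)) ((q + s * b) * h) (s * h) ((q + s * b) * (h / 2%:R) + r * h).
  by rewrite /comb !vecE; congr vec; ring.
have h0 : h != 0 by rewrite invr_eq0 mulf_neq0.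
have me0 : mir (comb u0 u1 u2 u3 1 0 0 0).
  by apply: (mir_eq mir0 (c := 1 / 2%:R)); rewrite ?mulf_neq0 ?invr_eq0 ?oner_neq0 // cE vecE; congr vec; ring.
have me1 : mir (comb u0 u1 u2 u3 (- t / 2%:R) 1 (- 1 / 2%:R) 0).
  apply: (mir_eq mir1 h0); rewrite cE vecE; congr vec; rewrite ?mul0r ?mulr0 ?addr0 //; field; rewrite ?two ?four //.
have me3 : mir (comb u0 u1 u2 u3 0 0 1 0).
  by apply: (mir_eq mir3 h0); rewrite cE vecE; congr vec; ring.
have me2 : mir (comb u0 u1 u2 u3 0 (- b) 0 1).
  by apply: (mir_eq mir2 h0); rewrite cE vecE; congr vec; ring.
have ne1 : t ^+ 2 / 4%:R + g + rh / 4%:R = 1 by rewrite /g; field.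
have nc : 0 ^+ 2 + g * (- b) ^+ 2 + rh * 0 ^+ 2 + D * 1 ^+ 2 = 1.
  by rewrite /g /b /D; field; rewrite ?four ?gam0.
have b0 : - b != 0 by rewrite oppr_eq0 mulf_neq0 ?invr_eq0.
have H := complete_of_rotation two F4 gram_sym n0 n1 n2 n3 o01 o02 o03 o12 o13 o23 g0' rh0 D0
  me0 me1 me3 me2 ne1 nc (oner_neq0 _) _ t0 three t2 Ft.
rewrite b0 orbT in H; have {}H := H isT.
case/orP: lr => lr.
  have m3h : mir (vec 0 0 0 h) by apply: (mir_eq mir3 h0); rewrite vecE; congr vec; ring.
  have mq : mir (comb u0 u1 u2 u3 (- rh * t / 2%:R) rh (1 - rh / 2%:R) 0).
    rewrite cE (_ : vec _ _ _ _ = vec 0 (0 - 0 + 0 + rh * h) 0 h); first exact: mir_g1 m3h.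
    by congr vec; field; rewrite ?two ?four.
  apply: (H _ _ _ _ _ _ _ me0 mq _ _ lr).
  - move=> c; rewrite !cE vecE; apply/eqP => /vec_inj[_ e _ _].
    case/eqP: (mulf_neq0 rh0 h0); transitivity ((rh + 0 * b) * h); first ring.
    by rewrite e; ring.
  by rewrite !cE !bform_vec /h; field; rewrite ?two ?four ?t0.
apply: (H _ _ _ _ _ _ _ me1 me3 _ _ lr).
- move=> c; rewrite !cE vecE; apply/eqP => /vec_inj[_ e _ e'].
  have c0 : c = 0.
    apply: (mulIf h0); rewrite mul0r; transitivity (c * ((1 + 0 * b) * h)); first ring.
    by rewrite -e; ring.
  case/eqP: h0; transitivity ((0 + 0 * b) * (h / 2%:R) + 1 * h); first ring.
  by rewrite e' c0; ring.
by rewrite !cE !bform_vec /h; field; rewrite ?two ?four ?t0.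
Qed.

(** For [k = 3] the image of the second root in the third and the fourth
    mirror is the sum [v1 + v2 + v3]. It is orthogonal to the second root, and
    the second root, the first root and this sum form a chain with two angles
    [pi / 5]. The long rotation is the product of the reflections in [v1] and
    in [g0 (v1 + v2 + v3)], for [x = tau ^ 4], or in [v1] and [v0], for [x =
    tau ^ 2]. *)
Lemma complete_chain_1_0_123 : rh = 1 -> (3%:R : F) != 0 ->
  long_rotation (t ^+ 2 * t ^+ 2) || long_rotation (t ^+ 2) -> classes_complete.
Proof.
move=> r1 three lr.
pose g := (4%:R - 2%:R * t ^+ 2) / 4%:R.
have g0' : g != 0.
  rewrite mulf_neq0 ?invr_eq0 //; apply: contraNneq two => e.
  have E : t * (4%:R - 2%:R * t ^+ 2) = - 2%:R.
    rewrite t2; have -> : t * (4%:R - 2%:R * (t + 1)) = 2%:R * t - 2%:R * t ^+ 2 by ring.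
    by rewrite t2; ring.
  by rewrite -oppr_eq0 -E e mulr0.
pose D := 1 / 2%:R : F.
have D0 : D != 0 by rewrite mulf_neq0 ?invr_eq0 ?oner_neq0.
have tt0 : t ^+ 2 != 0 by rewrite expf_neq0.
pose h := (2%:R * t)^-1; have h0 : h != 0 by rewrite invr_eq0 mulf_neq0.
pose u0 : 'cV[F]_4 := vec 0 h 0 0.
pose u1 : 'cV[F]_4 := vec (1 / 2%:R) (1 / 2%:R) (1 / 4%:R) (1 / 4%:R).
pose u2 : 'cV[F]_4 := vec 0 (1 / 2%:R) (1 / 2%:R) (1 / 2%:R).
pose u3 : 'cV[F]_4 := vec 0 0 (h / 2%:R) (- (h / 2%:R)).
have n0 : bform B u0 u0 = 1 by rewrite bform_vec /h; field; rewrite ?two ?four ?t0.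
have n1 : bform B u1 u1 = g by rewrite bform_vec r1 /g; field; rewrite ?two ?four ?t0.
have n2 : bform B u2 u2 = t ^+ 2 by rewrite bform_vec r1; field; rewrite ?two ?four ?t0.
have n3 : bform B u3 u3 = D by rewrite bform_vec r1 /D /h; field; rewrite ?two ?four ?t0.
have o01 : bform B u0 u1 = 0 by rewrite bform_vec r1 /h; field; rewrite ?two ?four ?t0.
have o02 : bform B u0 u2 = 0 by rewrite bform_vec r1 /h; field; rewrite ?two ?four ?t0.
have o03 : bform B u0 u3 = 0 by rewrite bform_vec r1 /h; field; rewrite ?two ?four ?t0.
have o12 : bform B u1 u2 = 0 by rewrite bform_vec r1; field; rewrite ?two ?four ?t0.
have o13 : bform B u1 u3 = 0 by rewrite bform_vec r1 /h; field; rewrite ?two ?four ?t0.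
have o23 : bform B u2 u3 = 0 by rewrite bform_vec r1 /h; field; rewrite ?two ?four ?t0.
have cE p q r s : comb u0 u1 u2 u3 p q r s =
  vec (q / 2%:R) (p * h + q / 2%:R + r / 2%:R) (q / 4%:R + r / 2%:R + s * (h / 2%:R))
      (q / 4%:R + r / 2%:R - s * (h / 2%:R)).
  by rewrite /comb !vecE; congr vec; ring.
have me0 : mir (comb u0 u1 u2 u3 1 0 0 0).
  by apply: (mir_eq mir1 h0); rewrite cE vecE; congr vec; ring.
have me1 : mir (comb u0 u1 u2 u3 (- t / 2%:R) 1 (- 1 / 2%:R) 0).
  apply: (mir_eq mir0 (c := 1 / 2%:R)); rewrite ?mulf_neq0 ?invr_eq0 ?oner_neq0 // cE vecE.
  by congr vec; rewrite /h; field; rewrite ?two ?four ?t0.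
have m0111 : mir (vec 0 (1 / 2%:R) (1 / 2%:R) (1 / 2%:R)).
  have := mir_g3 (mir_g2 mir1); rewrite !subr0 => m.
  apply: (mir_eq m (c := 1 / 2%:R)); rewrite ?mulf_neq0 ?invr_eq0 ?oner_neq0 // vecE.
  by congr vec; ring.
have me2 : mir (comb u0 u1 u2 u3 0 0 1 0).
  rewrite cE (_ : vec _ _ _ _ = vec 0 (1 / 2%:R) (1 / 2%:R) (1 / 2%:R)) //.
  by congr vec; ring.
have mc : mir (comb u0 u1 u2 u3 (- 1 / 2%:R) 0 h 1).
  by apply: (mir_eq mir2 h0); rewrite cE vecE; congr vec; field; rewrite ?two ?four.
have ne1 : t ^+ 2 / 4%:R + g + t ^+ 2 / 4%:R = 1 by rewrite /g; field.
have nc : (- 1 / 2%:R) ^+ 2 + g * 0 ^+ 2 + t ^+ 2 * h ^+ 2 + D * 1 ^+ 2 = 1.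
  by rewrite /h /D; field; rewrite ?two ?four ?t0.
have H := complete_of_rotation two F4 gram_sym n0 n1 n2 n3 o01 o02 o03 o12 o13 o23 g0' tt0 D0
  me0 me1 me2 mc ne1 nc (oner_neq0 _) _ t0 three t2 Ft.
rewrite h0 !orbT in H; have {}H := H isT.
case/orP: lr => lr.
  have mq : mir (comb u0 u1 u2 u3 (- t ^+ 3 / 2%:R) (t ^+ 2) (1 - t ^+ 2 / 2%:R) 0).
    rewrite cE (_ : vec _ _ _ _ =
      vec (- 0 + t ^+ 2 * (1 / 2%:R)) (1 / 2%:R) (1 / 2%:R) (1 / 2%:R)); first exact: mir_g0 m0111.
    by congr vec; rewrite /h; field; rewrite ?two ?four ?t0.
  apply: (H _ _ _ _ _ _ _ me0 mq _ _ lr).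
  - move=> c; rewrite !cE vecE; apply/eqP => /vec_inj[e _ _ _].
    by case/eqP: tt0; apply: (mulIf (_ : 2%:R^-1 != 0)); rewrite ?invr_eq0 // mul0r e; ring.
  by rewrite !cE !bform_vec r1 /h; field; rewrite ?two ?four ?t0.
apply: (H _ _ _ _ _ _ _ me0 me1 _ _ lr).
- move=> c; rewrite !cE vecE; apply/eqP => /vec_inj[e _ _ _].
  case/eqP: (oner_neq0 F); apply: (mulIf (_ : 2%:R^-1 != 0)); rewrite ?invr_eq0 // mul0r e; ring.
by rewrite !cE !bform_vec r1 /h; field; rewrite ?two ?four ?t0.
Qed.

(** The chain of the first three roots, whose second angle is [pi / 3]; the
    mirror outside their span is [v1 + v3]. *)
Lemma complete_chain_0_1_2 th : (3%:R : F) = 0 ->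
  prime_span th ->
  mir (vec 0 (1 + th) (- th) 0) -> classes_complete.
Proof.
move=> three Fth mth.
have gam0 : 3%:R - t ^+ 2 != 0 by rewrite three sub0r oppr_eq0 expf_neq0.
pose g := (3%:R - t ^+ 2) / 4%:R; have g0' : g != 0 by rewrite mulf_neq0 ?invr_eq0.
pose b := 2%:R * rh / (3%:R - t ^+ 2).
pose D := rh * (3%:R - t ^+ 2 - rh) / (3%:R - t ^+ 2).
have D0 : D != 0 by rewrite !mulf_neq0 ?invr_eq0.
pose h := (2%:R * t)^-1; have h0 : h != 0 by rewrite invr_eq0 mulf_neq0.
pose u0 : 'cV[F]_4 := vec (1 / 2%:R) 0 0 0.
pose u1 : 'cV[F]_4 := vec (t / 4%:R) h (h / 2%:R) 0.
pose u2 : 'cV[F]_4 := vec 0 0 h 0.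
pose u3 : 'cV[F]_4 := vec (b * (t / 4%:R)) (b * h) (b * (h / 2%:R)) h.
have n0 : bform B u0 u0 = 1 by rewrite bform_vec; field.
have n1 : bform B u1 u1 = g by rewrite bform_vec /g /h; field; rewrite ?two ?four ?t0.
have n2 : bform B u2 u2 = 1 by rewrite bform_vec /h; field; rewrite ?two ?four ?t0.
have n3 : bform B u3 u3 = D.
  by rewrite bform_vec /D /b /h; field; rewrite ?two ?four ?t0 ?gam0.
have o01 : bform B u0 u1 = 0 by rewrite bform_vec /h; field; rewrite ?two ?four ?t0.
have o02 : bform B u0 u2 = 0 by rewrite bform_vec /h; ring.
have o03 : bform B u0 u3 = 0 by rewrite bform_vec /b /h; field; rewrite ?two ?four ?t0 ?gam0.
have o12 : bform B u1 u2 = 0 by rewrite bform_vec /h; field; rewrite ?two ?four ?t0.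
have o13 : bform B u1 u3 = 0 by rewrite bform_vec /b /h; field; rewrite ?two ?four ?t0 ?gam0.
have o23 : bform B u2 u3 = 0 by rewrite bform_vec /b /h; field; rewrite ?two ?four ?t0 ?gam0.
have cE p q r s : comb u0 u1 u2 u3 p q r s =
  vec (p / 2%:R + (q + s * b) * (t / 4%:R)) ((q + s * b) * h)
      ((q + s * b) * (h / 2%:R) + r * h) (s * h).
  by rewrite /comb !vecE; congr vec; ring.
have me0 : mir (comb u0 u1 u2 u3 1 0 0 0).
  by apply: (mir_eq mir0 (c := 1 / 2%:R)); rewrite ?mulf_neq0 ?invr_eq0 ?oner_neq0 // cE vecE; congr vec; ring.
have me1 : mir (comb u0 u1 u2 u3 (- t / 2%:R) 1 (- 1 / 2%:R) 0).
  by apply: (mir_eq mir1 h0); rewrite cE vecE; congr vec; field; rewrite ?two ?four.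
have me2 : mir (comb u0 u1 u2 u3 0 0 1 0).
  by apply: (mir_eq mir2 h0); rewrite cE vecE; congr vec; ring.
have mc : mir (comb u0 u1 u2 u3 (- t / 2%:R) (1 - b) (- 1 / 2%:R) 1).
  have m13 : mir (vec 0 1 0 1) by have := mir_g3 mir1; rewrite subr0.
  by apply: (mir_eq m13 h0); rewrite cE vecE; congr vec; field; rewrite ?two ?four.
have ne1 : t ^+ 2 / 4%:R + g + 1 / 4%:R = 1 by rewrite /g; field.
have nc : (- t / 2%:R) ^+ 2 + g * (1 - b) ^+ 2 + 1 * (- 1 / 2%:R) ^+ 2 + D * 1 ^+ 2 = 1.
  by rewrite /g /b /D; field; rewrite ?two ?four ?gam0.
have a2 : - 1 / 2%:R != 0 :> F by rewrite mulf_neq0 ?oppr_eq0 ?invr_eq0 ?oner_neq0.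
have H := complete_of_parallel two F4 gram_sym n0 n1 n2 n3 o01 o02 o03 o12 o13 o23 g0' (oner_neq0 _) D0
  me0 me1 me2 mc ne1 nc (oner_neq0 _) _ t0 (th := th) three erefl Fth.
rewrite a2 !orbT in H; apply: (H isT).
apply: (mir_eq mth h0); rewrite !cE !vecE; congr vec; field; rewrite ?two ?four //.
Qed.

(** Computable arithmetic of the field with nine elements: [(i, j)] stands for
    [i + j tau], so that words in the generators are evaluated by conversion. *)
Section NineElements.
Hypothesis three : (3%:R : F) = 0.

Definition ev9 (x : nat * nat) : F := x.1%:R + x.2%:R * t.
Definition add9 (x y : nat * nat) := ((x.1 + y.1) %% 3, (x.2 + y.2) %% 3)%N.
Definition mul9 (x y : nat * nat) :=
  ((x.1 * y.1 + x.2 * y.2) %% 3, (x.1 * y.2 + x.2 * y.1 + x.2 * y.2) %% 3)%N.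

Let natr_mod3 n : (n %% 3)%:R = n%:R :> F.
Proof. by rewrite {2}(divn_eq n 3) natrD natrM three mulr0 add0r. Qed.

Lemma ev9_add x y : ev9 (add9 x y) = ev9 x + ev9 y.
Proof. by rewrite /ev9 /add9 /= !natr_mod3 !natrD; ring. Qed.
Lemma ev9_mul x y : ev9 (mul9 x y) = ev9 x * ev9 y.
Proof.
rewrite /ev9 /mul9 /= !natr_mod3 !natrD !natrM.
set a := x.1%:R; set b := x.2%:R; set c := y.1%:R; set d := y.2%:R.
transitivity (a * c + (a * d + b * c) * t + b * d * (t + 1)); first by ring.
by rewrite -t2; ring.
Qed.
Lemma ev9_opp x : ev9 (mul9 (2, 0)%N x) = - ev9 x.
Proof.
rewrite ev9_mul /ev9 /=; apply/eqP; rewrite -subr_eq0.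
rewrite (_ : _ - _ = 3%:R * (x.1%:R + x.2%:R * t)); last by ring.
by rewrite three mul0r.
Qed.

Definition vec9 := ((nat * nat) * (nat * nat) * (nat * nat) * (nat * nat))%type.
Definition ev9_vec (v : vec9) := let: (a, b, c, d) := v in vec (ev9 a) (ev9 b) (ev9 c) (ev9 d).
Definition act9 (r : nat * nat) (i : nat) (v : vec9) : vec9 :=
  let: (a, b, c, d) := v in
  let opp := mul9 (2, 0)%N in
  match i with
  | 0 => (add9 (opp a) (mul9 (1, 1)%N b), b, c, d)
  | 1 => (a, add9 (add9 (add9 a (opp b)) c) (mul9 r d), c, d)
  | 2 => (a, b, add9 b (opp c), d)
  | _ => (a, b, c, add9 b (opp d))
  end.

Lemma mir_act9 r i v : ev9 r = rh -> mir (ev9_vec v) -> mir (ev9_vec (act9 r i v)).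
Proof.
case: v => [[[a b] c] d] er; have e1 : ev9 (1, 1)%N = t ^+ 2 by rewrite t2 /ev9 /=; ring.
case: i => [|[|[|i]]]; rewrite /ev9_vec /act9 ?(ev9_add, ev9_opp) ?ev9_mul ?e1 ?er.
- exact: mir_g0.
- exact: mir_g1.
- exact: mir_g2.
- exact: mir_g3.
Qed.

Lemma mir_word9 r w v : ev9 r = rh -> mir (ev9_vec v) -> mir (ev9_vec (foldr (act9 r) v w)).
Proof. by move=> er mv; elim: w => //= i w IH; exact: mir_act9. Qed.

Lemma mir_word9_root1 r w v : ev9 r = rh ->
  foldr (act9 r) ((0, 0), (1, 0), (0, 0), (0, 0))%N w = v -> mir (ev9_vec v).
Proof.
move=> er <-; apply: mir_word9 => //.
have E0 : ev9 (0, 0)%N = 0 by rewrite /ev9 /=; ring.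
have E1 : ev9 (1, 0)%N = 1 by rewrite /ev9 /=; ring.
by rewrite /ev9_vec E0 E1; exact: mir1.
Qed.

(** In each case a word in the generators takes the second root to a multiple
    of [v1 + th (v1 - v2)] with [th] outside the prime field. For [k = 6] the
    form is singular, [rho] being 3. *)
Lemma complete_nine : k \in [:: 3; 4; 5]%N -> classes_complete.
Proof.
have zero9 (x y : F) z : x - y = 3%:R * z -> x = y.
  by move=> e; apply/eqP; rewrite -subr_eq0 e three mul0r.
have E0 : ev9 (0, 0)%N = 0 by rewrite /ev9 /=; ring.
have F2t : prime_span (2%:R * t).
  move=> u; have [a [b [ka kb ->]]] := Ft u; exists a, (2%:R * b); split=> //.
    by apply: prime_subM => //; exact: prime_sub_nat.
  by apply: (@zero9 _ _ (- (b * t))); ring.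
have F1t : prime_span (1 + t).
  move=> u; have [a [b [ka kb ->]]] := Ft u; exists (a - b), b; split=> //; first exact: prime_subB.
  by ring.
have fin th x y : prime_span th ->
    mir (ev9_vec ((0, 0), x, y, (0, 0))%N) -> forall c, c != 0 ->
    c * ev9 x = 1 + th -> c * ev9 y = - th -> classes_complete.
  move=> Fth m c c0 ex ey; apply: (complete_chain_0_1_2 three Fth).
  by apply: (mir_eq m c0); rewrite /ev9_vec vecZ ex ey E0 mulr0.
rewrite !inE => /or3P[] /eqP k_eq.
- have er : ev9 (1, 0)%N = rh by rewrite k_eq /= rmorph1 /ev9 /=; ring.
  have m := @mir_word9_root1 _ [:: 0; 1; 3; 1; 0; 1; 2; 0; 1; 3; 1; 0]%N
    ((0, 0), (1, 2), (1, 1), (0, 0))%N er erefl.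
  apply: (fin _ _ _ F1t m (-1)); rewrite ?oppr_eq0 ?oner_neq0 // /ev9 /=; last by ring.
  by apply: (@zero9 _ _ (- (1 + t))); ring.
- have er : ev9 (2, 0)%N = rh by rewrite k_eq /= rmorph_nat /ev9 /=; ring.
  have m := @mir_word9_root1 _ [:: 3; 1; 3; 0; 1; 3; 2; 1; 0]%N
    ((0, 0), (1, 2), (0, 1), (0, 0))%N er erefl.
  apply: (fin _ _ _ F2t m 1); rewrite ?oner_neq0 // /ev9 /=; first by ring.
  by apply: (@zero9 _ _ t); ring.
have er : ev9 (1, 1)%N = rh by rewrite k_eq /= rmorphXn t2 /ev9 /=; ring.
have m := @mir_word9_root1 _ [:: 3; 1; 0; 1; 3; 1; 3; 2; 0; 1; 0]%N
  ((0, 0), (1, 2), (0, 1), (0, 0))%N er erefl.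
apply: (fin _ _ _ F2t m 1); rewrite ?oner_neq0 // /ev9 /=; first by ring.
by apply: (@zero9 _ _ t); ring.
Qed.
End NineElements.
End Concrete.

(** * The orthogonal groups *)

Section Final.
Variables (F : finFieldType) (f : {rmorphism ztau -> F}) (k : nat).
Hypothesis two : (2%:R : F) != 0.
Hypothesis F4 : (4 < #|F|)%N.
Local Notation t := (f tau).
Local Notation rh := (f (rho k)).
Local Notation B := (map_mx f (gram k)).
Local Notation G := (reflection_group f k).
Local Notation mir := (mirror B G).
Hypothesis Ft : prime_span t.
Hypothesis Bunit : B \in unitmx.

Let t2 : t ^+ 2 = t + 1. Proof. exact: tau_sqr. Qed.
Let t0 : t != 0. Proof. exact: tau_neq0. Qed.
Let four : 4%:R != 0 :> F. Proof. exact: four_neq0. Qed.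

Let kernel v : B *m v = 0 -> v = 0 :> 'cV_4.
Proof. by move=> Bv; rewrite -[v](mulKmx Bunit) Bv mulmx0. Qed.

(** If [rho] vanishes, the last root lies in the radical. *)
Lemma gram_rho_neq0 : rh != 0.
Proof.
apply/eqP => r0; have := @kernel (vec 0 0 0 1); rewrite gram_vec r0.
rewrite (_ : vec _ _ _ _ = vec 0 0 0 0); last by congr vec; ring.
have z : vec 0 0 0 0 = 0 :> 'cV[F]_4 by apply/matrixP => -[[|[|[|[|i]]]] hi] j; rewrite !mxE.
by rewrite z -z => /(_ erefl)/vec_inj[_ _ _ /eqP]; rewrite oner_eq0.
Qed.

(** The vector [(tau ^ 2, 2, 1, 1)] is orthogonal to all roots but the second,
    and its pairing with that one is a multiple of [3 - tau ^ 2 - rho]. *)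
Lemma gram_disc_neq0 : 3%:R - t ^+ 2 - rh != 0.
Proof.
apply/eqP => r0; have := @kernel (vec (t ^+ 2) 2%:R 1 1); rewrite gram_vec.
rewrite (_ : vec _ _ _ _ = vec 0 (2%:R * t ^+ 2 * (3%:R - t ^+ 2 - rh)) 0 0); last by congr vec; ring.
have z : vec 0 0 0 0 = 0 :> 'cV[F]_4 by apply/matrixP => -[[|[|[|[|i]]]] hi] j; rewrite !mxE.
by rewrite r0 mulr0 z -z => /(_ erefl)/vec_inj[_ _ /eqP]; rewrite oner_eq0.
Qed.

Let long_t4 : (3%:R : F) != 0 -> 2%:R * t - 1 != 0 -> long_rotation (t ^+ 2 * t ^+ 2).
Proof.
move=> three s5; apply/orP; right; set z := t ^+ 2 * t ^+ 2.
have zE : z = 3%:R * t + 2%:R.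
  by rewrite /z {2}t2; transitivity (t * t ^+ 2 + t ^+ 2); [ring | rewrite t2; transitivity (t ^+ 2 + t + (t + 1)); [ring | rewrite t2; ring]].
have z0 : z != 0 by rewrite mulf_neq0 ?expf_neq0.
have -> : z - 1 = (2%:R * t - 1) * t ^+ 2.
  rewrite zE t2; transitivity (2%:R * t ^+ 2 + t - 1); last by ring.
  by rewrite t2; ring.
have -> : z - 2%:R = 3%:R * t by rewrite zE addrK.
have -> : z ^+ 2 - 3%:R * z + 1 = 4%:R * z.
  rewrite zE; transitivity (9%:R * t ^+ 2 + 3%:R * t - 1); first by ring.
  by rewrite t2; ring.
by rewrite !mulf_neq0 ?expf_neq0.
Qed.

(** Outside characteristic 3, a long rotation is found in each diagram: the
    value of [x] is [tau ^ 4] for [k = 3] and [k = 5], [2 tau ^ 2] for [k =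
    4], and 3 for [k = 6]. It fails to be long only for [k = 3] at the prime
    above 5, where [tau ^ 2 = 4] makes the product of the first two
    reflections unipotent; for [k = 5] the form is singular there. *)
Lemma mirrors_complete : k \in [:: 3; 4; 5; 6]%N -> classes_complete f k.
Proof.
have rh0 := gram_rho_neq0; have disc0 := gram_disc_neq0 => hk.
have t1 : 1 - t != 0.
  apply: contraNneq (oner_neq0 F) => e; rewrite -oppr_eq0.
  have -> : -1 = t * (1 - t) by rewrite mulrBr mulr1 -expr2 t2; ring.
  by rewrite e mulr0.
have [three|three] := eqVneq (3%:R : F) 0.
  apply: complete_nine => //; move: hk rh0; rewrite !inE => /or4P[] /eqP -> //.
  by rewrite /= rmorph_nat three eqxx.
have C013 := complete_chain_0_1_3 two rh0 F4 Ft disc0 three.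
move: hk; rewrite !inE => /or4P[] /eqP k_eq.
- have r1 : rh = 1 by rewrite k_eq /= rmorph1.
  apply: complete_chain_1_0_123 => //.
  have [s5|s5] := eqVneq (2%:R * t - 1) 0; last by rewrite long_t4.
  apply/orP; right; apply/orP; left; rewrite t2 -subr_eq0.
  (* squaring [2 tau - 1 = 0] gives [5 = 0], hence [tau = 3] *)
  have five : 5%:R = 0 :> F.
    have <- : (2%:R * t - 1) ^+ 2 = 5%:R; last by rewrite s5 expr0n.
    transitivity (4%:R * t ^+ 2 - 4%:R * t + 1); first by ring.
    by rewrite t2; ring.
  apply/eqP/(mulfI two); rewrite mulr0; transitivity (2%:R * t - 1 - 5%:R); first by ring.
  by rewrite s5 five subr0.
- have r2 : rh = 2%:R by rewrite k_eq /= rmorph_nat.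
  apply: C013; rewrite r2; first by rewrite t2 (_ : _ - _ = 1 - t) //; ring.
  apply/orP; left; apply/orP; right.
  set z := t ^+ 2 * 2%:R; have zE : z = 2%:R * t + 2%:R by rewrite /z t2; ring.
  have s0 : 2%:R * t + 1 != 0.
    apply: contraNneq (oner_neq0 F) => e.
    have -> : 1 = (2%:R * t + 1) * (2%:R * t - 3%:R).
      transitivity (4%:R * t ^+ 2 - 4%:R * t - 3%:R); last by ring.
      by rewrite t2; ring.
    by rewrite e mul0r.
  have -> : z - 1 = 2%:R * t + 1 by rewrite zE; ring.
  have -> : z - 2%:R = 2%:R * t by rewrite zE addrK.
  have -> : z ^+ 2 - 3%:R * z + 1 = 3%:R * (2%:R * t + 1).
    rewrite zE; transitivity (4%:R * t ^+ 2 + 2%:R * t - 1); first by ring.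
    by rewrite t2; ring.
  by rewrite /z !mulf_neq0 ?expf_neq0.
- have r5 : rh = t ^+ 2 by rewrite k_eq /= rmorphXn.
  apply: C013; rewrite r5.
    by rewrite t2 (_ : _ - _ = 2%:R * (1 - t)) ?mulf_neq0 //; ring.
  rewrite long_t4 //; move: disc0; rewrite r5 t2.
  by rewrite (_ : _ - _ = - (2%:R * t - 1)) ?oppr_eq0 //; ring.
have r3 : rh = 3%:R by rewrite k_eq /= rmorph_nat.
apply: C013; rewrite r3.
  by rewrite t2 (_ : _ - _ = - t) ?oppr_eq0 //; ring.
apply/orP; right; apply/orP; right.
have -> : 3%:R - 1 = 2%:R :> F by ring.
have -> : 3%:R - 2%:R = 1 :> F by ring.
have -> : 3%:R ^+ 2 - 3%:R * 3%:R + 1 = 1 :> F by ring.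
by rewrite !mulf_neq0 ?oner_neq0.
Qed.

Lemma full_group_set : group_set (full_orthogonal B).
Proof.
apply/group_setP; split=> [|A A' /fullP iA /fullP iA'].
  by apply/fullP => x y; rewrite -[gl 1%g]/(1%:M) !mul1mx.
by apply/fullP; exact: isometryM.
Qed.

Let rh0 : rh != 0 := gram_rho_neq0.

Lemma gens_refl A : A \in [set GL_map f r0_unit; GL_map f (r1_unit k); GL_map f r2_unit; GL_map f r3_unit] ->
  exists v, [/\ bform B v v != 0, forall x : 'cV[F]_4, gl A *m x = reflection B v x &
    nonzero_square rh -> nonzero_square (bform B v v)].
Proof.
have sq (c : F) : c != 0 -> nonzero_square (c ^+ 2).
  by move=> c0; apply/nonzero_squareP; exists c.
have tt0 : 2%:R * t != 0 by rewrite mulf_neq0.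
rewrite !inE -!orbA => /or4P[] /eqP ->.
- exists (vec 1 0 0 0); rewrite root0_norm; split=> [||_]; [exact: expf_neq0 | exact: g0_refl | exact: sq].
- exists (vec 0 1 0 0); rewrite root1_norm; split=> [||_]; [exact: expf_neq0 | exact: g1_refl | exact: sq].
- exists (vec 0 0 1 0); rewrite root2_norm; split=> [||_]; [exact: expf_neq0 | exact: g2_refl | exact: sq].
exists (vec 0 0 0 1); rewrite root3_norm; split=> [||/nonzero_squareP[c c0 ->]].
- by rewrite mulf_neq0 ?expf_neq0.
- exact: g3_refl.
by rewrite -exprMn; apply: sq; rewrite mulf_neq0.
Qed.

Lemma group_sub_full : G \subset full_orthogonal B.
Proof.
rewrite (gen_subG _ (Group full_group_set)); apply/subsetP => A /gens_refl[v [v0 hA _]].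
by apply/fullP => x y; rewrite !hA refl_isom //; exact: gram_sym.
Qed.

Lemma group_sub_O1 : nonzero_square rh -> G \subset orthogonal1 B.
Proof.
move=> rsq; rewrite gen_subG; apply/subsetP => A /gens_refl[v [v0 hA sq]].
apply: mem_gen; rewrite inE; apply/existsP; exists v; rewrite sq //=.
by apply/forallP => x; apply/eqP; exact: hA.
Qed.

Hypothesis hk : k \in [:: 3; 4; 5; 6]%N.

(** Every vector of square norm has the norm of a multiple of the first root.
    *)
Lemma mirror_square v : nonzero_square (bform B v v) -> mir v.
Proof.
case/nonzero_squareP => c c0 vc.
apply: (mirrors_complete hk (v := (c / 2%:R) *: vec 1 0 0 0)).
  by apply: (mirror_scal (gram_sym f k)); rewrite ?mulf_neq0 ?invr_eq0 //; exact: mir0.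
by rewrite vc bformZl (bformZr (gram_sym f k)) root0_norm; field.
Qed.

Lemma O1_sub_group : orthogonal1 B \subset G.
Proof.
rewrite gen_subG; apply/subsetP => A; rewrite inE => /existsP[v /andP[/mirror_square]].
case/mirrorP => v0 [A' GA' hA'] /forallP hA.
suff -> : A = A' by [].
by apply: gl_ext => x; rewrite hA'; apply/eqP; exact: hA.
Qed.

(** The last root represents the nonsquare norms and the first one the
    squares, so all reflections are available. The vector [w] is the one of
    [gram_disc_neq0]; with the pairwise orthogonal first, third and fourth
    roots it forms an orthogonal basis. *)
Lemma full_sub_group : ~~ nonzero_square rh -> full_orthogonal B \subset G.
Proof.
move=> nsq; have all_mir v : bform B v v != 0 -> mir v.
  move=> v0; have [sq|nv] := boolP (nonzero_square (bform B v v)); first exact: mirror_square.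
  have n3 : bform B (vec 0 0 0 1) (vec 0 0 0 1) = rh * (2%:R * t) ^+ 2 by exact: root3_norm.
  have tt0 : 2%:R * t != 0 by rewrite mulf_neq0.
  have nn3 : ~~ nonzero_square (rh * (2%:R * t) ^+ 2).
    apply: contraNN nsq => /nonzero_squareP[c c0 e]; apply/nonzero_squareP.
    exists (c / (2%:R * t)); first by rewrite mulf_neq0 ?invr_eq0.
    by rewrite expr_div_n -e mulfK ?expf_neq0.
  have [c c0 e] := square_class two (mulf_neq0 rh0 (expf_neq0 2 tt0)) v0 nn3 nv.
  apply: (mirrors_complete hk (v := c *: vec 0 0 0 1)).
    by apply: (mirror_scal (gram_sym f k)) => //; exact: mir3.
  by rewrite e bformZl (bformZr (gram_sym f k)) n3; ring.
pose w : 'cV[F]_4 := vec (t ^+ 2) 2%:R 1 1.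
have disc0 := gram_disc_neq0; have tt0 : t ^+ 2 != 0 by rewrite expf_neq0.
apply: (full_orthogonal_sub two (gram_sym f k) all_mir (u0 := vec 1 0 0 0)
  (u1 := vec 0 0 1 0) (u2 := vec 0 0 0 1) (u3 := w)).
- by rewrite root0_norm expf_neq0.
- by rewrite root2_norm // expf_neq0 ?mulf_neq0.
- by rewrite root3_norm // !mulf_neq0 ?expf_neq0 ?mulf_neq0.
- suff -> : bform B w w = 4%:R * t ^+ 2 * (3%:R - t ^+ 2 - rh) by rewrite !mulf_neq0.
  by rewrite bform_vec; ring.
- by rewrite bform_vec; ring.
- by rewrite bform_vec; ring.
- by rewrite bform_vec; ring.
- by rewrite bform_vec; ring.
- by rewrite bform_vec; ring.
- by rewrite bform_vec; ring.
move=> v; have [a [b [c [d ->]]]] := vecP v.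
exists (a - b / 2%:R * t ^+ 2), (c - b / 2%:R), (d - b / 2%:R), (b / 2%:R).
by rewrite /comb /w !vecE; congr vec; field.
Qed.
End Final.

Theorem theorem3p2 (k : nat) (hk : k \in [:: 3; 4; 5; 6]%N)
    (p : ztau) (hp : zt_prime p) (hodd : zt_odd p)
    (q : nat) (hq : q = `|zt_norm p|%N)
    (hg : map_mx (zt_red hp) (gram k) \in unitmx)
    (hc : map_mx (zt_red hp) (cartan k) \in unitmx) :
  let eps := legendre hp (\det (gram k)) in
  let B := map_mx (zt_red hp) (gram k) in
  is_O B q eps (reflection_group (zt_red hp) k) \/
  is_O1 B q eps (reflection_group (zt_red hp) k).
Proof.
move=> eps B; have [p0 pu _] := hp.
have redP a : reflect (zt_dvd p a) (zt_red hp a == 0) by exact: zt_mod_eq0.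
have red_surj x : exists a, zt_red hp a == x.
  by have [a e] := zt_mod_surj x; exists a; apply/eqP.
have two := two_neq0 redP p0 pu hodd.
have F4 := card_residue_gt4 redP p0 pu hodd.
have Ft := residue_span red_surj.
have space : orth_space B q eps.
  split.
  - by rewrite (card_residue redP red_surj p0) hq.
  - rewrite hq -(card_residue redP red_surj p0).
    exact: (card_residue_odd redP p0 pu hodd).
  - by [].
  - exact: conj (gram_sym (zt_red hp) k) hg.
  rewrite /orth_sign /eps /legendre (_ : (-1) ^+ 4./2 = 1) ?mul1r; last by rewrite sqrrN expr1n.
  by have := hg; rewrite unitmxE unitfE det_map_mx => /negbTE ->.
have [sq|nsq] := boolP (nonzero_square (zt_red hp (rho k))); [right|left]; split=> //.
  by apply/eqP; rewrite eqEsubset (group_sub_O1 two hg) // (O1_sub_group two F4 Ft hg).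
by apply/eqP; rewrite eqEsubset (group_sub_full two hg) (full_sub_group two F4 Ft hg).
Qed.
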